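(* Let $0\le p\le n$ and, for $\lambda\in\mathbb{C}$, let $P^{p}(\lambda)$ be the second order differential operator on $p$-form-valued tempered distributions on $\mathbb{R}^n$ $$\begin{aligned}P^p(\lambda)=&-(2\lambda-n-2)(\lambda-n+p-1)(\lambda-p)\partial_n\\&-(2\lambda-n-2)\big[(\lambda-n+p)\,\varepsilon_{e_n}\delta+(\lambda-p)\,d\,i_{e_n}\big]\\&-(\lambda-n+p-1)(\lambda-p)\,x_n\,\delta d-(\lambda-n+p)(\lambda-p-1)\,x_n\,d\delta.\end{aligned}$$ Then the distribution kernels $K^{(p),\pm}_{\lambda,\nu}(x',x_n)$ satisfy $$P^{p}(\lambda)K^{(p),\pm}_{\lambda,\nu}(x',x_n)=(\lambda+\nu-n)(\nu-\lambda+1)(\lambda-n+p-1)(\lambda-p)\,K^{(p),\mp}_{\lambda-1,\nu}(x',x_n).$$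
   Context: Let $n\ge 2$, $\lambda,\nu\in\mathbb{C}$, $x=(x',x_n)\in\mathbb{R}^n$ with $x'\in\mathbb{R}^{n-1}$, and $e_1,\dots,e_n$ the standard basis. $i_{e_k}$ and $\varepsilon_{e_k}$ are the interior and exterior products with $e_k$ on differential forms; $i_x=\sum_k x_ki_{e_k}$, $\varepsilon_x=\sum_kx_k\varepsilon_{e_k}$. $d=\sum_{k=1}^n\varepsilon_{e_k}\partial_k$ and $\delta=-\sum_{k=1}^n i_{e_k}\partial_k$. Put $$K^+_{\lambda,\nu}(x',x_n)=|x_n|^{\lambda+\nu-n}(|x'|^2+x_n^2)^{-\nu},\qquad K^-_{\lambda,\nu}(x',x_n)=\mathrm{sgn}(x_n)|x_n|^{\lambda+\nu-n}(|x'|^2+x_n^2)^{-\nu},$$ and define the kernels with values in endomorphisms of $p$-forms $$K^{(p),\pm}_{\lambda,\nu}(x',x_n)=K^\pm_{\lambda-1,\nu+1}(x',x_n)\,(i_x\varepsilon_x-\varepsilon_xi_x)\,i_{e_n}\varepsilon_{e_n}.$$ They are locally integrable for $\Re(\lambda+\nu)>n-1$ and $\Re(\lambda-\nu)>0$, and are understood as distributions depending meromorphically on $(\lambda,\nu)\in\mathbb{C}^2$; identities between them are identities of such meromorphic families. A differential operator acts on an endomorphism-valued distribution $T$ by acting on $T\omega_0$ for every constant-coefficient $p$-form $\omega_0$. Upper (respectively lower) signs correspond. *)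

(* Defs.v *)
From HB Require Import structures.
From mathcomp Require Import all_boot all_order all_algebra.
From mathcomp Require Import complex.
From mathcomp Require Import all_classical all_reals all_analysis.

Set Implicit Arguments.
Unset Strict Implicit.
Unset Printing Implicit Defensive.

Import Order.TTheory GRing.Theory Num.Theory numFieldNormedType.Exports.

Local Open Scope classical_set_scope.
Local Open Scope complex_scope.
Local Open Scope ring_scope.

(* Throughout, R^n is 'rV[R]_n, indexed from 0; when the last coordinate x_n
   is needed the dimension is written n.+1 and x_n is x 0 ord_max. *)

(* A form with coefficients in V: [w I] is the coefficient of the basis
   element e_I = e_(i_1) /\ ... /\ e_(i_p), where I = {i_1 < ... < i_p}.
   V is the field of complex numbers for constant forms and the space of
   distributions for distribution-valued forms. *)
Notation extform n V := ({set 'I_n} -> V).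

Section ExteriorAlgebra.
Variables (n : nat) (V : zmodType).

Definition is_pform (p : nat) (w : extform n V) : Prop :=
  forall I : {set 'I_n}, #|I| != p -> w I = 0.

Definition nbelow (k : 'I_n) (I : {set 'I_n}) : nat :=
  #|[set i in I | (i < k)%N]|.

(* e_k /\ e_I = (-1)^(nbelow k I) e_(k |: I) if k is not in I, 0 otherwise *)
Definition ext_basis (k : 'I_n) (w : extform n V) : extform n V :=
  fun I => if k \in I then w (I :\ k) *~ ((-1) ^+ nbelow k I) else 0.

(* i_(e_k) e_I = (-1)^(nbelow k I) e_(I :\ k) if k is in I, 0 otherwise *)
Definition int_basis (k : 'I_n) (w : extform n V) : extform n V :=
  fun I => if k \in I then 0 else w (k |: I) *~ ((-1) ^+ nbelow k I).

End ExteriorAlgebra.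

Section ConstantForms.
Variables (R : realType) (n : nat).
Local Notation C := (R[i]^o).

Definition ext_vec (x : 'rV[R]_n) (w : extform n C) : extform n C :=
  \sum_k (x 0 k)%:C *: ext_basis k w.

Definition int_vec (x : 'rV[R]_n) (w : extform n C) : extform n C :=
  \sum_k (x 0 k)%:C *: int_basis k w.

End ConstantForms.

Section Distributions.
Variables (R : realType) (n : nat).
Local Notation C := (R[i]^o).

Definition partial (k : 'I_n) (f : 'rV[R]_n -> R) : 'rV[R]_n -> R :=
  fun x => 'D_(delta_mx 0 k) f x.

Definition partials (s : seq 'I_n) (f : 'rV[R]_n -> R) : 'rV[R]_n -> R :=
  foldr partial f s.

Definition schwartz (f : 'rV[R]_n -> R) : Prop :=
  (forall s x, differentiable (partials s f) x) /\
  (forall s m, exists M : R, forall x,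
     (1 + `|x|) ^+ m * `|partials s f x| <= M).

(* Complex-valued distributions are given by their values on real-valued test
   functions: C-linear functionals on S(R^n; C) are the same thing as R-linear
   maps from S(R^n; R) to C. Such a map is represented by a total function, of
   which only the values on Schwartz functions are meaningful. *)
Definition dist := ('rV[R]_n -> R) -> C.

Definition tempered (T : dist) : Prop :=
  (forall (a : R) f g, schwartz f -> schwartz g ->
     T (fun x => a * f x + g x) = a%:C * T f + T g) /\
  (exists (m : nat) (A : R), forall f (M : R), schwartz f ->
     (forall s x, (size s <= m)%N ->
        (1 + `|x|) ^+ m * `|partials s f x| <= M) ->
     `|T f| <= (A * M)%:C).

Definition dist_partial (k : 'I_n) (T : dist) : dist :=
  fun f => - T (partial k f).

Definition dist_coord (k : 'I_n) (T : dist) : dist :=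
  fun f => T (fun x => x 0 k * f x).

Definition form_partial (k : 'I_n) (w : extform n dist) : extform n dist :=
  fun I => dist_partial k (w I).

Definition form_coord (k : 'I_n) (w : extform n dist) : extform n dist :=
  fun I => dist_coord k (w I).

Definition ext_deriv (w : extform n dist) : extform n dist :=
  \sum_k ext_basis k (form_partial k w).

Definition coderiv (w : extform n dist) : extform n dist :=
  - \sum_k int_basis k (form_partial k w).

(* Distributions with values in the endomorphisms of p-forms; [T w] is the
   p-form-valued distribution obtained by applying T to the constant form w. *)
Definition endo_dist := extform n C -> extform n dist.

Definition endo_tempered (p : nat) (T : endo_dist) : Prop :=
  [/\ forall (a : C) w w' I f, is_pform p w -> is_pform p w' -> schwartz f ->
        T (a *: w + w') I f = a * T w I f + T w' I f,
      forall w I, is_pform p w -> tempered (T w I) &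
      forall w (I : {set 'I_n}) f,
        is_pform p w -> schwartz f -> #|I| != p -> T w I f = 0].

End Distributions.

Section MeromorphicFamilies.
Variables (R : realType) (n : nat).
Local Notation C := (R[i]^o).

(* The double power series of f at a converges absolutely to f on a polydisc of
   radius r. Inequalities are those of R[i], hence between real numbers: in
   particular 0 < r says that r is a positive real. *)
Definition analytic_at (f : C * C -> C) (a : C * C) : Prop :=
  exists (c : nat -> nat -> C) (r M : C),
    [/\ 0 < r,
        forall N : nat,
          \sum_(j < N) \sum_(k < N) `|c j k| * r ^+ j * r ^+ k <= M &
        forall z : C * C, `|z.1 - a.1| < r -> `|z.2 - a.2| < r ->
          (fun N : nat => \sum_(j < N) \sum_(k < N)
             c j k * (z.1 - a.1) ^+ j * (z.2 - a.2) ^+ k : C) @ \oo --> f z].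

Definition holomorphic_on (U : set (C * C)) (f : C * C -> C) : Prop :=
  forall a, U a -> analytic_at f a.

(* T is a meromorphic family on C^2 of distributions with values in the
   endomorphisms of p-forms, and T is holomorphic on W. Locally there is a
   holomorphic g, not vanishing identically near any point, such that g T
   extends holomorphically and T can be singular only where g vanishes. *)
Definition meromorphic_family (p : nat) (W : set (C * C))
    (T : C * C -> endo_dist R n) : Prop :=
  [/\ open W,
      forall z, W z -> endo_tempered p (T z),
      forall w I f, is_pform p w -> schwartz f ->
        holomorphic_on W (fun z => T z w I f) &
      forall a : C * C, exists (U : set (C * C)) (g : C * C -> C),
        [/\ open U /\ U a,
            holomorphic_on U g,
            forall b (V : set (C * C)), U b -> open V -> V b ->
              exists z, [/\ U z, V z & g z != 0],
            forall z, U z -> g z != 0 -> W z &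
            forall w I f, is_pform p w -> schwartz f ->
              exists2 h : C * C -> C, holomorphic_on U h &
                forall z, U z -> W z -> g z * T z w I f = h z]].

End MeromorphicFamilies.

Section Integration.
Variable R : realType.

(* Lebesgue integral over R^n as an iterated integral; by Fubini's theorem it
   is the integral against n-dimensional Lebesgue measure whenever f is
   integrable, which is the only case in which it is used. *)
Fixpoint integral_rV (n : nat) : ('rV[R]_n -> R) -> R :=
  match n with
  | 0%N => fun f => f 0
  | m.+1 => fun f =>
      \int[lebesgue_measure]_(t in [set: R])
        integral_rV (fun y : 'rV[R]_m =>
                       f (row_mx (const_mx t : 'rV[R]_1) y))
  end.

Definition cintegral_rV (n : nat) (f : 'rV[R]_n -> R[i]) : R[i] :=
  integral_rV (fun x => complex.Re (f x)) +i* integral_rV (fun x => complex.Im (f x)).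

End Integration.

Section Kernels.
Variables (R : realType) (n : nat).
Local Notation C := (R[i]^o).

(* t^z = exp (z log t) for t > 0; for t = 0, which occurs only on a null set,
   the value is irrelevant. *)
Definition cpow (t : R) (z : C) : C :=
  (t `^ complex.Re z)%:C * (cos (complex.Im z * ln t) +i* sin (complex.Im z * ln t)).

(* K^+_(l,nu) for s = true and K^-_(l,nu) for s = false, on R^(n+1) *)
Definition kern (s : bool) (l nu : C) (x : 'rV[R]_n.+1) : C :=
  (if s then 1 else (Num.sg (x 0 ord_max))%:C)
  * cpow `|x 0 ord_max| (l + nu - n.+1%:R)
  * cpow (\sum_k x 0 k ^+ 2) (- nu).

Definition kernp (s : bool) (l nu : C) (x : 'rV[R]_n.+1) (w : extform n.+1 C) :
    extform n.+1 C :=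
  let w' := int_basis ord_max (ext_basis ord_max w) in
  kern s (l - 1) (nu + 1) x *:
    (int_vec x (ext_vec x w') - ext_vec x (int_vec x w')).

Definition integrable_region : set (C * C) :=
  [set z | n.+1%:R - 1 < complex.Re (z.1 + z.2) /\ 0 < complex.Re (z.1 - z.2)].

(* T is the meromorphic continuation of the family of locally integrable
   kernels kernp s, and T is holomorphic on W. *)
Definition kernel_continuation (p : nat) (s : bool) (W : set (C * C))
    (T : C * C -> endo_dist R n.+1) : Prop :=
  [/\ meromorphic_family p W T,
      integrable_region `<=` W &
      forall z, integrable_region z ->
      forall w I f, is_pform p w -> schwartz f ->
        T z w I f = cintegral_rV (fun x => kernp s z.1 z.2 x w I * (f x)%:C)].

Definition Pop (p : nat) (l : C) (w : extform n.+1 (dist R n.+1)) :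
    extform n.+1 (dist R n.+1) :=
  let N : C := n.+1%:R in
  let q : C := p%:R in
  let en := @ord_max n in
  - (((2 * l - N - 2) * (l - N + q - 1) * (l - q)) *: form_partial en w)
  - (2 * l - N - 2) *:
      ((l - N + q) *: (ext_basis en (coderiv w))
       + (l - q) *: (ext_deriv (int_basis en w)))
  - ((l - N + q - 1) * (l - q)) *:
      (form_coord en (coderiv (ext_deriv w)))
  - ((l - N + q) * (l - q - 1)) *:
      (form_coord en (ext_deriv (coderiv w))).

End Kernels.

(* Main.v *)
From HB Require Import structures.
Require Import Defs.
From mathcomp Require Import all_boot all_order all_algebra.
From mathcomp Require Import complex ring lra.
From mathcomp Require Import all_classical all_reals all_analysis.
From mathcomp Require Import measurable_realfun.

Set Implicit Arguments.
Unset Strict Implicit.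
Unset Printing Implicit Defensive.

Import Order.TTheory GRing.Theory Num.Theory numFieldNormedType.Exports.

Local Open Scope classical_set_scope.
Local Open Scope complex_scope.
Local Open Scope ring_scope.

(** Both sides of the identity are meromorphic in (lambda, nu), so it is enough
    to prove it for real parameters in some box, and there one may take the
    exponents as large as one likes: with N the dimension, the kernel is
        A(x) eta(x),   A = (1 or sgn x_n) |x_n|^a |x|^(2b),
        eta(x) = (i_x eps_x - eps_x i_x) w',   w' = i_(e_n) eps_(e_n) w,
    where a = lambda + nu - N and b = - nu - 1.  When a and b exceed 4 this is
    a function of class C^2 and of polynomial growth, its distributional
    derivatives are the classical ones, and the theorem becomes an identity
    between two functions of x.

    Pointwise identity.  Put t = x_n and r = |x|^2.  The function A and all its
    derivatives of order at most two are polynomials in x times the single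
    function B = |t|^(a-2) r^(b-2), with the sign of A, while eta is quadratic
    in x.  The Clifford relations and the number operator (the sum of the
    eps_(e_k) i_(e_k), which is multiplication by p on p-forms) reduce every
    double sum over coordinates in P^p(lambda)(A eta) to a combination of w',
    eps_x i_x w' and eps_(e_n) i_x w'.  Comparing the three coefficients is
    commutative algebra ([pointwise_identity]).

    Integration by parts.  The integral over R^N is iterated, so differentiating
    under an inner integral is best avoided.  Instead, it is invariant under
    translations, one variable at a time; difference quotients therefore have
    integral zero, and dominated convergence gives integral zero to partial
    derivatives ([integral_partial_eq0]).

    Continuation.  A function given near each point by absolutely convergent
    double power series is, along each coordinate line, a power series in one
    variable, and a power series whose zeros accumulate at its centre vanishes.
    Moving along segments, one coordinate at a time, extends vanishing from real
    parameters to complex ones ([real_identity]) and from a small polydisc to a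
    large one ([polydisc_identity]).  The difference of the two sides need not
    be defined everywhere, but locally it is a quotient whose denominator is
    nonzero on a dense set, so its vanishing propagates along the straight path
    from the box to any given point ([meromorphic_identity]). *)

(** * Anticommutation relations of exterior and interior products *)
Section Signs.
Variable n : nat.
Implicit Types (j k : 'I_n) (I : {set 'I_n}).

(** The sign of the exchange of two distinct basis vectors: with it, inserting
    or deleting an index changes the sign [(-1) ^+ nbelow k I] by a factor that
    is antisymmetric in the two indices. All anticommutation relations come from
    this antisymmetry ([order_sign_swap]). *)
Definition order_sign j k : int := if (j < k)%N then -1 else 1.

Lemma order_sign_swap j k : j != k -> order_sign k j = - order_sign j k.
Proof.
rewrite /order_sign => jk; case: ltngtP => // kj.
by move: jk; rewrite -val_eqE /= kj eqxx.
Qed.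

Lemma sign_nbelowU j k I : j \notin I ->
  (-1) ^+ nbelow k (j |: I) = order_sign j k * (-1) ^+ nbelow k I :> int.
Proof.
move=> jI; rewrite /order_sign /nbelow; case: ifPn => jk.
  have -> : [set i in j |: I | (i < k)%N] = j |: [set i in I | (i < k)%N].
    by apply/setP => i; rewrite !inE; case: eqVneq => // ->; rewrite jk.
  by rewrite cardsU1 inE (negbTE jI) /= exprS.
rewrite mul1r; congr (_ ^+ #|pred_of_set _|); apply/setP => i; rewrite !inE.
by case: eqVneq => // ->; rewrite (negbTE jk) !andbF.
Qed.

Lemma sign_nbelowD j k I : j \in I ->
  (-1) ^+ nbelow k (I :\ j) = order_sign j k * (-1) ^+ nbelow k I :> int.
Proof.
move=> jI; have := sign_nbelowU k (negbT (finset.setD11 j I)); rewrite finset.setD1K// => ->.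
by rewrite mulrA /order_sign; case: ifP; rewrite ?mulrNN !mul1r.
Qed.

Lemma sign_nbelow_sqr k I :
  (-1) ^+ nbelow k I * (-1) ^+ nbelow k I = 1 :> int.
Proof. by rewrite -exprD addnn -mul2n exprM sqrrN expr1n. Qed.

Lemma nbelowD1 k I : nbelow k (I :\ k) = nbelow k I.
Proof.
congr #|pred_of_set _|; apply/setP => i; rewrite !inE.
by case: eqVneq => // ->; rewrite ltnn !andbF.
Qed.

Lemma nbelowU1 k I : nbelow k (k |: I) = nbelow k I.
Proof.
congr #|pred_of_set _|; apply/setP => i; rewrite !inE.
by case: eqVneq => // ->; rewrite ltnn !andbF.
Qed.

End Signs.

Section CliffordRelations.
Variables (n : nat) (V : zmodType).
Implicit Types (w : extform n V) (j k : 'I_n).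

Lemma ext_basis_anticomm j k w :
  ext_basis j (ext_basis k w) = - ext_basis k (ext_basis j w).
Proof.
apply/funext => I; rewrite opprfctE /ext_basis !inE.
have [->|jk] := eqVneq j k; first by rewrite ?eqxx /=; case: ifP; rewrite ?mul0rz oppr0.
rewrite ?(eq_sym k) ?jk /=.
have [jI|jI] := boolP (j \in I); have [kI|kI] := boolP (k \in I);
  rewrite ?mul0rz ?oppr0//.
rewrite !sign_nbelowD// (order_sign_swap jk) finset.setDDl finset.setUC -finset.setDDl.
by rewrite -!mulrzA -mulrNz mulNr mulNr opprK mulrAC.
Qed.

Lemma int_basis_anticomm j k w :
  int_basis j (int_basis k w) = - int_basis k (int_basis j w).
Proof.
apply/funext => I; rewrite opprfctE /int_basis !inE.
have [->|jk] := eqVneq j k; first by rewrite ?eqxx /=; case: ifP; rewrite ?mul0rz oppr0.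
rewrite ?(eq_sym k) ?jk /=.
have [jI|jI] := boolP (j \in I); have [kI|kI] := boolP (k \in I);
  rewrite ?mul0rz ?oppr0//.
rewrite !sign_nbelowU// (order_sign_swap jk) finset.setUCA.
by rewrite -!mulrzA -mulrNz mulNr mulNr opprK mulrAC.
Qed.

Lemma ext_basis_sqr k w : ext_basis k (ext_basis k w) = 0.
Proof.
by apply/funext => I; rewrite /ext_basis !inE eqxx /= mul0rz; case: ifP.
Qed.

Lemma int_basis_sqr k w : int_basis k (int_basis k w) = 0.
Proof.
by apply/funext => I; rewrite /int_basis !inE eqxx /= mul0rz; case: ifP.
Qed.

Lemma int_ext_basis j k w :
  int_basis j (ext_basis k w) = w *+ (j == k) - ext_basis k (int_basis j w).
Proof.
apply/funext => I; rewrite addrfctE opprfctE /int_basis /ext_basis !inE.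
have [->|jk] := eqVneq j k.
  rewrite /=; case: ifP => kI.
    rewrite finset.setD1K// nbelowD1 -mulrzA sign_nbelow_sqr.
    by rewrite mulr1z subrr.
  by rewrite subr0 nbelowU1 -mulrzA sign_nbelow_sqr finset.setU1K// kI.
rewrite ?(eq_sym k) ?(negbTE jk) /= sub0r.
have [jI|jI] := boolP (j \in I); have [kI|kI] := boolP (k \in I);
  rewrite ?mul0rz ?oppr0//.
rewrite sign_nbelowU// sign_nbelowD// (order_sign_swap jk).
rewrite -!mulrzA -mulrNz mulNr mulNr opprK mulrAC.
congr (w _ *~ _); apply/setP => i; rewrite !inE.
by have [->|] := eqVneq i j; rewrite ?(negbTE jk)// andbT.
Qed.

(** In the coefficient of e_I the term of index k is that coefficient when k
    belongs to I, the two signs being equal, and 0 otherwise. *)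
Lemma number_operator p w : is_pform p w ->
  \sum_k ext_basis k (int_basis k w) = w *+ p.
Proof.
move=> wp; apply/funext => I; rewrite fct_sumE.
rewrite (eq_bigr (fun k => if k \in I then w I else 0)); last first.
  move=> k _; rewrite /ext_basis /int_basis !inE eqxx /=; case: ifP => // kI.
  by rewrite finset.setD1K// nbelowD1 -mulrzA sign_nbelow_sqr mulr1z.
rewrite -big_mkcond /= sumr_const.
have -> : (w *+ p) I = w I *+ p by elim: p {wp} => // q IH; rewrite !mulrS -IH.
by have [->//|/wp ->] := eqVneq #|I| p; rewrite !mul0rn.
Qed.

Lemma is_pform_int_ext p j k w : is_pform p w ->
  is_pform p (int_basis j (ext_basis k w)).
Proof.
move=> wp I Ip; rewrite /int_basis /ext_basis; case: ifP => // jI.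
case: ifP => kI; last by rewrite mul0rz.
rewrite wp ?mul0rz//; move: Ip; apply: contra => /eqP <-.
apply/eqP; have := cardsD1 k (j |: I); rewrite kI finset.cardsU1 jI !add1n. by case.
Qed.

End CliffordRelations.

Section Naturality.
Variables (n : nat) (V V' : zmodType) (phi : {additive V -> V'}).
(** Signs are integers, so both basis operations commute with every additive map
    of coefficients; this is used to compare real and complex forms. *)
Lemma ext_basis_map k (w : extform n V) :
  ext_basis k (fun I => phi (w I)) = fun I => phi (ext_basis k w I).
Proof. by apply/funext => I; rewrite /ext_basis; case: ifP; rewrite ?raddf0// raddfMz. Qed.
Lemma int_basis_map k (w : extform n V) :
  int_basis k (fun I => phi (w I)) = fun I => phi (int_basis k w I).
Proof. by apply/funext => I; rewrite /int_basis; case: ifP; rewrite ?raddf0// raddfMz. Qed.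
End Naturality.

Section Linearity.
Variables (K : pzRingType) (n : nat) (V : lmodType K) (k : 'I_n).

Lemma ext_basis_is_linear : linear (@ext_basis n V k).
Proof.
move=> a u v; apply/funext => I; rewrite /ext_basis !fctE.
by case: ifP => _; rewrite ?scaler0 ?addr0// mulrzDl scalerMzr.
Qed.

Lemma int_basis_is_linear : linear (@int_basis n V k).
Proof.
move=> a u v; apply/funext => I; rewrite /int_basis !fctE.
by case: ifP => _; rewrite ?scaler0 ?addr0// mulrzDl scalerMzr.
Qed.

HB.instance Definition _ :=
  GRing.isLinear.Build K (extform n V) (extform n V) _ (@ext_basis n V k)
    ext_basis_is_linear.
HB.instance Definition _ :=
  GRing.isLinear.Build K (extform n V) (extform n V) _ (@int_basis n V k)
    int_basis_is_linear.
End Linearity.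

Section VectorOperators.
Variables (K : numFieldType) (n : nat).
Local Notation form := (extform n (K^o)).
Variables (x : 'I_n -> K).
Implicit Types (u w : form).

Definition exterior_by u : form := \sum_k x k *: ext_basis k u.
Definition interior_by u : form := \sum_k x k *: int_basis k u.

Lemma exterior_by_is_linear : linear exterior_by.
Proof.
move=> a u v; rewrite /exterior_by scaler_sumr -big_split /=.
by apply: eq_bigr => k _; rewrite linearP scalerDr !scalerA mulrC.
Qed.
Lemma interior_by_is_linear : linear interior_by.
Proof.
move=> a u v; rewrite /interior_by scaler_sumr -big_split /=.
by apply: eq_bigr => k _; rewrite linearP scalerDr !scalerA mulrC.
Qed.
HB.instance Definition _ :=
  GRing.isLinear.Build K form form _ exterior_by exterior_by_is_linear.
HB.instance Definition _ :=
  GRing.isLinear.Build K form form _ interior_by interior_by_is_linear.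

Lemma sumZ_delta (F : 'I_n -> form) j : \sum_k (k == j)%:R *: F k = F j.
Proof.
rewrite (bigD1 j)//= eqxx scale1r big1 ?addr0// => k /negbTE ->.
by rewrite scale0r.
Qed.

Lemma int_ext_basisZ j k w :
  int_basis j (ext_basis k w) = (k == j)%:R *: w - ext_basis k (int_basis j w).
Proof. by rewrite int_ext_basis scaler_nat eq_sym. Qed.

Lemma ext_int_basisZ j k w :
  ext_basis k (int_basis j w) = (k == j)%:R *: w - int_basis j (ext_basis k w).
Proof. by rewrite int_ext_basisZ opprB addrC subrK. Qed.

Lemma int_exterior_by j w :
  int_basis j (exterior_by w) = x j *: w - exterior_by (int_basis j w).
Proof.
rewrite /exterior_by linear_sum /=.
rewrite (eq_bigr (fun k => (k == j)%:R *: (x k *: w)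
    - x k *: ext_basis k (int_basis j w))).
  by rewrite big_split /= sumZ_delta sumrN.
by move=> k _; rewrite linearZ /= int_ext_basisZ scalerBr !scalerA mulrC.
Qed.

Lemma ext_exterior_by j w :
  ext_basis j (exterior_by w) = - exterior_by (ext_basis j w).
Proof.
rewrite /exterior_by linear_sum -sumrN /=; apply: eq_bigr => k _.
by rewrite linearZ /= (ext_basis_anticomm j) scalerN.
Qed.

Lemma int_interior_by j w :
  int_basis j (interior_by w) = - interior_by (int_basis j w).
Proof.
rewrite /interior_by linear_sum -sumrN /=; apply: eq_bigr => k _.
by rewrite linearZ /= (int_basis_anticomm j) scalerN.
Qed.

Lemma ext_interior_by j w :
  ext_basis j (interior_by w) = x j *: w - interior_by (ext_basis j w).
Proof.
rewrite /interior_by linear_sum /=.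
rewrite (eq_bigr (fun k => (k == j)%:R *: (x k *: w)
    - x k *: int_basis k (ext_basis j w))).
  by rewrite big_split /= sumZ_delta sumrN.
by move=> k _; rewrite linearZ /= ext_int_basisZ scalerBr !scalerA mulrC (eq_sym j).
Qed.

Definition sqnorm : K := \sum_k x k ^+ 2.

Lemma interior_exterior_by w :
  interior_by (exterior_by w) = sqnorm *: w - exterior_by (interior_by w).
Proof.
rewrite {1}/interior_by.
under eq_bigr do rewrite int_exterior_by scalerBr scalerA -expr2.
rewrite big_split /= -scaler_suml sumrN; congr (_ - _).
by rewrite /interior_by linear_sum; apply: eq_bigr => k _; rewrite linearZ.
Qed.

(** The square is its own opposite because the basis operations anticommute. *)
Lemma exterior_by_sqr w : exterior_by (exterior_by w) = 0.
Proof.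
have EN : exterior_by (exterior_by w) = - exterior_by (exterior_by w).
  rewrite {1}/exterior_by (eq_bigr (fun k => - exterior_by (x k *: ext_basis k w))).
    by rewrite sumrN -linear_sum.
 by move=> k _; rewrite ext_exterior_by [in RHS]linearZ /= scalerN.
apply/funext => I; apply/eqP; rewrite -eqNr; apply/eqP.
exact: esym (congr1 (@^~ I) EN).
Qed.

Lemma interior_by_sqr w : interior_by (interior_by w) = 0.
Proof.
have EN : interior_by (interior_by w) = - interior_by (interior_by w).
  rewrite {1}/interior_by (eq_bigr (fun k => - interior_by (x k *: int_basis k w))).
    by rewrite sumrN -linear_sum.
  by move=> k _; rewrite int_interior_by [in RHS]linearZ /= scalerN.
apply/funext => I; apply/eqP; rewrite -eqNr; apply/eqP.
exact: esym (congr1 (@^~ I) EN).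
Qed.

(** The fermionic number operator. On p-forms it is multiplication by p, but
    stating the commutation rules for the operator itself keeps track of degrees
    without any degree bookkeeping on intermediate forms. *)
Definition number_op w : form := \sum_k ext_basis k (int_basis k w).

Lemma number_op_is_linear : linear number_op.
Proof.
move=> a u v; rewrite /number_op scaler_sumr -big_split /=.
by apply: eq_bigr => k _; rewrite !linearP.
Qed.
HB.instance Definition _ :=
  GRing.isLinear.Build K form form _ number_op number_op_is_linear.

Lemma number_exterior_by w :
  number_op (exterior_by w) = exterior_by w + exterior_by (number_op w).
Proof.
rewrite {1}/number_op.
under eq_bigr do rewrite int_exterior_by linearB linearZ /= ext_exterior_by opprK.
by rewrite big_split /= linear_sum.
Qed.

Lemma number_interior_by w :
  number_op (interior_by w) = interior_by (number_op w) - interior_by w.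
Proof.
rewrite {1}/number_op.
under eq_bigr do rewrite int_interior_by linearN /= ext_interior_by opprB.
by rewrite big_split /= sumrN [interior_by (number_op w)]linear_sum.
Qed.

Lemma number_dual w :
  \sum_k int_basis k (ext_basis k w) = n%:R *: w - number_op w.
Proof.
under eq_bigr do rewrite int_ext_basisZ eqxx scale1r.
by rewrite big_split /= sumrN sumr_const card_ord scaler_nat.
Qed.

End VectorOperators.

Section LinearExpansion.
Variables (K : numFieldType) (n : nat) (x : 'I_n -> K) (k : 'I_n).
Implicit Types (a : K) (u v : extform n (K^o)).

Lemma ext_basisD u v : ext_basis k (u + v) = ext_basis k u + ext_basis k v.
Proof. exact: linearD. Qed.
Lemma ext_basisN u : ext_basis k (- u) = - ext_basis k u.
Proof. exact: linearN. Qed.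
Lemma ext_basisZ a u : ext_basis k (a *: u) = a *: ext_basis k u.
Proof. exact: linearZ_LR. Qed.
Lemma int_basisD u v : int_basis k (u + v) = int_basis k u + int_basis k v.
Proof. exact: linearD. Qed.
Lemma int_basisN u : int_basis k (- u) = - int_basis k u.
Proof. exact: linearN. Qed.
Lemma int_basisZ a u : int_basis k (a *: u) = a *: int_basis k u.
Proof. exact: linearZ_LR. Qed.
Lemma exterior_byD u v : exterior_by x (u + v) = exterior_by x u + exterior_by x v.
Proof. exact: linearD. Qed.
Lemma exterior_byN u : exterior_by x (- u) = - exterior_by x u.
Proof. exact: linearN. Qed.
Lemma exterior_byZ a u : exterior_by x (a *: u) = a *: exterior_by x u.
Proof. exact: linearZ_LR. Qed.
Lemma interior_byD u v : interior_by x (u + v) = interior_by x u + interior_by x v.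
Proof. exact: linearD. Qed.
Lemma interior_byN u : interior_by x (- u) = - interior_by x u.
Proof. exact: linearN. Qed.
Lemma interior_byZ a u : interior_by x (a *: u) = a *: interior_by x u.
Proof. exact: linearZ_LR. Qed.

End LinearExpansion.

(** Rewriting with these explicit rules normalises words in the four operators.
    They match sums up to conversion, so forms that are sums by definition are
    generalised before they are used. *)
Definition form_expand := (ext_basisD, ext_basisN, ext_basisZ,
  int_basisD, int_basisN, int_basisZ, exterior_byD, exterior_byN, exterior_byZ,
  interior_byD, interior_byN, interior_byZ).

(** * The pointwise identity *)
Lemma form0E (T : Type) (V : nmodType) (I : T) : (0 : T -> V) I = 0.
Proof. by []. Qed.

(** Identities between combinations of forms are checked coefficientwise, each
    distinct form becoming a variable of a commutative ring identity. *)
Ltac form_ring :=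
  apply/funext => ?; rewrite ?(form0E, fctE) /GRing.scale/=; ring.

Section PointwiseIdentity.
Variables (K : numFieldType) (n : nat).
Local Notation form := (extform n (K^o)).
Variables (x : 'I_n -> K) (m : 'I_n) (w : form) (q : K).
Local Notation E := (exterior_by x).
Local Notation J := (interior_by x).
Local Notation e := (ext_basis m).
Local Notation i := (int_basis m).
Local Notation r := (sqnorm x).
Local Notation t := (x m).
Local Notation N := (n%:R : K).

(** The form (i_x eps_x - eps_x i_x) w written in normal order; [reflected1] and
    [reflected2] are its first and second partial derivatives in x. *)
Definition reflected : form := r *: w - 2 *: E (J w).
Definition reflected1 (k : 'I_n) : form :=
  (2 * x k) *: w - 2 *: ext_basis k (J w) - 2 *: E (int_basis k w).
Definition reflected2 (j k : 'I_n) : form :=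
  (2 * (j == k)%:R) *: w - 2 *: ext_basis k (int_basis j w)
  - 2 *: ext_basis j (int_basis k w).

Hypotheses (iw : i w = 0) (numw : number_op w = q *: w).

Lemma J_reflected : J reflected = (- r) *: J w.
Proof.
rewrite /reflected linearB !linearZ /= interior_exterior_by interior_by_sqr linear0 subr0.
form_ring.
Qed.

Lemma E_reflected : E reflected = r *: E w.
Proof. by rewrite /reflected linearB !linearZ /= exterior_by_sqr oppr0 scaler0 addr0. Qed.

(** The hypothesis on w removes the term in which [i] passes through to w; this is
    where the factor i_(e_n) eps_(e_n) of the kernel enters. *)
Lemma i_reflected : i reflected = (- 2 * t) *: J w.
Proof.
rewrite /reflected linearB !linearZ /= int_exterior_by iw int_interior_by iw.
rewrite !linear0.
form_ring.
Qed.

Lemma number_reflected : number_op reflected = q *: reflected.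
Proof.
rewrite /reflected linearB !linearZ /= number_exterior_by number_interior_by numw.
rewrite linearB !linearZ /=.
form_ring.
Qed.

Lemma ext_reflected1 : \sum_k ext_basis k (reflected1 k) = (2 * (q + 1)) *: E w.
Proof.
transitivity (2 *: E w + 2 *: E (number_op w)).
  rewrite /number_op [E (\sum_k _)]linear_sum [X in _ = 2 *: X + _]/exterior_by.
  rewrite !scaler_sumr -big_split /=.
  apply: eq_bigr => k _; rewrite /reflected1 2!linearB !linearZ /=.
  rewrite ext_basis_sqr ext_exterior_by; form_ring.
rewrite numw [E (q *: w)]linearZ /=.
form_ring.
Qed.

Lemma int_reflected1 :
  \sum_k int_basis k (reflected1 k) = (- 2 * (N - q + 1)) *: J w.
Proof.
transitivity (2 *: J w - 2 *: (N *: J w - number_op (J w)) - 2 *: J w).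
  rewrite -number_dual {1 3}/interior_by !scaler_sumr -!sumrN -!big_split /=.
  apply: eq_bigr => k _; rewrite /reflected1 2!linearB !linearZ /=.
  rewrite int_exterior_by int_basis_sqr !linear0; form_ring.
rewrite number_interior_by numw [J (q *: w)]linearZ /=.
form_ring.
Qed.

(** Euler's relation: the form is homogeneous of degree 2 in x. *)
Lemma euler_reflected1 : \sum_k x k *: reflected1 k = 2 *: reflected.
Proof.
transitivity ((2 * r) *: w - 2 *: E (J w) - 2 *: E (J w)).
  rewrite /sqnorm mulr_sumr scaler_suml {1}/exterior_by {1}/interior_by.
  rewrite [E (\sum_k _)]linear_sum !scaler_sumr -!sumrN -!big_split /=.
  apply: eq_bigr => k _; rewrite /reflected1 [E (x k *: _)]linearZ /=; form_ring.
by rewrite /reflected; apply/funext => I; rewrite !fctE /GRing.scale/=; ring.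
Qed.

Lemma int_reflected2 j :
  \sum_k int_basis k (reflected2 j k) = (- 2 * (N - q + 1)) *: int_basis j w.
Proof.
transitivity (2 *: int_basis j w
   - 2 *: (N *: int_basis j w - number_op (int_basis j w)) - 2 *: int_basis j w).
  rewrite -number_dual -{1 3}(sumZ_delta (fun k => int_basis k w) j).
  rewrite !scaler_sumr -!sumrN -!big_split /=.
  apply: eq_bigr => k _; rewrite /reflected2 2!linearB !linearZ /=.
  rewrite !int_ext_basisZ int_basis_sqr !linear0 eqxx (eq_sym j); form_ring.
have -> : number_op (int_basis j w) = int_basis j (number_op w) - int_basis j w.
  rewrite /number_op linear_sum -{2}(sumZ_delta (fun k => int_basis k w) j).
  rewrite -sumrN -big_split /=; apply: eq_bigr => k _.
  rewrite (int_basis_anticomm k) linearN /= [in RHS]int_ext_basisZ; form_ring.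
rewrite numw [int_basis j (q *: w)]linearZ /=.
form_ring.
Qed.

Lemma ext_reflected2 j :
  \sum_k ext_basis k (reflected2 j k) = (2 * (q + 1)) *: ext_basis j w.
Proof.
transitivity (2 *: ext_basis j w + 2 *: ext_basis j (number_op w)).
  rewrite /number_op linear_sum -{1}(sumZ_delta (fun k => ext_basis k w) j).
  rewrite !scaler_sumr -!big_split /=.
  apply: eq_bigr => k _; rewrite /reflected2 2!linearB !linearZ /=.
  rewrite ext_basis_sqr (ext_basis_anticomm k j) (eq_sym j); form_ring.
rewrite numw [ext_basis j (q *: w)]linearZ /=.
form_ring.
Qed.


Section WithDensity.
Variables (B a b : K).
Local Notation A := (t ^+ 2 * r ^+ 2 * B).
Local Notation alpha := (a * t * r ^+ 2 * B).
Local Notation beta := (2 * b * t ^+ 2 * r * B).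
Local Notation gamma := (a * (a - 1) * r ^+ 2 * B).
Local Notation kappa := (2 * a * b * t * r * B).
Local Notation mu := (4 * b * (b - 1) * t ^+ 2 * B).

(** First and second partial derivatives of the density
    A = |t|^a r^b, written as polynomials in x times
    B = |t|^(a-2) r^(b-2). Factoring out B makes the final comparison an identity
    of polynomials in which t and r may vanish. *)
Definition density1 (k : 'I_n) : K := alpha * (k == m)%:R + beta * x k.
Definition density2 (j k : 'I_n) : K :=
  gamma * (j == m)%:R * (k == m)%:R
  + kappa * ((k == m)%:R * x j + (j == m)%:R * x k)
  + beta * (j == k)%:R + mu * x j * x k.

(** Partial derivatives of the form A eta by Leibniz' rule. *)
Definition field1 (k : 'I_n) : form :=
  density1 k *: reflected + A *: reflected1 k.
Definition field2 (j k : 'I_n) : form :=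
  density2 j k *: reflected + density1 k *: reflected1 j
  + density1 j *: reflected1 k + A *: reflected2 j k.

Lemma sum_ext_density1 u :
  \sum_k ext_basis k (density1 k *: u) = alpha *: e u + beta *: E u.
Proof.
rewrite -(sumZ_delta (fun k => ext_basis k u) m) /exterior_by.
rewrite !scaler_sumr -big_split /=; apply: eq_bigr => k _.
rewrite linearZ /= /density1; form_ring.
Qed.

Lemma sum_int_density1 u :
  \sum_k int_basis k (density1 k *: u) = alpha *: i u + beta *: J u.
Proof.
rewrite -(sumZ_delta (fun k => int_basis k u) m) /interior_by.
rewrite !scaler_sumr -big_split /=; apply: eq_bigr => k _.
rewrite linearZ /= /density1; form_ring.
Qed.

Lemma sum_ext_density2 j u : \sum_k ext_basis k (density2 j k *: u) =
  (gamma * (j == m)%:R + kappa * x j) *: e u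
  + (kappa * (j == m)%:R + mu * x j) *: E u + beta *: ext_basis j u.
Proof.
rewrite -(sumZ_delta (fun k => ext_basis k u) m) {1}/exterior_by.
rewrite -(sumZ_delta (fun k => ext_basis k u) j).
rewrite !scaler_sumr -!big_split /=; apply: eq_bigr => k _.
rewrite linearZ /= /density2 (eq_sym j k); form_ring.
Qed.

Lemma sum_int_density2 j u : \sum_k int_basis k (density2 j k *: u) =
  (gamma * (j == m)%:R + kappa * x j) *: i u
  + (kappa * (j == m)%:R + mu * x j) *: J u + beta *: int_basis j u.
Proof.
rewrite -(sumZ_delta (fun k => int_basis k u) m) {1}/interior_by.
rewrite -(sumZ_delta (fun k => int_basis k u) j).
rewrite !scaler_sumr -!big_split /=; apply: eq_bigr => k _.
rewrite linearZ /= /density2 (eq_sym j k); form_ring.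
Qed.

Lemma sum_int_field1 : \sum_k int_basis k (field1 k) =
  (- 2 * t * alpha - r * beta - 2 * (N - q + 1) * A) *: J w.
Proof.
transitivity (alpha *: i reflected + beta *: J reflected
              + A *: \sum_k int_basis k (reflected1 k)).
  rewrite -sum_int_density1 scaler_sumr -big_split /=; apply: eq_bigr => k _.
  by rewrite linearD /= [int_basis k (A *: _)]linearZ.
rewrite i_reflected J_reflected int_reflected1; form_ring.
Qed.

Lemma sum_ext_field1 : \sum_k ext_basis k (field1 k) =
  alpha *: e reflected + (beta * r + 2 * (q + 1) * A) *: E w.
Proof.
transitivity (alpha *: e reflected + beta *: E reflected
              + A *: \sum_k ext_basis k (reflected1 k)).
  rewrite -sum_ext_density1 scaler_sumr -big_split /=; apply: eq_bigr => k _.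
  by rewrite linearD /= [ext_basis k (A *: _)]linearZ.
rewrite E_reflected ext_reflected1; form_ring.
Qed.

(** The sum depends on j only through [j == m], [x j] and the basis operations of
    index j, so that the sum over j is again of a closed form. *)
Lemma sum_int_field2 j : \sum_k int_basis k (field2 j k) =
  (gamma * (j == m)%:R + kappa * x j) *: i reflected
  + (kappa * (j == m)%:R + mu * x j) *: J reflected
  + beta *: int_basis j reflected
  + alpha *: i (reflected1 j) + beta *: J (reflected1 j)
  - (2 * (N - q + 1) * density1 j) *: J w
  - (2 * (N - q + 1) * A) *: int_basis j w.
Proof.
transitivity (\sum_k int_basis k (density2 j k *: reflected)
  + \sum_k int_basis k (density1 k *: reflected1 j)
  + density1 j *: \sum_k int_basis k (reflected1 k)
  + A *: \sum_k int_basis k (reflected2 j k)).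
  rewrite !scaler_sumr -!big_split /=; apply: eq_bigr => k _.
  by rewrite 3!linearD /= [int_basis k (A *: _)]linearZ
     [int_basis k (density1 j *: _)]linearZ.
rewrite sum_int_density2 sum_int_density1 int_reflected1 int_reflected2.
form_ring.
Qed.

Lemma sum_ext_field2 j : \sum_k ext_basis k (field2 j k) =
  (gamma * (j == m)%:R + kappa * x j) *: e reflected
  + (kappa * (j == m)%:R + mu * x j) *: E reflected
  + beta *: ext_basis j reflected
  + alpha *: e (reflected1 j) + beta *: E (reflected1 j)
  + (2 * (q + 1) * density1 j) *: E w
  + (2 * (q + 1) * A) *: ext_basis j w.
Proof.
transitivity (\sum_k ext_basis k (density2 j k *: reflected)
  + \sum_k ext_basis k (density1 k *: reflected1 j)
  + density1 j *: \sum_k ext_basis k (reflected1 k)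
  + A *: \sum_k ext_basis k (reflected2 j k)).
  rewrite !scaler_sumr -!big_split /=; apply: eq_bigr => k _.
  by rewrite 3!linearD /= [ext_basis k (A *: _)]linearZ
     [ext_basis k (density1 j *: _)]linearZ.
rewrite sum_ext_density2 sum_ext_density1 ext_reflected1 ext_reflected2.
form_ring.
Qed.

Lemma sum_ext_affine c d u :
  \sum_j (c * (j == m)%:R + d * x j) *: ext_basis j u = c *: e u + d *: E u.
Proof.
rewrite -(sumZ_delta (fun k => ext_basis k u) m) {1}/exterior_by.
rewrite !scaler_sumr -!big_split /=; apply: eq_bigr => k _; form_ring.
Qed.

Lemma sum_int_affine c d u :
  \sum_j (c * (j == m)%:R + d * x j) *: int_basis j u = c *: i u + d *: J u.
Proof.
rewrite -(sumZ_delta (fun k => int_basis k u) m) {1}/interior_by.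
rewrite !scaler_sumr -!big_split /=; apply: eq_bigr => k _; form_ring.
Qed.

(** In each term eps_j is moved past the contractions with e_m and with x, so that
    only sums already known for the first derivatives are left. *)
Lemma ext_int_field2 : \sum_j ext_basis j (\sum_k int_basis k (field2 j k)) =
  gamma *: e (i reflected) + kappa *: E (i reflected)
  + kappa *: e (J reflected) + mu *: E (J reflected)
  + (beta * q) *: reflected
  + alpha *: (reflected1 m - i ((2 * (q + 1)) *: E w))
  + beta *: (2 *: reflected - J ((2 * (q + 1)) *: E w))
  - (2 * (N - q + 1)) *: (alpha *: e (J w) + beta *: E (J w))
  - (2 * (N - q + 1) * A * q) *: w.
Proof.
transitivity (\sum_j ((gamma * (j == m)%:R + kappa * x j) *: ext_basis j (i reflected)
  + (kappa * (j == m)%:R + mu * x j) *: ext_basis j (J reflected)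
  + beta *: ext_basis j (int_basis j reflected)
  + alpha *: ((j == m)%:R *: reflected1 j - i (ext_basis j (reflected1 j)))
  + beta *: (x j *: reflected1 j - J (ext_basis j (reflected1 j)))
  - (2 * (N - q + 1)) *: ext_basis j (density1 j *: J w)
  - (2 * (N - q + 1) * A) *: ext_basis j (int_basis j w))).
  apply: eq_bigr => j _; rewrite sum_int_field2 -ext_int_basisZ -ext_interior_by.
  move: (reflected) (reflected1 j) (density1 j) => u v c.
  rewrite !form_expand; form_ring.
rewrite !big_split /= !sumrN -!scaler_sumr sum_ext_density1 !sum_ext_affine.
rewrite !big_split /= !sumrN sumZ_delta euler_reflected1 -!linear_sum /=.
rewrite ext_reflected1 -!/(number_op _) number_reflected numw.
form_ring.
Qed.

Lemma int_ext_field2 : \sum_j int_basis j (\sum_k ext_basis k (field2 j k)) =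
  gamma *: i (e reflected) + kappa *: J (e reflected)
  + kappa *: i (E reflected) + mu *: J (E reflected)
  + (beta * (N - q)) *: reflected
  + alpha *: (reflected1 m - e ((- 2 * (N - q + 1)) *: J w))
  + beta *: (2 *: reflected - E ((- 2 * (N - q + 1)) *: J w))
  + (2 * (q + 1)) *: (alpha *: i (E w) + beta *: J (E w))
  + (2 * (q + 1) * A * (N - q)) *: w.
Proof.
transitivity (\sum_j ((gamma * (j == m)%:R + kappa * x j) *: int_basis j (e reflected)
  + (kappa * (j == m)%:R + mu * x j) *: int_basis j (E reflected)
  + beta *: int_basis j (ext_basis j reflected)
  + alpha *: ((j == m)%:R *: reflected1 j - e (int_basis j (reflected1 j)))
  + beta *: (x j *: reflected1 j - E (int_basis j (reflected1 j)))
  + (2 * (q + 1)) *: int_basis j (density1 j *: E w)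
  + (2 * (q + 1) * A) *: int_basis j (ext_basis j w))).
  apply: eq_bigr => j _; rewrite sum_ext_field2.
  rewrite -[X in _ + alpha *: (_ - e X)]/(int_basis j (reflected1 j)).
  rewrite (eq_sym j m) -int_ext_basisZ -int_exterior_by.
  move: (reflected) (reflected1 j) (density1 j) => u v c.
  rewrite !form_expand; form_ring.
rewrite !big_split /= -!scaler_sumr sum_int_density1 !sum_int_affine.
rewrite !big_split /= !sumrN sumZ_delta euler_reflected1 -!linear_sum /=.
rewrite int_reflected1 !number_dual number_reflected numw.
form_ring.
Qed.

Lemma reflected1_last : reflected1 m = (2 * t) *: w - 2 *: e (J w).
Proof. by rewrite /reflected1 iw !linear0; form_ring. Qed.

Lemma i_e_reflected : i (e reflected) = reflected - e (i reflected).
Proof. by rewrite int_ext_basisZ eqxx scale1r. Qed.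

Lemma iEw : i (E w) = t *: w.
Proof. by rewrite int_exterior_by iw linear0; form_ring. Qed.

Lemma J_e_reflected : J (e reflected) = t *: reflected - e (J reflected).
Proof. by rewrite ext_interior_by opprB addrC subrK. Qed.

Lemma sum_ext_i_field1 : \sum_k ext_basis k (i (field1 k)) =
  field1 m - i (alpha *: e reflected + (beta * r + 2 * (q + 1) * A) *: E w).
Proof.
under eq_bigr do rewrite ext_int_basisZ.
by rewrite big_split /= sumZ_delta sumrN -sum_ext_field1 [i (\sum_k _)]linear_sum.
Qed.

(** All words reduce to w, E (J w) and e (J w); the three coefficients agree as
    polynomials in t, r, a, b, q and N after substituting l and nu. *)
Theorem pointwise_identity (l nu : K) : l = a + b + N + 1 -> nu = - b - 1 ->
  - (((2 * l - N - 2) * (l - N + q - 1) * (l - q)) *: field1 m)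
  - (2 * l - N - 2) *:
      ((l - N + q) *: (e (- \sum_k int_basis k (field1 k)))
       + (l - q) *: (\sum_k ext_basis k (i (field1 k))))
  - ((l - N + q - 1) * (l - q)) *:
      (t *: - \sum_j int_basis j (\sum_k ext_basis k (field2 j k)))
  - ((l - N + q) * (l - q - 1)) *:
      (t *: \sum_j ext_basis j (- \sum_k int_basis k (field2 j k)))
  = ((l + nu - N) * (nu - l + 1) * (l - N + q - 1) * (l - q)
     * (t * r ^+ 2 * B)) *: reflected.
Proof.
move=> -> ->.
have -> : \sum_j ext_basis j (- \sum_k int_basis k (field2 j k)) =
    - \sum_j ext_basis j (\sum_k int_basis k (field2 j k)).
  by rewrite -sumrN; apply: eq_bigr => j _; rewrite linearN.
rewrite int_ext_field2 ext_int_field2 sum_int_field1 sum_ext_i_field1.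
(* the form is made opaque so that normalisation does not unfold it *)
have reflectedE : reflected = r *: w - 2 *: E (J w) by [].
rewrite /field1 reflected1_last.
move: reflectedE i_e_reflected J_e_reflected E_reflected i_reflected J_reflected.
move: (reflected) => u uE i_e_u J_e_u E_u i_u J_u.
rewrite !form_expand i_e_u iEw J_e_u E_u i_u J_u !form_expand iEw.
rewrite interior_exterior_by /density1 eqxx uE.
form_ring.
Qed.

End WithDensity.

End PointwiseIdentity.

(** * Dominated integrals over the line *)
Section LineIntegrals.
Variable R : realType.
Local Notation mu := (@lebesgue_measure R).
Implicit Types (t : R) (G : R -> R).

(** An integrable weight whose products dominate rapidly decreasing functions in
    several variables, and which is slowly varying under bounded translations. *)
Definition cauchy_weight t : R := (oneDsqr t)^-1.
Local Notation wt := cauchy_weight.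

Lemma cauchy_weight_gt0 t : 0 < wt t.
Proof. by rewrite invr_gt0 (lt_le_trans ltr01). Qed.

Lemma cauchy_weight_le1 t : wt t <= 1.
Proof. exact: oneDsqrV_le1. Qed.

Lemma integrable_cauchy_weight : mu.-integrable setT (EFin \o wt).
Proof.
apply/integrableP; split.
  by apply/measurable_EFinP; apply: continuous_measurable_fun;
    exact: continuous_oneDsqrV.
under eq_integral => t _ do
  rewrite /= ger0_norm ?(ltW (cauchy_weight_gt0 _))//.
rewrite ge0_symfun_integralT.
- rewrite (_ : [set x | _] = `[0%R, +oo[%classic); last first.
    by apply/seteqP; split => x /=; rewrite in_itv/= andbT.
  by rewrite integral0y_oneDsqr -EFinM ltry.
- by move=> t; rewrite ltW// cauchy_weight_gt0.
- exact: continuous_oneDsqrV.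
- by move=> t; rewrite /= /wt /oneDsqr sqrrN.
Qed.

Lemma integrable_cauchy_weightZ (C : R) :
  mu.-integrable setT (EFin \o (fun t => C * wt t)).
Proof.
have := integrableZl measurableT C integrable_cauchy_weight.
by apply: eq_integrable => // t _; rewrite /= EFinM.
Qed.

Definition cauchy_mass : R := \int[mu]_(t in [set: R]) wt t.

Definition line_tame (C : R) G : Prop :=
  continuous G /\ forall t, `|G t| <= C * wt t.

Lemma line_tame_measurable C G : line_tame C G ->
  measurable_fun setT (EFin \o G).
Proof.
by move=> [cG _]; apply/measurable_EFinP; exact: continuous_measurable_fun.
Qed.

Lemma line_tame_integrable C G : line_tame C G ->
  mu.-integrable setT (EFin \o G).
Proof.
move=> tG; apply: le_integrable (integrable_cauchy_weightZ C) => //.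
  exact: line_tame_measurable tG.
case: tG => [_ GC]; by move=> t _ /=; rewrite lee_fin (le_trans (GC t))// ler_norm.
Qed.

Lemma line_bound C G : line_tame C G ->
  `|\int[mu]_(t in [set: R]) G t| <= C * cauchy_mass.
Proof.
move=> tG; have iG := line_tame_integrable tG.
apply: le_trans (le_normr_Rintegral _ iG) _ => //.
rewrite -RintegralZl//; last exact: integrable_cauchy_weight.
apply: le_Rintegral => //.
- have := integrable_abse iG; exact: eq_integrable.
- exact: integrable_cauchy_weightZ.
- by move=> t _; case: tG.
Qed.

Lemma line_dominated_convergence C (Gk : nat -> R -> R) G :
  (forall k, line_tame C (Gk k)) -> line_tame C G ->
  (forall t, Gk k t @[k --> \oo] --> G t) ->
  \int[mu]_(t in [set: R]) Gk k t @[k --> \oo] --> \int[mu]_(t in [set: R]) G t.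
Proof.
move=> tGk tG GkG.
have [|||||_ _ cv] := @dominated_convergence _ _ _ mu setT measurableT
   (fun k => EFin \o Gk k) (EFin \o G) (fun t => (C * wt t)%:E).
- by move=> k; exact: line_tame_measurable (tGk k).
- exact: line_tame_measurable tG.
- by apply: aeW => t _; apply: cvg_EFin; [exact: nearW|exact: GkG].
- exact: integrable_cauchy_weightZ.
- by apply: aeW => t k _; rewrite /= lee_fin; case: (tGk k).
rewrite /Rintegral; apply: fine_cvg; rewrite fineK; first exact: cv.
exact: integrable_fin_num (line_tame_integrable tG).
Qed.

(** For nonnegative functions this is a change of variables; in general G is the
    difference of the nonnegative functions G + C wt and C wt. *)
Lemma line_translation C G (v : R) : line_tame C G ->
  \int[mu]_(t in [set: R]) G (t + v) = \int[mu]_(t in [set: R]) G t.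
Proof.
have ge0_translation (H : R -> R) : continuous H -> (forall t, 0 <= H t) ->
    (\int[mu]_t (H t)%:E = \int[mu]_t (H (t + v))%:E)%E.
  move=> cH H0.
  have dF (t : R) : is_derive t (1 : R) (fun s : R => s + v) (1 : R).
    by apply: is_derive_eq; rewrite addr0.
  have d1F : derive1 (fun s : R => s + v) = cst 1.
    by apply/funext => t; rewrite derive1E; exact: derive_val.
  rewrite (@increasing_ge0_integration_by_substitutionT R (fun s => s + v))//.
  - by apply: eq_integral => t _; rewrite /= d1F/= mulr1.
  - by move=> s t; rewrite ltrD2r.
  - by rewrite d1F => t; exact: cvg_cst.
  - by rewrite d1F; exact: is_cvg_cst.
  - by rewrite d1F; exact: is_cvg_cst.
  - exact: cvg_addrr_Ny.
  - exact: cvg_addrr.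
move=> [cG GC].
have C0 : 0 <= C.
  by rewrite -(pmulr_lge0 _ (cauchy_weight_gt0 0)) (le_trans _ (GC 0)).
pose H t := G t + C * wt t; pose H' t := C * wt t.
have cw : continuous (fun t => C * wt t).
  by move=> t; apply: cvgM; [exact: cvg_cst|exact: continuous_oneDsqrV].
have tH' : line_tame C H'.
  by split=> // t; rewrite /H' ger0_norm// mulr_ge0// ltW// cauchy_weight_gt0.
have tH : line_tame (C + C) H.
  split=> [t|t]; first by apply: cvgD; [exact: cG|exact: cw].
  rewrite mulrDl (le_trans (ler_normD _ _))// lerD//.
  by rewrite ger0_norm// mulr_ge0// ltW// cauchy_weight_gt0.
have cT : continuous (fun t => t + v).
  by move=> t; apply: cvgD; [exact: cvg_id|exact: cvg_cst].
have shift_int K (H0 : R -> R) : line_tame K H0 -> (forall t, 0 <= H0 t) ->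
   mu.-integrable setT (EFin \o (fun t => H0 (t + v))).
  move=> [cH0 HK] H00; apply/integrableP; split.
    apply/measurable_EFinP; apply: continuous_measurable_fun => t.
    apply: continuous_comp; [exact: cT|exact: cH0].
  under eq_integral do rewrite /= ger0_norm//.
  rewrite -ge0_translation//.
  have /integrableP[_] := line_tame_integrable (conj cH0 HK).
  by under eq_integral do rewrite /= ger0_norm//.
have H'0 t : 0 <= H' t by rewrite mulr_ge0// ltW// cauchy_weight_gt0.
have H0 t : 0 <= H t.
  by have := GC t; rewrite ler_norml => /andP[+ _]; rewrite /H -subr_ge0 opprK.
have -> : (fun t => G (t + v)) = fun t => H (t + v) - H' (t + v).
  by apply/funext => t; rewrite /H /H' addrK.
have -> : \int[mu]_(t in [set: R]) G t = \int[mu]_(t in [set: R]) (H t - H' t).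
  by apply: eq_Rintegral => t _; rewrite /H /H' addrK.
have iH := line_tame_integrable tH; have iH' := line_tame_integrable tH'.
have iHv := shift_int _ _ tH H0; have iHv' := shift_int _ _ tH' H'0.
rewrite RintegralB// RintegralB//.
congr (_ - _); rewrite /Rintegral -ge0_translation//; first by case: tH.
Qed.

End LineIntegrals.

(** * Dominated iterated integrals *)
Section IteratedIntegral.
Variable R : realType.
Local Notation mu := (@lebesgue_measure R).
Local Notation wt := (@cauchy_weight R).

Definition entry_cvg m (u : nat -> 'rV[R]_m) (x : 'rV[R]_m) : Prop :=
  forall i, u k 0 i @[k --> \oo] --> x 0 i.

(** Sequential continuity for entrywise convergence: this form of continuity
    passes to slices and to iterated integrals in every dimension, including 0,
    with no reference to a norm. *)
Definition seq_continuous m (F : 'rV[R]_m -> R) : Prop :=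
  forall u x, entry_cvg u x -> F (u k) @[k --> \oo] --> F x.

Definition weight m (x : 'rV[R]_m) : R := \prod_i wt (x 0 i).

(** On this class the iterated integral is linear, translation invariant and
    continuous for dominated convergence. *)
Definition tame m (C : R) (F : 'rV[R]_m -> R) : Prop :=
  seq_continuous F /\ forall x, `|F x| <= C * weight x.

Definition slice m (F : 'rV[R]_m.+1 -> R) (t : R) (y : 'rV[R]_m) : R :=
  F (row_mx (const_mx t : 'rV[R]_1) y).

Lemma weight_gt0 m (x : 'rV[R]_m) : 0 < weight x.
Proof. by apply: prodr_gt0 => i _; exact: cauchy_weight_gt0. Qed.

Lemma row_mx_head m t (y : 'rV[R]_m) (i : 'I_1) :
  (row_mx (const_mx t : 'rV[R]_1) y : 'rV[R]_m.+1) 0 (lshift m i) = t.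
Proof. by rewrite (row_mxEl (const_mx t : 'rV[R]_1)) mxE. Qed.

Lemma row_mx_tail m t (y : 'rV[R]_m) (i : 'I_m) :
  (row_mx (const_mx t : 'rV[R]_1) y : 'rV[R]_m.+1) 0 (rshift 1 i) = y 0 i.
Proof. by rewrite (row_mxEr (const_mx t : 'rV[R]_1)). Qed.

Lemma weight_row_mx m t (y : 'rV[R]_m) :
  @weight m.+1 (row_mx (const_mx t : 'rV[R]_1) y) = wt t * weight y.
Proof.
rewrite /weight (@big_split_ord _ _ _ 1 m) /= big_ord1 row_mx_head.
by congr (_ * _); apply: eq_bigr => i _; rewrite row_mx_tail.
Qed.

Lemma tame_ge0 m C (F : 'rV[R]_m -> R) : tame C F -> 0 <= C.
Proof.
move=> [_ FC]; rewrite -(pmulr_lge0 _ (weight_gt0 (0 : 'rV[R]_m))).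
exact: le_trans (FC 0).
Qed.

Lemma tame_le m C C' (F : 'rV[R]_m -> R) : C <= C' -> tame C F -> tame C' F.
Proof.
move=> CC' [cF FC]; split=> // x; apply: le_trans (FC x) _.
by rewrite ler_wpM2r// ltW// weight_gt0.
Qed.

Lemma entry_cvg_row_mx m (t : nat -> R) t0 (y : nat -> 'rV[R]_m) y0 :
  t k @[k --> \oo] --> t0 -> entry_cvg y y0 ->
  @entry_cvg m.+1 (fun k => row_mx (const_mx (t k) : 'rV[R]_1) (y k))
    (row_mx (const_mx t0 : 'rV[R]_1) y0).
Proof.
move=> tt0 yy0 i; case: (@split_ordP 1 m i) => j ->.
  by rewrite row_mx_head; under eq_fun do rewrite row_mx_head.
by rewrite row_mx_tail; under eq_fun do rewrite row_mx_tail; exact: yy0.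
Qed.

Lemma tame_slice m C (F : 'rV[R]_m.+1 -> R) t :
  tame C F -> tame (C * wt t) (slice F t).
Proof.
move=> [cF FC]; split=> [u x ux|y].
  by apply: cF; apply: entry_cvg_row_mx ux; exact: cvg_cst.
by rewrite -mulrA -weight_row_mx; exact: FC.
Qed.

Lemma tame_slice_cst m C (F : 'rV[R]_m.+1 -> R) t :
  tame C F -> tame C (slice F t).
Proof.
move=> tF; apply: tame_le (tame_slice t tF).
by rewrite ler_piMr ?cauchy_weight_le1// (tame_ge0 tF).
Qed.

Definition dominated_convergence_rV m : Prop :=
  forall C (Fk : nat -> 'rV[R]_m -> R) F,
  (forall k, tame C (Fk k)) -> tame C F ->
  (forall x, Fk k x @[k --> \oo] --> F x) ->
  integral_rV (Fk k) @[k --> \oo] --> integral_rV F.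

Definition bounded_integral m : Prop := forall C (F : 'rV[R]_m -> R),
  tame C F -> `|integral_rV F| <= C * cauchy_mass R ^+ m.

(** Continuity of the inner integral in the outer variable is itself an instance
    of dominated convergence one dimension lower. *)
Lemma tame_inner_integral m C (F : 'rV[R]_m.+1 -> R) :
  dominated_convergence_rV m -> bounded_integral m -> tame C F ->
  line_tame (C * cauchy_mass R ^+ m) (fun t => integral_rV (slice F t)).
Proof.
move=> DCT BI tF; split=> [t|t]; last first.
  by rewrite mulrAC; apply: BI; exact: tame_slice.
apply/(@cvg_nbhsP R R^o) => u ut; apply: (DCT C).
- by move=> k; exact: tame_slice_cst.
- exact: tame_slice_cst.
- move=> y; case: tF => cF _; apply: cF; apply: entry_cvg_row_mx ut _.
  by move=> i; exact: cvg_cst.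
Qed.

(** Both properties are proved together because the inductive step needs each of
    them for slices, to see that inner integrals are dominated functions of one
    variable. *)
Lemma integral_rV_bound_and_convergence m :
  bounded_integral m /\ dominated_convergence_rV m.
Proof.
elim: m => [|m [BI DCT]].
  split=> [C F [_ FC]|C Fk F _ _ FkF] /=; last exact: FkF.
  by have := FC 0; rewrite /weight big_ord0 expr0.
split=> [C F tF|C Fk F tFk tF FkF] /=.
  by rewrite exprSr mulrA; apply: line_bound; exact: tame_inner_integral.
apply: (@line_dominated_convergence _ (C * cauchy_mass R ^+ m)).
- by move=> k; exact: tame_inner_integral (tFk k).
- exact: tame_inner_integral tF.
- move=> t; apply: (DCT C).
  + by move=> k; exact: tame_slice_cst.
  + exact: tame_slice_cst.
  + by move=> y; exact: FkF.
Qed.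

Lemma integral_rV_cvg m : dominated_convergence_rV m.
Proof. by have [] := integral_rV_bound_and_convergence m. Qed.

Lemma line_tame_inner m C (F : 'rV[R]_m.+1 -> R) : tame C F ->
  line_tame (C * cauchy_mass R ^+ m) (fun t => integral_rV (slice F t)).
Proof.
by have [] := integral_rV_bound_and_convergence m; move=> *; apply: tame_inner_integral.
Qed.

Lemma integral_rVD m C D (F G : 'rV[R]_m -> R) : tame C F -> tame D G ->
  integral_rV (fun x => F x + G x) = integral_rV F + integral_rV G.
Proof.
elim: m C D F G => [|m IH] C D F G tF tG //=.
under eq_Rintegral do rewrite (IH _ _ _ _ (tame_slice_cst _ tF) (tame_slice_cst _ tG)).
rewrite RintegralD//.
  exact: line_tame_integrable (line_tame_inner tF).
exact: line_tame_integrable (line_tame_inner tG).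
Qed.

Lemma integral_rVZ m C c (F : 'rV[R]_m -> R) : tame C F ->
  integral_rV (fun x => c * F x) = c * integral_rV F.
Proof.
elim: m C F => [|m IH] C F tF //=.
under eq_Rintegral do rewrite (IH _ _ (tame_slice_cst _ tF)).
by rewrite RintegralZl//; exact: line_tame_integrable (line_tame_inner tF).
Qed.

(** Translating all coordinates at once makes the induction immediate: the first
    coordinate is the one-dimensional case, the others are the inner integral. *)
Lemma integral_rV_translation m C (F : 'rV[R]_m -> R) v : tame C F ->
  integral_rV (fun x => F (x + v)) = integral_rV F.
Proof.
elim: m C F v => [|m IH] C F v tF /=.
  by congr F; apply/matrixP => i [].
pose v0 : R := @lsubmx _ 1 1 m v 0 0; pose v1 := @rsubmx _ 1 1 m v.
rewrite -(line_translation v0 (line_tame_inner tF)).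
apply: eq_Rintegral => t _.
rewrite -(IH _ _ v1 (tame_slice_cst (t + v0) tF)).
congr integral_rV; apply/funext => y; rewrite /slice; congr F.
apply/rowP => i; rewrite [LHS]mxE; case: (@split_ordP 1 m i) => j ->.
  by rewrite !row_mx_head /v0 mxE ord1.
by rewrite !row_mx_tail mxE /v1 mxE.
Qed.

End IteratedIntegral.

(** * Directional derivatives and Schwartz functions *)
Section PartialDerivatives.
Variables (R : realType) (n : nat).
Local Notation E := 'rV[R]_n.+1.
Implicit Types (F u f : E -> R) (k : 'I_n.+1) (x : E).

(** Carrying the derivative as an argument avoids any separate differentiability
    hypothesis. *)
Definition has_partial k F F' : Prop :=
  forall x, is_derive x (delta_mx 0 k) F (F' x).

Lemma is_derive_line F x v (s d : R) :
  is_derive (x + s *: v) v F d -> is_derive s 1 (fun t : R => F (x + t *: v)) d.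
Proof.
suff e : (fun h : R => h^-1 *: (F (h *: v + (x + s *: v)) - F (x + s *: v))) =
    (fun h : R => h^-1 *: (F (x + (h *: (1 : R) + s) *: v) - F (x + s *: v))).
  by case=> dF <-; split; rewrite /derivable /derive /= -e.
apply/funext => h; congr (_ *: (F _ - _)).
by rewrite [h *: (1 : R)]mulr1 scalerDl addrCA.
Qed.

Lemma is_derive_of_line F x v (d : R) :
  is_derive (0 : R) 1 (fun t : R => F (x + t *: v)) d -> is_derive x v F d.
Proof.
suff e : (fun h : R => h^-1 *: (F (h *: v + x) - F x)) =
    (fun h : R => h^-1 *: (F (x + (h *: (1 : R) + 0) *: v) - F (x + 0 *: v))).
  by case=> dF <-; split; rewrite /derivable /derive /= e.
apply/funext => h; by rewrite scale0r !addr0 [h *: (1 : R)]mulr1 (addrC x).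
Qed.

Lemma entry_cvg_shift (y : nat -> E) x v :
  entry_cvg y x -> entry_cvg (fun j => y j + v) (x + v).
Proof.
move=> yx i; rewrite mxE; under eq_fun do rewrite mxE.
by apply: cvgD; [exact: yx|exact: cvg_cst].
Qed.

(** The factor 3 comes from 1 + t^2 <= 3 (1 + (t + h)^2) when |h| <= 1. *)
Lemma weight_shift k (h : R) x : `|h| <= 1 ->
  weight (x + h *: delta_mx 0 k) <= 3 * weight x.
Proof.
move=> h1; rewrite /weight (bigD1 k)//= [X in 3 * X](bigD1 k)//= mulrA.
rewrite [X in _ * X](eq_bigr (fun i => cauchy_weight (x 0 i))); last first.
  move=> i /negbTE ik; rewrite !mxE ik andbF mulr0 addr0//.
rewrite ler_wpM2r//.
  by apply: prodr_ge0 => i _; rewrite ltW// cauchy_weight_gt0.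
rewrite !mxE !eqxx mulr1 /cauchy_weight /oneDsqr.
set t := x 0 k.
rewrite -[leLHS]mul1r ler_pdivlMr ?ltr_pwDl ?sqr_ge0// mulrAC.
rewrite ler_pdivrMr ?ltr_pwDl ?sqr_ge0// mul1r.
have : h ^+ 2 <= 1 by rewrite -real_normK ?num_real// expr_le1.
have := sqr_ge0 (t + 2 * h); nra.
Qed.

(** Difference quotients have integral 0 by translation invariance, are dominated
    by the mean value theorem together with [weight_shift], and converge to the
    partial derivative. *)
Lemma integral_partial_eq0 k C C' F F' :
  tame C F -> tame C' F' -> has_partial k F F' -> integral_rV F' = 0.
Proof.
move=> tF tF' dF.
pose v : E := delta_mx 0 k.
pose h (j : nat) : R := j.+1%:R^-1.
have h0 j : 0 < h j by rewrite invr_gt0.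
have h1 j : h j <= 1 by rewrite invf_le1// ler1n.
pose Q j x := (h j)^-1 * (F (x + h j *: v) - F x).
have tQ1 j : tame (C + 3 * C) (fun x => F (x + h j *: v) - F x).
  split=> [y x yx|x].
    have [cF _] := tF.
    by apply: cvgB; apply: cF => //; exact: entry_cvg_shift.
  rewrite (le_trans (ler_normB _ _))// addrC mulrDl lerD//; first by case: tF.
  case: (tF) => _ /(_ (x + h j *: v)) /le_trans; apply.
  by rewrite (mulrC 3) -mulrA ler_wpM2l ?(tame_ge0 tF)// weight_shift// ger0_norm ?(ltW (h0 _)).
have tQ j : tame (3 * C') (Q j).
  split=> [y x yx|x].
    apply: cvgM; first exact: cvg_cst.
    have [cF _] := tF.
    by apply: cvgB; apply: cF => //; exact: entry_cvg_shift.
  have dg (s : R) : is_derive s 1 (fun t : R => F (x + t *: v)) (F' (x + s *: v)).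
    exact/is_derive_line/dF.
  have [|c] := @MVT R (fun t : R => F (x + t *: v)) (fun s => F' (x + s *: v)) 0 (h j) (h0 j).

  - apply: derivable_within_continuous => s _.
    by case: (dg s).
  rewrite scale0r addr0 subr0 in_itv /= => /andP[c0 ch] e.
  rewrite /Q e mulrCA mulVf ?gt_eqF// mulr1.
  case: (tF') => _ /(_ (x + c *: v)) /le_trans; apply.
  rewrite (mulrC 3) -mulrA ler_wpM2l ?(tame_ge0 tF')// weight_shift//.
  by rewrite ger0_norm ?(ltW c0)// (le_trans (ltW ch)).
have Q0 j : integral_rV (Q j) = 0.
  rewrite /Q (integral_rVZ _ (tQ1 j)).
  have tN : tame C (fun x => - 1 * F x).
    case: tF => cF FC; split=> [y x yx|x]; last by rewrite mulN1r normrN.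
    by apply: cvgM; [exact: cvg_cst|exact: cF].
  have tS : tame (3 * C) (fun x => F (x + h j *: v)).
    case: (tF) => cF FC; split=> [y x yx|x].
      by apply: cF; exact: entry_cvg_shift.
    case: (tF) => _ /(_ (x + h j *: v)) /le_trans; apply.
    by rewrite (mulrC 3) -mulrA ler_wpM2l ?(tame_ge0 tF)// weight_shift// ger0_norm ?(ltW (h0 _)).
  transitivity ((h j)^-1 * integral_rV (fun x => F (x + h j *: v) + (- 1 * F x))).
    by congr (_ * integral_rV _); apply/funext => x; rewrite mulN1r.
  rewrite (integral_rVD tS tN) (integral_rVZ _ tF) (integral_rV_translation _ tF).
  by rewrite mulN1r subrr mulr0.
have Qcvg x : Q j x @[j --> \oo] --> F' x.
  have [dFx <-] := dF x.
  have hd : h j @[j --> \oo] --> (0 : R)^'.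
    move=> A A0; have : \forall j \near \oo, h j != 0 -> A (h j).
      exact: (@cvg_harmonic R (fun y => y != 0 -> A y) A0).
    by apply: filterS => j; apply; rewrite gt_eqF.
  have := cvg_comp _ _ hd dFx.
  apply: cvg_trans; apply: near_eq_cvg; apply: nearW => j /=.
  by rewrite /Q (addrC x).
have le3 : C' <= 3 * C' by rewrite ler_peMl ?(tame_ge0 tF')// ler1n.
have Qlim : integral_rV (Q j) @[j --> \oo] --> integral_rV F'.
  exact: integral_rV_cvg tQ (tame_le le3 tF') Qcvg.
have Qlim0 : integral_rV (Q j) @[j --> \oo] --> (0 : R).
  by under eq_fun do rewrite Q0; exact: cvg_cst.
exact: cvg_unique Qlim Qlim0.
Qed.


Lemma entry_cvg_cvg (y : nat -> E) x : entry_cvg y x -> y j @[j --> \oo] --> x.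
Proof.
move=> yx; apply/cvgrPdist_lt => e e0.
have : \forall j \near \oo, forall i, `|x 0 i - y j 0 i| < e.
  apply: filter_forall => i; move/cvgrPdist_lt : (yx i); exact.
apply: filterS => j xy; rewrite /Num.norm/= mx_normrE.
apply/bigmax_ltP; split=> // -[i i'] _.
by rewrite /= !mxE ord1.
Qed.

Lemma entry_le_norm x k : `|x 0 k| <= `|x|.
Proof.
rewrite [leRHS]/Num.norm/= mx_normrE.
exact: (@le_bigmax _ R _ 0 (fun ij : 'I_1 * 'I_n.+1 => `|x ij.1 ij.2|) (0, k)).
Qed.

Lemma continuous_seq_continuous F : continuous F -> seq_continuous F.
Proof.
by move=> cF y x /entry_cvg_cvg yx; exact: cvg_comp yx (cF x).
Qed.

Lemma schwartz_seq_continuous f : schwartz f -> seq_continuous f.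
Proof.
move=> [df _]; apply: continuous_seq_continuous => x.
exact/differentiable_continuous/(df [::]).
Qed.

Lemma schwartz_partial k f : schwartz f -> schwartz (partial k f).
Proof.
have e s : partials s (partial k f) = partials (rcons s k) f.
  by rewrite /partials foldr_rcons.
move=> [df bf]; split=> [s x|s m]; rewrite e; [exact: df|exact: bf].
Qed.

Lemma schwartz_has_partial k f : schwartz f -> has_partial k f (partial k f).
Proof.
by move=> [df _] x; split=> //; apply: diff_derivable; exact: (df [::]).
Qed.

Lemma schwartz_decay m f : schwartz f ->
  exists M, forall x, `|f x| <= M * (1 + `|x|) ^- m.
Proof.
move=> [_ /(_ [::] m)[M fM]]; exists M => x.
by rewrite ler_pdivlMr ?exprn_gt0 ?ltr_pwDl// mulrC.
Qed.

Lemma is_derive_coord (j : 'I_n.+1) k x :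
  is_derive x (delta_mx 0 j) (fun y : E => y 0 k) (k == j)%:R.
Proof.
apply: is_derive_of_line.
rewrite (_ : (fun t : R => _) = fun t : R => x 0 k + t * (k == j)%:R); last first.
  by apply/funext => t; rewrite !mxE eqxx.
by apply: is_derive_eq; rewrite add0r mul1r scaler0 add0r [_%:A]mulr1.
Qed.

Lemma partial_coordM j k f x : differentiable f x ->
  partial j (fun y => y 0 k * f y) x = (k == j)%:R * f x + x 0 k * partial j f x.
Proof.
move=> df; rewrite /partial.
have D1 := is_derive_coord j k x.
have D2 : is_derive x (delta_mx 0 j) f ('D_(delta_mx 0 j) f x).
  by split=> //; exact: diff_derivable.
have [_ ->] := is_deriveM D1 D2.
by rewrite addrC mulrC.
Qed.

(** Leibniz' rule in the crude form that suffices for seminorm estimates: the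
    error is a finite sum of derivatives of f. *)
Lemma partials_coordM k f s : schwartz f -> exists L : seq (seq 'I_n.+1),
  forall x, partials s (fun y : E => y 0 k * f y) x =
     x 0 k * partials s f x + \sum_(s' <- L) partials s' f x.
Proof.
move=> sf; elim: s => [|j s [L IH]].
  by exists [::] => x; rewrite big_nil addr0.
exists ((if k == j then [:: s] else [::]) ++ [seq j :: s' | s' <- L]) => x.
have df s' y := sf.1 s' y.
rewrite /= {1}/partial (_ : partials s _ =
  (fun y : E => y 0 k * partials s f y) +
  (fun y : E => \sum_(s' <- L) partials s' f y)); last first.
  by apply/funext => y; rewrite IH.
have dc : derivable (fun y : E => y 0 k * partials s f y) x (delta_mx 0 j).
  apply: derivableM; apply: diff_derivable; last exact: df.
  exact: differentiable_coord.
have dS (L' : seq (seq 'I_n.+1)) : is_derive x (delta_mx 0 j)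
   (fun y : E => \sum_(s' <- L') partials s' f y)
   (\sum_(s' <- L') partials (j :: s') f x).
  elim: L' => [|s' L' IHL].
    under eq_fun do rewrite big_nil; rewrite big_nil; exact: is_derive_cst.
  under eq_fun do rewrite big_cons; rewrite big_cons.
  have D1 : is_derive x (delta_mx 0 j) (partials s' f) (partials (j :: s') f x).
    by split=> //; apply: diff_derivable; exact: df.
  exact: is_deriveD D1 IHL.
have [dSL dSE] := dS L.
rewrite (deriveD dc dSL) dSE.
rewrite -/(partial j (fun y : E => y 0 k * partials s f y) x) partial_coordM; last exact: df.
rewrite big_cat big_map /= [RHS]addrCA -addrA; congr (_ + _).
by case: eqP => _; rewrite ?big_nil ?mul0r// mul1r big_seq1.
Qed.

Lemma schwartz_coordM k f : schwartz f -> schwartz (fun x : E => x 0 k * f x).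
Proof.
move=> sf; split=> [s x|s m]; have [L e] := partials_coordM k s sf.
  rewrite (_ : partials s _ = (fun y : E => y 0 k * partials s f y) +
     (fun y : E => \sum_(s' <- L) partials s' f y)); last first.
    by apply/funext => y; rewrite e.
  apply: differentiableD.
    apply: differentiableM; last exact: sf.1.
    exact: differentiable_coord.
  elim: L {e} => [|s' L IH].
    by under eq_fun do rewrite big_nil; exact: differentiable_cst.
  under eq_fun do rewrite big_cons.
  by apply: differentiableD => //; exact: sf.1.
have [M fM] := sf.2 s m.+1.
have [M' fM'] : exists M', forall x,
    (1 + `|x|) ^+ m * `|\sum_(s' <- L) partials s' f x| <= M'.
  elim: L {e} => [|s' L [M' IH]].
    by exists 0 => x; rewrite big_nil normr0 mulr0.
  have [M'' fM''] := sf.2 s' m; exists (M'' + M') => x.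
  rewrite big_cons; apply: le_trans (lerD (fM'' x) (IH x)).
  by rewrite -mulrDr ler_wpM2l ?exprn_ge0 ?addr_ge0// ler_normD.
exists (M + M') => x; rewrite e; apply: le_trans (lerD (fM x) (fM' x)).
apply: (@le_trans _ _ ((1 + `|x|) ^+ m *
  (`|x 0 k * partials s f x| + `|\sum_(s' <- L) partials s' f x|))).
  by rewrite ler_wpM2l ?exprn_ge0 ?addr_ge0// ler_normD.
rewrite mulrDr lerD2r normrM exprSr -mulrA ler_wpM2l ?exprn_ge0 ?addr_ge0//.
by rewrite ler_wpM2r// (le_trans (entry_le_norm x k))// lerDr.
Qed.

End PartialDerivatives.

(** * Functions of slow growth as distributions *)
Section SlowGrowth.
Variables (R : realType) (n : nat).
Local Notation E := 'rV[R]_n.+1.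
Implicit Types (u v f : E -> R) (k : 'I_n.+1) (x : E).

(** Continuous functions of polynomial growth: they define distributions by
    integration, and products and polynomials stay in the class. *)
Definition slow u : Prop :=
  seq_continuous u /\ exists (m : nat) (M : R), forall x, `|u x| <= M * (1 + `|x|) ^+ m.

(** The distribution defined by u. *)
Definition pairing u f : R := integral_rV (fun x => u x * f x).

Lemma slow_bound_ge0 (M : R) m u : (forall x, `|u x| <= M * (1 + `|x|) ^+ m) -> 0 <= M.
Proof. by move=> /(_ 0); rewrite normr0 addr0 expr1n mulr1; apply: le_trans. Qed.

Lemma slowD u v : slow u -> slow v -> slow (fun x => u x + v x).
Proof.
move=> [cu [m [M uM]]] [cv [m' [M' vM]]]; split=> [y x yx|].
  by apply: cvgD; [exact: cu|exact: cv].
exists (m + m')%N, (M + M') => x.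
have x1 : 1 <= 1 + `|x| by rewrite lerDl.
rewrite (le_trans (ler_normD _ _))// mulrDl lerD//.
  rewrite (le_trans (uM x))// ler_wpM2l ?(slow_bound_ge0 uM)//.
  by rewrite ler_weXn2l// leq_addr.
rewrite (le_trans (vM x))// ler_wpM2l ?(slow_bound_ge0 vM)//.
by rewrite ler_weXn2l// leq_addl.
Qed.

Lemma slowM u v : slow u -> slow v -> slow (fun x => u x * v x).
Proof.
move=> [cu [m [M uM]]] [cv [m' [M' vM]]]; split=> [y x yx|].
  by apply: cvgM; [exact: cu|exact: cv].
exists (m + m')%N, (M * M') => x.
rewrite normrM exprD mulrACA; apply: ler_pM => //.
Qed.

Lemma slow_cst (c : R) : slow (fun=> c).
Proof.
split=> [y x _|]; first exact: cvg_cst.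
by exists 0%N, `|c| => x; rewrite expr0 mulr1.
Qed.

Lemma slow_coord k : slow (fun x => x 0 k).
Proof.
split=> [y x yx|]; first exact: yx.
by exists 1%N, 1 => x; rewrite mul1r expr1 (le_trans (entry_le_norm x k))// lerDr.
Qed.

Lemma slowZ (c : R) u : slow u -> slow (fun x => c * u x).
Proof. by apply: slowM; exact: slow_cst. Qed.

Lemma slowN u : slow u -> slow (fun x => - u x).
Proof.
move=> su; rewrite (_ : (fun x => _) = (fun x => -1 * u x)); first exact: slowZ.
by apply/funext => x; rewrite mulN1r.
Qed.

Lemma slow_sum (T : Type) (L : seq T) (F : T -> E -> R) :
  (forall i, slow (F i)) -> slow (fun x => \sum_(i <- L) F i x).
Proof.
move=> sF; elim: L => [|i L IH].
  by under eq_fun do rewrite big_nil; exact: slow_cst.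
by under eq_fun do rewrite big_cons; exact: slowD.
Qed.

Lemma weight_ge x : (1 + `|x|) ^- (2 * n.+1) <= weight x.
Proof.
rewrite exprM -exprVn -[X in _ ^+ X]card_ord -prodr_const; apply: ler_prod => i _.
rewrite invr_ge0 exprn_ge0 ?addr_ge0//= /cauchy_weight lef_pV2.
- have xi := entry_le_norm x i; have x0 := normr_ge0 (x 0 i).
  have x2 : x 0 i ^+ 2 = `|x 0 i| ^+ 2 by rewrite real_normK ?num_real.
  by rewrite /oneDsqr x2; nra.
- by rewrite posrE exprn_gt0// ltr_pwDl.
- by rewrite posrE (lt_le_trans ltr01).
Qed.

Lemma slow_schwartz_tame u f : slow u -> schwartz f ->
  exists C, tame C (fun x => u x * f x).
Proof.
move=> [cu [m [M uM]]] sf; have [M' fM'] := schwartz_decay (m + 2 * n.+1) sf.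
exists (M * M'); split=> [y x yx|x].
  by apply: cvgM; [exact: cu|exact: schwartz_seq_continuous yx].
have M'0 : 0 <= M'.
  have := fM' 0; rewrite normr0 addr0 expr1n invr1 mulr1; exact: le_trans.
rewrite normrM; apply: (@le_trans _ _ (M * M' * (1 + `|x|) ^- (2 * n.+1))).
  apply: le_trans (ler_pM _ _ (uM x) (fM' x)) _ => //.
  rewrite exprD invfM mulrACA ler_wpM2l ?mulr_ge0 ?(slow_bound_ge0 uM)//.
  by rewrite mulrA divff ?mul1r// expf_neq0// gt_eqF// ltr_pwDl.
by rewrite ler_wpM2l ?weight_ge// mulr_ge0// (slow_bound_ge0 uM).
Qed.

Lemma pairingD u v f : slow u -> slow v -> schwartz f ->
  pairing (fun x => u x + v x) f = pairing u f + pairing v f.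
Proof.
move=> su sv sf; have [C tC] := slow_schwartz_tame su sf.
have [D tD] := slow_schwartz_tame sv sf.
rewrite /pairing -(integral_rVD tC tD); congr integral_rV.
by apply/funext => x; rewrite mulrDl.
Qed.

Lemma pairingZ (c : R) u f : slow u -> schwartz f ->
  pairing (fun x => c * u x) f = c * pairing u f.
Proof.
move=> su sf; have [C tC] := slow_schwartz_tame su sf.
rewrite /pairing -(integral_rVZ c tC); congr integral_rV.
by apply/funext => x; rewrite mulrA.
Qed.

Lemma pairing0 f : pairing (fun=> 0) f = 0.
Proof.
have t0 : @tame R n.+1 0 (fun=> 0).
  by split=> [y x _|x]; [exact: cvg_cst|rewrite normr0 mul0r].
rewrite /pairing (_ : (fun x => _) = fun x => 0 * 0).
  by rewrite (integral_rVZ 0 t0) mul0r.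
by apply/funext => x; rewrite mul0r mulr0.
Qed.

Lemma pairing_coord k u f : pairing u (fun x => x 0 k * f x) =
  pairing (fun x => x 0 k * u x) f.
Proof. by rewrite /pairing; congr integral_rV; apply/funext => x; rewrite mulrCA mulrA. Qed.

(** Integration by parts: the product u f is dominated and has integrable partial
    derivative of integral 0. *)
Lemma pairing_partial k u u' f : slow u -> slow u' -> has_partial k u u' ->
  schwartz f -> pairing u (partial k f) = - pairing u' f.
Proof.
move=> su su' du sf; have spf := schwartz_partial k sf.
have [C tC] := slow_schwartz_tame su sf.
have [C1 t1] := slow_schwartz_tame su spf.
have [C2 t2] := slow_schwartz_tame su' sf.
have tD : tame (C1 + C2) (fun x => u x * partial k f x + u' x * f x).
  split=> [y x yx|x].
    by apply: cvgD; [case: t1 => /(_ y x yx)|case: t2 => /(_ y x yx)].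
  rewrite (le_trans (ler_normD _ _))// mulrDl lerD//; first by case: t1.
  by case: t2.
apply/eqP; rewrite -addr_eq0 /pairing -(integral_rVD t1 t2); apply/eqP.
apply: integral_partial_eq0 tC tD _ => x.
have dM := is_deriveM (du x) (schwartz_has_partial k sf x).
by apply: (is_derive_eq dM); rewrite /GRing.scale/= [f x * _]mulrC.
Qed.

End SlowGrowth.

(** * Signed powers *)
Section SignedPowers.
Variable R : realType.
Implicit Types (s : bool) (a t : R).

(** The powers |t|^a and sgn(t) |t|^a, for [s] true and false. Treating both at
    once, with values at 0 included, gives one differentiation rule that
    exchanges them and holds on the whole line ([is_derive_spow]). *)
Definition spow s a t : R := (if s then 1 else Num.sg t) * `|t| `^ a.

Lemma spow0 s a : a != 0 -> spow s a 0 = 0.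
Proof. by move=> a0; rewrite /spow normr0 powR0// mulr0. Qed.

Lemma spow_gt0 s a t : 0 < t -> spow s a t = t `^ a.
Proof. by move=> t0; rewrite /spow gtr0_sg// if_same mul1r gtr0_norm. Qed.

Lemma spow_lt0 s a t : t < 0 -> spow s a t = (if s then 1 else -1) * (- t) `^ a.
Proof. by move=> t0; rewrite /spow ltr0_sg// ltr0_norm. Qed.

Lemma spow_ge0 s a t : a != 0 -> 0 <= t -> spow s a t = spow true a t.
Proof.
move=> a0; rewrite le_eqVlt => /predU1P[<-|t0]; first by rewrite !spow0.
by rewrite !spow_gt0.
Qed.

Lemma norm_spow_le s a t : `|spow s a t| <= `|t| `^ a.
Proof.
rewrite normrM [X in _ * X]ger0_norm ?powR_ge0// ler_piMl ?powR_ge0//.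
by case: s; rewrite ?normr1// normr_sg; case: (t == 0).
Qed.

Lemma mul_spow s a t : 0 < a -> t * spow s a t = spow (~~ s) (a + 1) t.
Proof.
move=> a0; have a1 : a + 1 != 0 by rewrite gt_eqF// addr_gt0.
have [t0|t0|->] := ltrgtP t 0; last by rewrite mul0r spow0.
- rewrite !spow_lt0// powRD ?(negbTE a1)// powRr1 ?oppr_ge0 ?ltW//.
  by case: s; rewrite /= ?mulN1r ?mul1r; ring.
- by rewrite !spow_gt0// powRD ?(negbTE a1)// powRr1 ?ltW// mulrC.
Qed.

(** Away from 0 this is the derivative of a power; at 0 the difference quotient is
    at most |h|^(a-1), hence at most |h| near 0 because a > 2. *)
Lemma is_derive_spow s a t : 2 < a ->
  is_derive t 1 (spow s a) (a * spow (~~ s) (a - 1) t).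
Proof.
move=> a2; have [t0|t0|->] := ltrgtP t 0.
- have e : {near t, (fun u => (if s then 1 else -1) * (- u) `^ a) =1 spow s a}.
    by near=> u; rewrite spow_lt0//; near: u; exact: lt_nbhsl.
  apply: near_eq_is_derive e _.
  have Nt : 0 < - t by rewrite oppr_gt0.
  have d1 := is_derive1_powR a Nt.
  have d2 : is_derive t (1 : R) (fun u : R => - u) (-1) by exact: (is_deriveNid t (1 : R)).
  have d3 := @is_derive1_comp R (fun u : R => u `^ a) (fun u : R => - u) t _ _ d1 d2.
  have d4 := is_deriveZ (if s then 1 else -1) d3.
  apply: (is_derive_eq d4); rewrite spow_lt0//.
  by clear d4; case: s => /=; rewrite /GRing.scale/=; ring.
- have e : {near t, (fun u => u `^ a) =1 spow s a}.
    by near=> u; rewrite spow_gt0//; near: u; exact: lt_nbhsr.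
  apply: near_eq_is_derive e _.
  by rewrite spow_gt0//; exact: is_derive1_powR.
- have a10 : a - 1 != 0 by rewrite gt_eqF// subr_gt0; lra.
  have a0 : a != 0 by rewrite gt_eqF//; lra.
  rewrite spow0// mulr0.
  have q0 : (fun h : R => h^-1 *: (spow s a (h *: (1 : R) + 0) - spow s a 0))
      @ 0^' --> (0 : R).
    apply/cvgrPdist_le => e e0; near=> h.
    have h0 : h != 0 by near: h; exact: nbhs_dnbhs_neq.
    rewrite spow0// addr0 sub0r subr0 normrN [h *: (1 : R)]mulr1.
    rewrite normrM normfV ler_pdivrMl ?normr_gt0//.
    apply: le_trans (norm_spow_le _ _ _) _.
    have h1 : `|h| <= Num.min 1 e.
      near: h; apply: dnbhs0_le; by rewrite lt_min ltr01.
    move: h1; rewrite le_min => /andP[h1 he].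
    apply: (@le_trans _ _ (`|h| `^ 2)).
      by apply: ger_powR; [rewrite normr_gt0 h0|exact: ltW].
    by rewrite powR_mulrn// expr2 ler_wpM2l.
  split; first by apply/cvg_ex; exists 0.
  by apply: cvg_lim q0.
Unshelve. all: end_near. Qed.

Lemma spow_growth s a m t : 0 <= a -> a <= m%:R -> `|spow s a t| <= (1 + `|t|) ^+ m.
Proof.
move=> a0 am; apply: le_trans (norm_spow_le _ _ _) _.
apply: (@le_trans _ _ ((1 + `|t|) `^ a)).
  by apply: ge0_ler_powR; rewrite ?nnegrE ?addr_ge0// lerDr.
by rewrite -powR_mulrn ?addr_ge0//; apply: ler_powR => //; rewrite lerDl.
Qed.

End SignedPowers.

(** * Derivatives of the scalar kernel *)
Section Densities.
Variables (R : realType) (n : nat).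
Local Notation E := 'rV[R]_n.+1.
Implicit Types (u v f : E -> R) (j k : 'I_n.+1) (x : E) (s : bool) (a b : R).
Local Notation m := (@ord_max n).
Local Notation coords x := (fun k => x 0 k).

Lemma eq_has_partial k u v u' v' : u =1 v -> u' =1 v' ->
  has_partial k u u' -> has_partial k v v'.
Proof. by move=> /funext <- /funext <-. Qed.

Lemma has_partialD k u v u' v' : has_partial k u u' -> has_partial k v v' ->
  has_partial k (fun x => u x + v x) (fun x => u' x + v' x).
Proof. by move=> du dv x; exact: is_deriveD (du x) (dv x). Qed.

Lemma has_partialM k u v u' v' : has_partial k u u' -> has_partial k v v' ->
  has_partial k (fun x => u x * v x) (fun x => u' x * v x + u x * v' x).
Proof.
move=> du dv x; apply: (is_derive_eq (is_deriveM (du x) (dv x))).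
by rewrite /GRing.scale/= addrC [v x * _]mulrC.
Qed.

Lemma has_partial_cst k (c : R) : has_partial k (fun=> c) (fun=> 0).
Proof. by move=> x; exact: is_derive_cst. Qed.

Lemma has_partialZ k (c : R) u u' : has_partial k u u' ->
  has_partial k (fun x => c * u x) (fun x => c * u' x).
Proof.
move=> du; apply: eq_has_partial (has_partialM (has_partial_cst k c) du) => x //.
by rewrite mul0r add0r.
Qed.

Lemma has_partial_coord j k :
  has_partial j (fun x => x 0 k) (fun=> (k == j)%:R).
Proof. by move=> x; exact: is_derive_coord. Qed.

Lemma has_partial_sum k (T : Type) (L : seq T) (F F' : T -> E -> R) :
  (forall i, has_partial k (F i) (F' i)) ->
  has_partial k (fun x => \sum_(i <- L) F i x) (fun x => \sum_(i <- L) F' i x).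
Proof.
move=> dF; elim: L => [|i L IH].
  by apply: eq_has_partial (has_partial_cst k 0) => x; rewrite big_nil.
by apply: eq_has_partial (has_partialD (dF i) IH) => x; rewrite big_cons.
Qed.

Lemma has_partial_comp k u u' (g g' : R -> R) : has_partial k u u' ->
  (forall t : R, is_derive t (1 : R) g (g' t)) ->
  has_partial k (fun x => g (u x)) (fun x => g' (u x) * u' x).
Proof.
move=> du dg x; apply: is_derive_of_line.
have d1 : is_derive (0 : R) (1 : R)
    (fun t : R => u (x + t *: delta_mx 0 k)) (u' x).
  by apply: is_derive_line; rewrite scale0r addr0.
have d2 := dg (u (x + 0 *: delta_mx 0 k)).
have := @is_derive1_comp R g (fun t : R => u (x + t *: delta_mx 0 k)) 0 _ _ d2 d1.
by rewrite scale0r addr0.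
Qed.

Lemma has_partial_sqnorm k :
  has_partial k (fun x => sqnorm (coords x)) (fun x => 2 * x 0 k).
Proof.
have := @has_partial_sum k _ (index_enum 'I_n.+1) (fun i x => x 0 i * x 0 i)
  _ (fun i => has_partialM (has_partial_coord k i) (has_partial_coord k i)).
apply: eq_has_partial => x; first by apply: eq_bigr => i _; rewrite expr2.
rewrite (bigD1 k)//= eqxx big1 ?addr0 => [|i /negbTE ->].
  by rewrite mulr1n; ring.
by rewrite mul0r mulr0 addr0.
Qed.

Lemma seq_continuous_comp (g : R -> R) u : continuous g -> seq_continuous u ->
  seq_continuous (fun x => g (u x)).
Proof. by move=> cg cu y x yx; exact: cvg_comp (cu y x yx) (cg (u x)). Qed.

Lemma slow_spow s a u : 2 < a -> slow u -> slow (fun x => spow s a (u x)).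
Proof.
move=> a2 [cu [p [M uM]]]; split.
  apply: seq_continuous_comp cu => t; apply: differentiable_continuous.
  apply/derivable1_diffP; by case: (is_derive_spow s t a2).
have [q aq] : exists q : nat, a <= q%:R.
  by exists (Num.bound a); apply: ltW; apply: archi_boundP; lra.
exists (p * q)%N, ((1 + M) ^+ q) => x.
have M0 := slow_bound_ge0 uM.
apply: le_trans (spow_growth s (u x) _ aq) _; first lra.
rewrite exprM -exprMn; apply: lerXn2r; rewrite ?nnegrE ?addr_ge0 ?mulr_ge0 ?exprn_ge0 ?addr_ge0//.
rewrite mulrDl mul1r lerD//.
by apply: exprn_ege1; rewrite lerDl.
Qed.

(** The scalar kernel. The power of the squared norm is taken with [spow true] so
    that the chain rule applies also at the origin. *)
Definition kdensity s a b x : R :=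
  spow s a (x 0 m) * spow true b (sqnorm (coords x)).

Lemma slow_sqnorm : slow (fun x => sqnorm (coords x)).
Proof.
rewrite /sqnorm; apply: slow_sum => i.
by under eq_fun do rewrite expr2; apply: slowM; exact: slow_coord.
Qed.

Lemma sqnorm_ge0 x : 0 <= sqnorm (coords x).
Proof. by apply: sumr_ge0 => i _; exact: sqr_ge0. Qed.

Lemma slow_kdensity s a b : 2 < a -> 2 < b -> slow (kdensity s a b).
Proof.
move=> a2 b2.
have sk := slowM (slow_spow s a2 (slow_coord R m)) (slow_spow true b2 slow_sqnorm).
exact: sk.
Qed.

(** The derivative of the power of the squared norm is a signed power, which
    agrees with the unsigned one since the squared norm is nonnegative. *)
Lemma has_partial_kdensity k s a b : 2 < a -> 2 < b ->
  has_partial k (kdensity s a b) (fun x =>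
    a * (k == m)%:R * kdensity (~~ s) (a - 1) b x
    + 2 * b * x 0 k * kdensity s a (b - 1) x).
Proof.
move=> a2 b2.
have d1 := has_partial_comp (has_partial_coord k m) (fun t => is_derive_spow s t a2).
have d2 := has_partial_comp (has_partial_sqnorm k) (fun t => is_derive_spow true t b2).
apply: eq_has_partial (has_partialM d1 d2) => x //.
rewrite /kdensity (eq_sym m k) [spow (~~ true) _ _]spow_ge0.
- by ring.
- by rewrite gt_eqF//; lra.
- exact: sqnorm_ge0.
Qed.

Lemma kdensity_coordM s a b x : 0 < a ->
  x 0 m * kdensity s a b x = kdensity (~~ s) (a + 1) b x.
Proof. by move=> a0; rewrite /kdensity mulrA mul_spow. Qed.

Lemma kdensity_sqnormM s a b x : 0 < b ->
  sqnorm (coords x) * kdensity s a b x = kdensity s a (b + 1) x.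
Proof.
move=> b0; rewrite /kdensity mulrCA mul_spow//=; congr (_ * _).
by apply: spow_ge0; [rewrite gt_eqF// addr_gt0|exact: sqnorm_ge0].
Qed.

Lemma has_partial_kdensity1 k s a b : 4 < a -> 4 < b ->
  has_partial k (kdensity s a b)
    (fun x => density1 (coords x) m (kdensity s (a - 2) (b - 2) x) a b k).
Proof.
move=> a4 b4; apply: eq_has_partial (@has_partial_kdensity k s a b _ _) => // [x||];
  [rewrite /density1|lra..].
have -> : kdensity (~~ s) (a - 1) b x =
    x 0 m * (sqnorm (coords x) * (sqnorm (coords x) * kdensity s (a - 2) (b - 2) x)).
  rewrite !kdensity_sqnormM ?kdensity_coordM; try lra.
  by congr kdensity; ring.
have -> : kdensity s a (b - 1) x =
    x 0 m * (x 0 m * (sqnorm (coords x) * kdensity s (a - 2) (b - 2) x)).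
  rewrite !kdensity_sqnormM
  ?kdensity_coordM ?kdensity_coordM ?negbK; try lra.
  by congr kdensity; ring.
by ring.
Qed.

End Densities.

(** * Derivatives of form-valued fields *)
Section Fields.
Variables (R : realType) (n : nat).
Local Notation E := 'rV[R]_n.+1.
Local Notation form := (extform n.+1 (R^o)).
Implicit Types (F G : E -> form) (u : E -> R) (j k : 'I_n.+1) (x : E) (w : form).
Local Notation m := (@ord_max n).
Local Notation coords x := (fun k => x 0 k).

Section Density2.
Variables (s : bool) (a b : R) (x : E).
Local Notation B := (kdensity s (a - 2) (b - 2) x).
Local Notation t := (x 0 m).
Local Notation r := (sqnorm (coords x)).

(** In this lemma and the next five the two digits are the powers of x_n and of
    |x|^2 by which the lowest density, with exponents a - 2 and b - 2, has to be
    multiplied (02 meaning power 0 of x_n). *)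
Lemma kdensity22 : 4 < a -> 4 < b ->
  kdensity s a b x = t ^+ 2 * r ^+ 2 * B.
Proof.
move=> a4 b4; rewrite -mulrA !expr2 -!mulrA !kdensity_sqnormM
  ?kdensity_coordM ?kdensity_coordM ?negbK; try lra.
by congr kdensity; ring.
Qed.

Lemma kdensity12 : 4 < a -> 4 < b ->
  kdensity (~~ s) (a - 1) b x = t * r ^+ 2 * B.
Proof.
move=> a4 b4; rewrite -mulrA !expr2 -!mulrA !kdensity_sqnormM ?kdensity_coordM; try lra.
by congr kdensity; ring.
Qed.

Lemma kdensity21 : 4 < a -> 4 < b ->
  kdensity s a (b - 1) x = t ^+ 2 * r * B.
Proof.
move=> a4 b4; rewrite -mulrA !expr2 -!mulrA !kdensity_sqnormM ?kdensity_coordM ?kdensity_coordM ?negbK; try lra.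
by congr kdensity; ring.
Qed.

Lemma kdensity02 : 4 < a -> 4 < b ->
  kdensity s (a - 1 - 1) b x = r ^+ 2 * B.
Proof.
move=> a4 b4; rewrite !expr2 -!mulrA !kdensity_sqnormM; try lra.
by congr kdensity; ring.
Qed.

Lemma kdensity11 : 4 < a -> 4 < b ->
  kdensity (~~ s) (a - 1) (b - 1) x = t * r * B.
Proof.
move=> a4 b4; rewrite -!mulrA !kdensity_sqnormM ?kdensity_coordM; try lra.
by congr kdensity; ring.
Qed.

Lemma kdensity20 : 4 < a -> 4 < b ->
  kdensity s a (b - 1 - 1) x = t ^+ 2 * B.
Proof.
move=> a4 b4; rewrite !expr2 -!mulrA ?kdensity_coordM ?kdensity_coordM ?negbK; try lra.
by congr kdensity; ring.
Qed.

Lemma density1E k : 4 < a -> 4 < b -> density1 (coords x) m B a b k =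
  a * (k == m)%:R * kdensity (~~ s) (a - 1) b x
  + 2 * b * x 0 k * kdensity s a (b - 1) x.
Proof. by move=> a4 b4; rewrite kdensity12// kdensity21// /density1; ring. Qed.

Lemma density2E j k : 4 < a -> 4 < b -> density2 (coords x) m B a b j k =
  a * (k == m)%:R * ((a - 1) * (j == m)%:R * kdensity s (a - 1 - 1) b x
    + 2 * b * x 0 j * kdensity (~~ s) (a - 1) (b - 1) x)
  + (2 * b * (k == j)%:R * kdensity s a (b - 1) x
     + 2 * b * x 0 k * (a * (j == m)%:R * kdensity (~~ s) (a - 1) (b - 1) x
        + 2 * (b - 1) * x 0 j * kdensity s a (b - 1 - 1) x)).
Proof.
move=> a4 b4; rewrite kdensity02// kdensity11// kdensity21// kdensity20//.
by rewrite /density2 (eq_sym j k); ring.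
Qed.
End Density2.

Lemma has_partial_density1 s (a b : R) j k : 4 < a -> 4 < b ->
  has_partial j
    (fun x => density1 (coords x) m (kdensity s (a - 2) (b - 2) x) a b k)
    (fun x => density2 (coords x) m (kdensity s (a - 2) (b - 2) x) a b j k).
Proof.
move=> a4 b4.
have a2 : 2 < a by lra. have b2 : 2 < b by lra.
have a12 : 2 < a - 1 by lra. have b12 : 2 < b - 1 by lra.
have d1 := has_partial_kdensity j (~~ s) a12 b2.
have d2 := has_partial_kdensity j s a2 b12.
have d3 := has_partialM (has_partialZ (2 * b) (@has_partial_coord R n j k)) d2.
apply: eq_has_partial (has_partialD (has_partialZ (a * (k == m)%:R) d1) d3) => x.
  by rewrite density1E//; ring.
by rewrite negbK density2E//; ring.
Qed.

Definition field_partial k F F' : Prop :=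
  forall I, has_partial k (fun x => F x I) (fun x => F' x I).

Definition slow_field F : Prop := forall I, slow (fun x => F x I).

Lemma eq_field_partial k F G F' G' : F =1 G -> F' =1 G' ->
  field_partial k F F' -> field_partial k G G'.
Proof. by move=> /funext <- /funext <-. Qed.

Lemma field_partialD k F F' G G' : field_partial k F F' -> field_partial k G G' ->
  field_partial k (fun x => F x + G x) (fun x => F' x + G' x).
Proof. by move=> dF dG I; exact: has_partialD (dF I) (dG I). Qed.

Lemma field_partial_cst k w : field_partial k (fun=> w) (fun=> 0).
Proof. by move=> I; exact: has_partial_cst. Qed.

Lemma field_partialM k u u' F F' : has_partial k u u' -> field_partial k F F' ->
  field_partial k (fun x => u x *: F x) (fun x => u' x *: F x + u x *: F' x).
Proof. by move=> du dF I; exact: has_partialM du (dF I). Qed.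

Lemma field_partialZ k (c : R) F F' : field_partial k F F' ->
  field_partial k (fun x => c *: F x) (fun x => c *: F' x).
Proof. by move=> dF I; exact: has_partialZ. Qed.

Lemma field_partial_ext k j F F' : field_partial k F F' ->
  field_partial k (fun x => ext_basis j (F x)) (fun x => ext_basis j (F' x)).
Proof.
move=> dF I; have [jI|jI] := boolP (j \in I).
  apply: eq_has_partial (has_partialZ ((-1) ^+ nbelow j I) (dF (I :\ j))) => x;
    by rewrite /ext_basis jI -mulrzl rmorphXn/= mulrN1z.
by apply: eq_has_partial (has_partial_cst k 0) => x; rewrite /ext_basis (negbTE jI).
Qed.

Lemma field_partial_int k j F F' : field_partial k F F' ->
  field_partial k (fun x => int_basis j (F x)) (fun x => int_basis j (F' x)).
Proof.
move=> dF I; have [jI|jI] := boolP (j \in I).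
  by apply: eq_has_partial (has_partial_cst k 0) => x; rewrite /int_basis jI.
apply: eq_has_partial (has_partialZ ((-1) ^+ nbelow j I) (dF (j |: I))) => x;
  by rewrite /int_basis (negbTE jI) -mulrzl rmorphXn/= mulrN1z.
Qed.

Lemma field_partial_sum k (F F' : 'I_n.+1 -> E -> form) :
  (forall i, field_partial k (F i) (F' i)) ->
  field_partial k (fun x => \sum_i F i x) (fun x => \sum_i F' i x).
Proof.
move=> dF I; apply: eq_has_partial (has_partial_sum _ (fun i => dF i I)) => x;
  by rewrite fct_sumE.
Qed.

Lemma slow_ext j F : slow_field F -> slow_field (fun x => ext_basis j (F x)).
Proof.
move=> sF I; have [jI|jI] := boolP (j \in I).
  under eq_fun do rewrite /ext_basis jI -mulrzl; exact: slowZ.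
by under eq_fun do rewrite /ext_basis (negbTE jI); exact: slow_cst.
Qed.

Lemma slow_int j F : slow_field F -> slow_field (fun x => int_basis j (F x)).
Proof.
move=> sF I; have [jI|jI] := boolP (j \in I).
  by under eq_fun do rewrite /int_basis jI; exact: slow_cst.
under eq_fun do rewrite /int_basis (negbTE jI) -mulrzl; exact: slowZ.
Qed.

Lemma slow_fieldD F G : slow_field F -> slow_field G ->
  slow_field (fun x => F x + G x).
Proof. by move=> sF sG I; exact: slowD (sF I) (sG I). Qed.

Lemma slow_fieldM u F : slow u -> slow_field F -> slow_field (fun x => u x *: F x).
Proof. by move=> su sF I; exact: slowM su (sF I). Qed.

Lemma slow_fieldZ (c : R) F : slow_field F -> slow_field (fun x => c *: F x).
Proof. by move=> sF I; exact: slowZ. Qed.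

Lemma slow_fieldN F : slow_field F -> slow_field (fun x => - F x).
Proof. by move=> sF I; exact: slowN. Qed.

Lemma slow_field_cst w : slow_field (fun=> w).
Proof. by move=> I; exact: slow_cst. Qed.

Lemma slow_field_sum (F : 'I_n.+1 -> E -> form) :
  (forall i, slow_field (F i)) -> slow_field (fun x => \sum_i F i x).
Proof.
move=> sF I; under eq_fun do rewrite fct_sumE; apply: slow_sum => i; exact: sF.
Qed.

Lemma field_partial_exterior k F F' : field_partial k F F' ->
  field_partial k (fun x => exterior_by (coords x) (F x))
    (fun x => ext_basis k (F x) + exterior_by (coords x) (F' x)).
Proof.
move=> dF; apply: eq_field_partial (field_partial_sum (fun i =>
  field_partialM (@has_partial_coord R n k i) (field_partial_ext i dF))) => // x.
by rewrite big_split /= sumZ_delta.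
Qed.

Lemma field_partial_interior k F F' : field_partial k F F' ->
  field_partial k (fun x => interior_by (coords x) (F x))
    (fun x => int_basis k (F x) + interior_by (coords x) (F' x)).
Proof.
move=> dF; apply: eq_field_partial (field_partial_sum (fun i =>
  field_partialM (@has_partial_coord R n k i) (field_partial_int i dF))) => // x.
by rewrite big_split /= sumZ_delta.
Qed.

Lemma slow_exterior F : slow_field F ->
  slow_field (fun x => exterior_by (coords x) (F x)).
Proof.
move=> sF; apply: slow_field_sum => i.
by apply: slow_fieldM; [exact: slow_coord|exact: slow_ext].
Qed.

Lemma slow_interior F : slow_field F ->
  slow_field (fun x => interior_by (coords x) (F x)).
Proof.
move=> sF; apply: slow_field_sum => i.
by apply: slow_fieldM; [exact: slow_coord|exact: slow_int].
Qed.

Lemma slow_reflected w : slow_field (fun x => reflected (coords x) w).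
Proof.
apply: slow_fieldD; first exact: slow_fieldM (@slow_sqnorm R n) (slow_field_cst w).
apply/slow_fieldN/slow_fieldZ/slow_exterior/slow_interior; exact: slow_field_cst.
Qed.

Lemma slow_reflected1 k w : slow_field (fun x => reflected1 (coords x) w k).
Proof.
apply: slow_fieldD; first apply: slow_fieldD.
- apply: slow_fieldM (slow_field_cst w); apply: slowZ; exact: slow_coord.
- apply/slow_fieldN/slow_fieldZ/slow_ext/slow_interior; exact: slow_field_cst.
- apply/slow_fieldN/slow_fieldZ/slow_exterior; exact: slow_field_cst.
Qed.

Lemma field_partial_reflected k w :
  field_partial k (fun x => reflected (coords x) w)
    (fun x => reflected1 (coords x) w k).
Proof.
have d1 := field_partialM (@has_partial_sqnorm R n k) (field_partial_cst k w).
have d2 := field_partial_exterior (field_partial_interior (field_partial_cst k w)).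
apply: eq_field_partial (field_partialD d1 (field_partialZ (-2) d2)) => x.
  by rewrite /reflected scaleNr.
rewrite /reflected1 [interior_by _ 0]linear0 addr0; form_ring.
Qed.

Lemma field_partial_reflected1 j k w :
  field_partial j (fun x => reflected1 (coords x) w k)
    (fun=> reflected2 w j k).
Proof.
have d1 := field_partialM (has_partialZ 2 (@has_partial_coord R n j k)) (field_partial_cst j w).
have d2 := field_partial_ext k (field_partial_interior (field_partial_cst j w)).
have d3 := field_partial_exterior (field_partial_cst j (int_basis k w)).
apply: eq_field_partial (field_partialD (field_partialD d1 (field_partialZ (-2) d2))
  (field_partialZ (-2) d3)) => x.
  by rewrite /reflected1 !scaleNr.
rewrite /reflected2 (eq_sym j k) [interior_by _ 0]linear0 [exterior_by _ 0]linear0 addr0.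
form_ring.
Qed.

End Fields.

(** * The operator on distributions represented by fields *)
Lemma fct_mulrn (U : Type) (V : zmodType) (g : U -> V) (p : nat) y :
  (g *+ p) y = g y *+ p.
Proof. by elim: p => [//|p IH]; rewrite !mulrS -IH. Qed.

Lemma fct_mulrz (U : Type) (V : zmodType) (g : U -> V) (z : int) y :
  (g *~ z) y = g y *~ z.
Proof.
case: z => p; first by rewrite -!pmulrn fct_mulrn.
by rewrite !NegzE !mulrNz -!pmulrn -fct_mulrn.
Qed.

Section Representation.
Variables (R : realType) (n : nat).
Local Notation E := 'rV[R]_n.+1.
Local Notation C := (R[i]^o).
Local Notation form := (extform n.+1 (R^o)).
Implicit Types (F G : E -> form) (j k : 'I_n.+1) (x : E) (w : form)
  (Om : extform n.+1 (dist R n.+1)).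
Local Notation m := (@ord_max n).
Local Notation coords x := (fun k => x 0 k).

(** Slow growth is part of the relation so that it is stable under all operations
    entering the differential operator. *)
Definition represents F Om : Prop := slow_field F /\ forall I f, schwartz f ->
  Om I f = (pairing (fun x => F x I) f)%:C.

Lemma field_partialN k F F' : field_partial k F F' ->
  field_partial k (fun x => - F x) (fun x => - F' x).
Proof.
by move=> dF; apply: eq_field_partial (field_partialZ (-1) dF) => x;
  rewrite scaleN1r.
Qed.

Lemma eq_represents F G Om : F =1 G -> represents F Om -> represents G Om.
Proof. by move=> /funext <-. Qed.

Lemma represents_partial k F F' Om : slow_field F' ->
  field_partial k F F' -> represents F Om -> represents F' (form_partial k Om).
Proof.
move=> sF' dF [sF rF]; split=> // I f sf; rewrite /form_partial /dist_partial rF.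
  by rewrite (pairing_partial (sF I) (sF' I) (dF I) sf) rmorphN opprK.
exact: schwartz_partial.
Qed.

Lemma represents_coord k F Om : represents F Om ->
  represents (fun x => x 0 k *: F x) (form_coord k Om).
Proof.
move=> [sF rF]; split=> [|I f sf].
  by apply: slow_fieldM => //; exact: slow_coord.
rewrite /form_coord /dist_coord rF; first by rewrite pairing_coord.
exact: schwartz_coordM.
Qed.

Lemma represents_ext k F Om : represents F Om ->
  represents (fun x => ext_basis k (F x)) (ext_basis k Om).
Proof.
move=> [sF rF]; split=> [|I f sf]; first exact: slow_ext.
rewrite /ext_basis; case: ifP => kI; last by rewrite pairing0.
under eq_fun do rewrite -mulrzl.
by rewrite pairingZ// rmorphM/= -rF// rmorph_int mulrzl fct_mulrz.
Qed.

Lemma represents_int k F Om : represents F Om ->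
  represents (fun x => int_basis k (F x)) (int_basis k Om).
Proof.
move=> [sF rF]; split=> [|I f sf]; first exact: slow_int.
rewrite /int_basis; case: ifP => kI; first by rewrite pairing0.
under eq_fun do rewrite -mulrzl.
by rewrite pairingZ// rmorphM/= -rF// rmorph_int mulrzl fct_mulrz.
Qed.

Lemma representsD F G Om Om' : represents F Om -> represents G Om' ->
  represents (fun x => F x + G x) (Om + Om').
Proof.
move=> [sF rF] [sG rG]; split=> [|I f sf]; first exact: slow_fieldD.
by rewrite !fctE rF// rG// -rmorphD/= -(pairingD (sF I) (sG I) sf).
Qed.

Lemma representsZ (c : R) F Om : represents F Om ->
  represents (fun x => c *: F x) (c%:C *: Om).
Proof.
move=> [sF rF]; split=> [|I f sf]; first exact: slow_fieldZ.
by rewrite !fctE rF// -[LHS]rmorphM/= -(pairingZ c (sF I) sf).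
Qed.

Lemma representsN F Om : represents F Om -> represents (fun x => - F x) (- Om).
Proof.
move=> /(representsZ (-1)); rewrite rmorphN rmorph1 scaleN1r.
by apply: eq_represents => x; rewrite scaleN1r.
Qed.

Lemma represents_sum (F : 'I_n.+1 -> E -> form)
  (Om : 'I_n.+1 -> extform n.+1 (dist R n.+1)) :
  (forall k, represents (F k) (Om k)) ->
  represents (fun x => \sum_k F k x) (\sum_k Om k).
Proof.
move=> rF; elim: (index_enum _) => [|k L IH] .
  rewrite big_nil; apply: (@eq_represents (fun=> 0)) => [x|].
    by rewrite big_nil.
  by split=> [I|I f sf]; [exact: slow_cst|rewrite pairing0].
rewrite big_cons; apply: (@eq_represents (fun x => F k x + \sum_(k <- L) F k x)).
  by move=> x; rewrite big_cons.
exact: representsD.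
Qed.

Lemma represents_ext_deriv F (F1 : 'I_n.+1 -> E -> form) Om :
  (forall k, slow_field (F1 k)) -> (forall k, field_partial k F (F1 k)) ->
  represents F Om ->
  represents (fun x => \sum_k ext_basis k (F1 k x)) (ext_deriv Om).
Proof.
move=> sF1 dF rF; apply: represents_sum => k.
by apply: represents_ext; exact: represents_partial (dF k) rF.
Qed.

Lemma represents_coderiv F (F1 : 'I_n.+1 -> E -> form) Om :
  (forall k, slow_field (F1 k)) -> (forall k, field_partial k F (F1 k)) ->
  represents F Om ->
  represents (fun x => - \sum_k int_basis k (F1 k x)) (coderiv Om).
Proof.
move=> sF1 dF rF; apply: representsN; apply: represents_sum => k.
by apply: represents_int; exact: represents_partial (dF k) rF.
Qed.

Section SecondOrder.
Variables (F : E -> form) (F1 : 'I_n.+1 -> E -> form)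
  (F2 : 'I_n.+1 -> 'I_n.+1 -> E -> form) (Om : extform n.+1 (dist R n.+1)).
Hypotheses (sF1 : forall k, slow_field (F1 k))
  (sF2 : forall j k, slow_field (F2 j k))
  (dF : forall k, field_partial k F (F1 k))
  (dF1 : forall j k, field_partial j (F1 k) (F2 j k))
  (rF : represents F Om).

(** The two derivatives fall on the field by integration by parts, after which the
    operator acts on it by the same formula. *)
Lemma represents_Pop p (l : R) :
  let N : R := n.+1%:R in let q : R := p%:R in
  represents (fun x =>
    - (((2 * l - N - 2) * (l - N + q - 1) * (l - q)) *: F1 m x)
    - (2 * l - N - 2) *:
      ((l - N + q) *: ext_basis m (- \sum_k int_basis k (F1 k x))
       + (l - q) *: \sum_k ext_basis k (int_basis m (F1 k x)))
    - ((l - N + q - 1) * (l - q)) *: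
      (x 0 m *: - \sum_j int_basis j (\sum_k ext_basis k (F2 j k x)))
    - ((l - N + q) * (l - q - 1)) *:
      (x 0 m *: \sum_j ext_basis j (- \sum_k int_basis k (F2 j k x))))
  (Pop p l%:C Om).
Proof.
move=> N q.
have dE j : field_partial j (fun x => \sum_k ext_basis k (F1 k x))
    (fun x => \sum_k ext_basis k (F2 j k x)).
  by apply: field_partial_sum => k; exact: field_partial_ext.
have dI j : field_partial j (fun x => - \sum_k int_basis k (F1 k x))
    (fun x => - \sum_k int_basis k (F2 j k x)).
  by apply/field_partialN/field_partial_sum => k; exact: field_partial_int.
have sE j : slow_field (fun x => \sum_k ext_basis k (F2 j k x)).
  by apply: slow_field_sum => k; exact: slow_ext.
have sI j : slow_field (fun x => - \sum_k int_basis k (F2 j k x)).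
  by apply/slow_fieldN/slow_field_sum => k; exact: slow_int.
have rdel := represents_coderiv sF1 dF rF.
have rdi : represents (fun x => \sum_k ext_basis k (int_basis m (F1 k x)))
    (ext_deriv (int_basis m Om)).
  apply: represents_ext_deriv (represents_int m rF).
    by move=> k; exact: slow_int.
  by move=> k; exact: field_partial_int.
have rdeld := represents_coderiv sE dE (represents_ext_deriv sF1 dF rF).
have rddel := represents_ext_deriv sI dI rdel.
rewrite /Pop.
have -> : (2 * l%:C - n.+1%:R - 2) * (l%:C - n.+1%:R + p%:R - 1) * (l%:C - p%:R)
    = ((2 * l - N - 2) * (l - N + q - 1) * (l - q))%:C :> C.
  by rewrite /N /q !(rmorph_nat, rmorph1, rmorphN, rmorphM, rmorphD).
have -> : 2 * l%:C - n.+1%:R - 2 = (2 * l - N - 2)%:C :> C.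
  by rewrite /N /q !(rmorph_nat, rmorph1, rmorphN, rmorphM, rmorphD).
have -> : (l%:C - n.+1%:R + p%:R - 1) * (l%:C - p%:R)
    = ((l - N + q - 1) * (l - q))%:C :> C.
  by rewrite /N /q !(rmorph_nat, rmorph1, rmorphN, rmorphM, rmorphD).
have -> : (l%:C - n.+1%:R + p%:R) * (l%:C - p%:R - 1)
    = ((l - N + q) * (l - q - 1))%:C :> C.
  by rewrite /N /q !(rmorph_nat, rmorph1, rmorphN, rmorphM, rmorphD).
have -> : l%:C - n.+1%:R + p%:R = (l - N + q)%:C :> C.
  by rewrite /N /q !(rmorph_nat, rmorph1, rmorphN, rmorphM, rmorphD).
have -> : l%:C - p%:R = (l - q)%:C :> C.
  by rewrite /N /q !(rmorph_nat, rmorph1, rmorphN, rmorphM, rmorphD).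
apply: representsD; last first.
  exact/representsN/representsZ/represents_coord.
apply: representsD; last first.
  exact/representsN/representsZ/represents_coord.
apply: representsD; last first.
  apply/representsN/representsZ/representsD; apply: representsZ => //.
  exact: represents_ext.
exact/representsN/representsZ/(represents_partial _ (dF m)).
Qed.

End SecondOrder.

Lemma slow_density1 s (a b : R) k : 4 < a -> 4 < b ->
  slow (fun x => density1 (coords x) m (kdensity s (a - 2) (b - 2) x) a b k).
Proof.
move=> a4 b4; under eq_fun do rewrite density1E//.
have s12 : slow (@kdensity R n (~~ s) (a - 1) b) by apply: slow_kdensity; lra.
have s21 : slow (@kdensity R n s a (b - 1)) by apply: slow_kdensity; lra.
apply: slowD; first exact: slowZ.
by apply: slowM s21; apply: slowZ; exact: slow_coord.
Qed.

Lemma slow_density2 s (a b : R) j k : 4 < a -> 4 < b ->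
  slow (fun x => density2 (coords x) m (kdensity s (a - 2) (b - 2) x) a b j k).
Proof.
move=> a4 b4; under eq_fun do rewrite density2E//.
have s02 : slow (@kdensity R n s (a - 1 - 1) b) by apply: slow_kdensity; lra.
have s11 : slow (@kdensity R n (~~ s) (a - 1) (b - 1)) by apply: slow_kdensity; lra.
have s20 : slow (@kdensity R n s a (b - 1 - 1)) by apply: slow_kdensity; lra.
have s21 : slow (@kdensity R n s a (b - 1)) by apply: slow_kdensity; lra.
apply: slowD.
  apply: slowZ; apply: slowD; first exact: slowZ.
  by apply: slowM s11; apply: slowZ; exact: slow_coord.
apply: slowD; first exact: slowZ.
apply: slowM; first by apply: slowZ; exact: slow_coord.
apply: slowD; first exact: slowZ.
by apply: slowM s20; apply: slowZ; exact: slow_coord.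
Qed.

(** The kernel applied to a constant form, the factor i_(e_n) eps_(e_n) being left
    to the form. *)
Definition kfield s (a b : R) w x : form :=
  kdensity s a b x *: reflected (coords x) w.

Lemma slow_kfield s (a b : R) w : 2 < a -> 2 < b -> slow_field (kfield s a b w).
Proof.
by move=> a2 b2; exact: slow_fieldM (slow_kdensity n s a2 b2) (slow_reflected w).
Qed.

(** With exponents above 4 the field has two derivatives given by [field1] and
    [field2], so the pointwise identity applies at every x. *)
Theorem Pop_kfield p s (l nu : R) w Om :
  4 < l + nu - n.+1%:R -> 4 < - nu - 1 -> is_pform p w -> int_basis m w = 0 ->
  represents (kfield s (l + nu - n.+1%:R) (- nu - 1) w) Om ->
  represents (fun x =>
    ((l + nu - n.+1%:R) * (nu - l + 1) * (l - n.+1%:R + p%:R - 1) * (l - p%:R)) *: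
     kfield (~~ s) (l - 1 + nu - n.+1%:R) (- nu - 1) w x) (Pop p l%:C Om).
Proof.
set a := l + nu - n.+1%:R; set b := - nu - 1 => a4 b4 wp iw rw.
pose B := @kdensity R n s (a - 2) (b - 2).
have numw : number_op w = p%:R *: w by rewrite scaler_nat; exact: number_operator.
have sA : slow (@kdensity R n s a b) by apply: slow_kdensity; lra.
pose F1 k x := field1 (coords x) m w (B x) a b k.
pose F2 j k x := field2 (coords x) m w (B x) a b j k.
have sF1 k : slow_field (F1 k).
  apply: slow_fieldD; first exact: slow_fieldM (slow_density1 s k a4 b4) (slow_reflected w).
  rewrite /B; under eq_fun do rewrite -kdensity22//.
  exact: slow_fieldM sA (slow_reflected1 k w).
have sF2 j k : slow_field (F2 j k).
  apply: slow_fieldD; last first.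
    rewrite /B; under eq_fun do rewrite -kdensity22//.
    exact: slow_fieldM sA (slow_field_cst _).
  apply: slow_fieldD; last first.
    exact: slow_fieldM (slow_density1 s j a4 b4) (slow_reflected1 k w).
  apply: slow_fieldD; last first.
    exact: slow_fieldM (slow_density1 s k a4 b4) (slow_reflected1 j w).
  exact: slow_fieldM (slow_density2 s j k a4 b4) (slow_reflected w).
have dF k : field_partial k (kfield s a b w) (F1 k).
  apply: eq_field_partial (field_partialM (has_partial_kdensity1 k s a4 b4)
    (field_partial_reflected k w)) => // x.
  by rewrite /F1 /field1 -kdensity22.
have dF1 j k : field_partial j (F1 k) (F2 j k).
  have d1 := field_partialM (has_partial_density1 s j k a4 b4) (field_partial_reflected j w).
  have d2 := field_partialM (has_partial_kdensity1 j s a4 b4) (field_partial_reflected1 j k w).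
  apply: eq_field_partial (field_partialD d1 d2) => x.
    by rewrite /F1 /field1 -kdensity22.
  by rewrite /F2 /field2 -kdensity22// !addrA.
apply: eq_represents (represents_Pop sF1 sF2 dF dF1 rw p l) => x.
rewrite (@pointwise_identity _ _ (coords x) m w p%:R iw numw (B x) a b l nu); last 2 first.
- by rewrite /a /b; ring.
- by rewrite /b; ring.
rewrite scalerA; congr (_ *: _).
rewrite (_ : l - 1 + nu - n.+1%:R = a - 1); last by rewrite /a; ring.
by rewrite kdensity12.
Qed.

End Representation.

(** * Differential operators as finite combinations of evaluations *)
Section Observables.
Variables (R : realType) (n : nat).
Local Notation C := (R[i]^o).
Local Notation dform := (extform n.+1 (dist R n.+1)).
Implicit Types (I J : {set 'I_n.+1}) (f g : 'rV[R]_n.+1 -> R) (Om : dform).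

(** Finite combinations of evaluations of the components of a distribution-valued
    form, with coefficients polynomial in l. Whatever holds for evaluations and is
    stable under these combinations holds for a differential operator with
    polynomial coefficients: linearity, regularity in the parameters, and the
    existence of local denominators are all obtained in this way. *)
Inductive observable : (C -> dform -> C) -> Prop :=
| observable_eval J g : schwartz g -> observable (fun _ Om => Om J g)
| observable_add F G : observable F -> observable G ->
    observable (fun l Om => F l Om + G l Om)
| observable_scale (c : C) F : observable F ->
    observable (fun l Om => c * F l Om)
| observable_param F : observable F -> observable (fun l Om => l * F l Om).

Lemma eq_observable F G : (forall l Om, F l Om = G l Om) ->
  observable F -> observable G.
Proof.
by move=> FG; rewrite (_ : F = G)//; apply/funext => l; apply/funext => Om.
Qed.

Lemma observable_linear F (l a : C) Om Om1 Om2 : observable F ->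
  (forall J g, schwartz g -> Om J g = a * Om1 J g + Om2 J g) ->
  F l Om = a * F l Om1 + F l Om2.
Proof.
move=> oF lin; elim: oF => {F} [J g sg|F G _ IF _ IG|c F _ IF|F _ IF]; first exact: lin.
- by rewrite IF IG; ring.
- by rewrite IF; ring.
- by rewrite IF; ring.
Qed.

Definition differential_op (Op : C -> dform -> dform) : Prop :=
  forall I f, schwartz f -> observable (fun l Om => Op l Om I f).

Lemma observable0 f : schwartz f -> observable (fun _ _ => 0).
Proof.
move=> sf; apply: eq_observable (observable_scale 0 (observable_eval finset.set0 sf)).
by move=> l Om; rewrite mul0r.
Qed.

(** The coefficients by which observables may be multiplied; they contain the
    polynomials in l. *)
Definition multiplier (c : C -> C) : Prop := forall F, observable F ->
  observable (fun l Om => c l * F l Om).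

Lemma multiplier_cst (c : C) : multiplier (fun=> c).
Proof. by move=> F; exact: observable_scale. Qed.

Lemma multiplier_id : multiplier id.
Proof. exact: observable_param. Qed.

Lemma multiplierD c d : multiplier c -> multiplier d -> multiplier (fun l => c l + d l).
Proof.
move=> mc md F oF; apply: eq_observable (observable_add (mc F oF) (md F oF)) => l Om.
by rewrite mulrDl.
Qed.

Lemma multiplierB (c : C -> C) (d : C) : multiplier c -> multiplier (fun l => c l - d).
Proof. by move=> mc; apply: multiplierD => //; exact: multiplier_cst. Qed.

Lemma multiplierM c d : multiplier c -> multiplier d -> multiplier (fun l => c l * d l).
Proof.
move=> mc md F oF; apply: eq_observable (mc _ (md F oF)) => l Om.
by rewrite mulrA.
Qed.

Lemma differential_op_id : differential_op (fun _ Om => Om).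
Proof. by move=> I f sf; exact: observable_eval. Qed.

Lemma differential_opD A B : differential_op A -> differential_op B ->
  differential_op (fun l Om => A l Om + B l Om).
Proof. by move=> dA dB I f sf; exact: observable_add (dA I f sf) (dB I f sf). Qed.

Lemma differential_opZ c A : multiplier c -> differential_op A ->
  differential_op (fun l Om => c l *: A l Om).
Proof. by move=> mc dA I f sf; exact: mc _ (dA I f sf). Qed.

Lemma differential_opN A : differential_op A -> differential_op (fun l Om => - A l Om).
Proof.
move=> dA I f sf; apply: eq_observable (observable_scale (-1) (dA I f sf)) => l Om.
by rewrite mulN1r.
Qed.

Lemma differential_op_ext k A : differential_op A ->
  differential_op (fun l Om => ext_basis k (A l Om)).
Proof.
move=> dA I f sf; have [kI|kI] := boolP (k \in I).
  apply: eq_observable (observable_scale ((-1) ^+ nbelow k I)%:~R (dA (I :\ k) f sf)) => l Om.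
  by rewrite /ext_basis kI fct_mulrz mulrzl.
by apply: eq_observable (observable0 sf) => l Om; rewrite /ext_basis (negbTE kI).
Qed.

Lemma differential_op_int k A : differential_op A ->
  differential_op (fun l Om => int_basis k (A l Om)).
Proof.
move=> dA I f sf; have [kI|kI] := boolP (k \in I).
  by apply: eq_observable (observable0 sf) => l Om; rewrite /int_basis kI.
apply: eq_observable (observable_scale ((-1) ^+ nbelow k I)%:~R (dA (k |: I) f sf)) => l Om.
by rewrite /int_basis (negbTE kI) fct_mulrz mulrzl.
Qed.

Lemma differential_op_partial k A : differential_op A ->
  differential_op (fun l Om => form_partial k (A l Om)).
Proof.
move=> dA I f sf.
apply: eq_observable (observable_scale (-1) (dA I _ (schwartz_partial k sf))) => l Om.
by rewrite mulN1r.
Qed.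

Lemma differential_op_coord k A : differential_op A ->
  differential_op (fun l Om => form_coord k (A l Om)).
Proof. by move=> dA I f sf; exact: dA I _ (schwartz_coordM k sf). Qed.

Lemma differential_op_sum (A : 'I_n.+1 -> C -> dform -> dform) :
  (forall k, differential_op (A k)) ->
  differential_op (fun l Om => \sum_k A k l Om).
Proof.
move=> dA; elim: (index_enum _) => [|k L IH] I f sf.
  by apply: eq_observable (observable0 sf) => l Om; rewrite big_nil.
have oD := differential_opD (dA k) IH I sf.
by apply: eq_observable oD => l Om; rewrite big_cons.
Qed.

Lemma differential_op_ext_deriv A : differential_op A ->
  differential_op (fun l Om => ext_deriv (A l Om)).
Proof.
by move=> dA; apply: differential_op_sum => k;
  apply/differential_op_ext/differential_op_partial.
Qed.

Lemma differential_op_coderiv A : differential_op A ->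
  differential_op (fun l Om => coderiv (A l Om)).
Proof.
by move=> dA; apply/differential_opN/differential_op_sum => k;
  apply/differential_op_int/differential_op_partial.
Qed.

Lemma differential_op_Pop p : differential_op (fun l Om => Pop p l Om).
Proof.
have mB c := multiplierB c multiplier_id.
have mBD c d := multiplierD (mB c) (multiplier_cst d).
have m2 := multiplierB 2 (multiplierB n.+1%:R (multiplierM (multiplier_cst 2) multiplier_id)).
have m1 := multiplierM (multiplierM m2 (multiplierB 1 (mBD n.+1%:R p%:R))) (mB p%:R).
have m5 := multiplierM (multiplierB 1 (mBD n.+1%:R p%:R)) (mB p%:R).
have m6 := multiplierM (mBD n.+1%:R p%:R) (multiplierB 1 (mB p%:R)).
have id := differential_op_id; have d := differential_op_ext_deriv id.
have delta := differential_op_coderiv id.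
have t1 := differential_opZ m1 (differential_op_partial ord_max id).
have t3 := differential_opZ (mBD n.+1%:R p%:R) (differential_op_ext ord_max delta).
have t4 := differential_opZ (mB p%:R)
  (differential_op_ext_deriv (differential_op_int ord_max id)).
have t2 := differential_opZ m2 (differential_opD t3 t4).
have t5 := differential_opZ m5
  (differential_op_coord ord_max (differential_op_coderiv d)).
have t6 := differential_opZ m6
  (differential_op_coord ord_max (differential_op_ext_deriv delta)).
exact: differential_opD (differential_opD (differential_opD
  (differential_opN t1) (differential_opN t2)) (differential_opN t5))
  (differential_opN t6).
Qed.

End Observables.

(** * Kernels at real parameters *)

Section RealKernels.
Variables (R : realType) (n : nat).
Local Notation C := (R[i]^o).
Local Notation m := (@ord_max n).
Local Notation coords x := (fun k => x 0 k).
Implicit Types (x : 'rV[R]_n.+1) (w : extform n.+1 (R^o)).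

Definition complexify w : extform n.+1 C := fun I => (w I)%:C.

Lemma cpow_real (t a : R) : cpow t a%:C = (t `^ a)%:C.
Proof. by rewrite /cpow /= mul0r cos0 sin0 mulr1. Qed.

Lemma ext_basis_complexify k w :
  ext_basis k (complexify w) = complexify (ext_basis k w).
Proof. exact: (@ext_basis_map n.+1 R^o C (real_complex R)). Qed.

Lemma int_basis_complexify k w :
  int_basis k (complexify w) = complexify (int_basis k w).
Proof. exact: (@int_basis_map n.+1 R^o C (real_complex R)). Qed.

Lemma ext_vec_complexify x w :
  ext_vec x (complexify w) = complexify (exterior_by (coords x) w).
Proof.
rewrite /ext_vec /exterior_by /complexify; apply/funext => I.
rewrite !fct_sumE rmorph_sum; apply: eq_bigr => k _.
by rewrite !fctE ext_basis_complexify /complexify -[LHS]rmorphM.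
Qed.

Lemma int_vec_complexify x w :
  int_vec x (complexify w) = complexify (interior_by (coords x) w).
Proof.
rewrite /int_vec /interior_by /complexify; apply/funext => I.
rewrite !fct_sumE rmorph_sum; apply: eq_bigr => k _.
by rewrite !fctE int_basis_complexify /complexify -[LHS]rmorphM.
Qed.

Lemma kern_real s (l nu : R) x : kern s (l%:C - 1) (nu%:C + 1) x =
  (kdensity s (l + nu - n.+1%:R) (- nu - 1) x)%:C.
Proof.
rewrite /kern /kdensity /spow /=.
have -> : l%:C - 1 + (nu%:C + 1) - n.+1%:R = (l + nu - n.+1%:R)%:C :> C.
  by rewrite !(rmorph_nat, rmorphN, rmorphD) /=; ring.
have -> : - (nu%:C + 1) = (- nu - 1)%:C :> C.
  by rewrite !(rmorph_nat, rmorphN, rmorphD, rmorph1) /=; ring.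
rewrite !cpow_real mul1r [X in _ = (_ * (X `^ _))%:C]ger0_norm; last exact: sqnorm_ge0.
by case: s; rewrite ?mul1r !rmorphM.
Qed.

Lemma kernp_real s (l nu : R) x w :
  kernp s l%:C nu%:C x (complexify w) =
  complexify (kfield s (l + nu - n.+1%:R) (- nu - 1) (int_basis m (ext_basis m w)) x).
Proof.
rewrite /kernp kern_real ext_basis_complexify int_basis_complexify.
set w' := int_basis _ _.
rewrite !(ext_vec_complexify, int_vec_complexify) interior_exterior_by.
apply/funext => I; rewrite !fctE /complexify /kfield /reflected !fctE.
rewrite -rmorphB -[LHS]/(_ * _) -rmorphM; congr (_%:C).
by rewrite /GRing.scale/=; ring.
Qed.

Lemma cintegral_real (u f : 'rV[R]_n.+1 -> R) :
  cintegral_rV (fun x => (u x)%:C * (f x)%:C) = (pairing u f)%:C.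
Proof.
rewrite /cintegral_rV /pairing.
rewrite (_ : (fun x => complex.Im _) = fun x => (fun=> 0) x * f x); last first.
  by apply/funext => x /=; rewrite mul0r mulr0 addr0.
rewrite -/(pairing _ _) pairing0; congr (_ +i* _).
by congr integral_rV; apply/funext => x /=; rewrite mul0r subr0.
Qed.

(** Inside the region of integrability the family is the integral, and at real
    parameters the complex powers are real powers. *)
Lemma represents_continuation p s W T (l nu : R) w :
  @kernel_continuation R n p s W T ->
  2 < l + nu - n.+1%:R -> 2 < - nu - 1 -> is_pform p w ->
  represents
    (kfield s (l + nu - n.+1%:R) (- nu - 1) (int_basis m (ext_basis m w)))
    (T (l%:C, nu%:C) (complexify w)).
Proof.
move=> [_ _ Tint] a2 b2 wp; split=> [|I f sf]; first exact: slow_kfield.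
rewrite Tint//=.
- by under eq_fun do rewrite kernp_real; exact: cintegral_real.
- split=> /=; last by have := ler0n R n.+1; lra.
  by lra.
- by move=> J /wp; rewrite /complexify => ->.
Qed.

End RealKernels.

(** * Moduli, limits and power series in one complex variable *)
Section Modulus.
Variable R : realType.
Local Notation C := (R[i]^o).
Implicit Types (z w : C) (u v : nat -> C).

(** The modulus as a real number, so that estimates take place in an ordered field
    rather than among the real elements of the complex numbers. *)
Definition modulus z : R := complex.Re `|z|.

Lemma modulusE z : `|z| = (modulus z)%:C.
Proof. by case: z => a b; rewrite /modulus normc_def. Qed.

Lemma modulus_ge0 z : 0 <= modulus z.
Proof. by rewrite -lecR -modulusE; exact: normr_ge0. Qed.

Lemma modulus0 : modulus 0 = 0.
Proof. by rewrite /modulus normr0. Qed.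

Lemma modulus1 : modulus 1 = 1.
Proof. by rewrite /modulus normr1. Qed.

Lemma modulus_eq0 z : modulus z = 0 -> z = 0.
Proof. by move=> z0; apply/eqP; rewrite -normr_eq0 modulusE z0. Qed.

Lemma modulusM z w : modulus (z * w) = modulus z * modulus w.
Proof. by apply: complexI; rewrite -modulusE normrM !modulusE rmorphM. Qed.

Lemma modulusX z k : modulus (z ^+ k) = modulus z ^+ k.
Proof. by apply: complexI; rewrite -modulusE normrX !modulusE rmorphXn. Qed.

Lemma modulusN z : modulus (- z) = modulus z.
Proof. by rewrite /modulus normrN. Qed.

Lemma modulusB z w : modulus (z - w) = modulus (w - z).
Proof. by rewrite -modulusN opprB. Qed.

Lemma modulusD z w : modulus (z + w) <= modulus z + modulus w.
Proof. by rewrite -lecR rmorphD /= -!modulusE ler_normD. Qed.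

Lemma modulus_real (t : R) : modulus t%:C = `|t|.
Proof. by rewrite /modulus normc_def /= expr0n /= addr0 sqrtr_sqr. Qed.

Lemma modulus_sum (I : Type) (s : seq I) (P : pred I) (F : I -> C) :
  modulus (\sum_(i <- s | P i) F i) <= \sum_(i <- s | P i) modulus (F i).
Proof.
elim/big_rec2: _ => [|i x y _ h]; first by rewrite modulus0.
by apply: le_trans (modulusD _ _) _; rewrite lerD2l.
Qed.

Definition tends u z : Prop := forall e : R, 0 < e ->
  exists N0, forall N, (N0 <= N)%N -> modulus (u N - z) < e.

Lemma cvg_tends u z : u N @[N --> \oo] --> z -> tends u z.
Proof.
move=> /cvgrPdist_lt uz e e0; have /uz [N0 _ N0P] : 0 < e%:C :> C by rewrite ltcR.
by exists N0 => N /N0P; rewrite modulusE ltcR modulusB.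
Qed.

Lemma tendsD u v z w : tends u z -> tends v w -> tends (fun N => u N + v N) (z + w).
Proof.
move=> uz vw e e0; have e2 : 0 < e / 2 by rewrite divr_gt0.
have [N1 h1] := uz _ e2; have [N2 h2] := vw _ e2.
exists (maxn N1 N2) => N; rewrite geq_max => /andP[/h1 l1 /h2 l2].
rewrite opprD addrACA; apply: le_lt_trans (modulusD _ _) _.
by rewrite [ltRHS]splitr ltrD.
Qed.

Lemma tends_bounded_mul0 u v (B : R) : (forall N, modulus (u N) <= B) ->
  tends v 0 -> tends (fun N => u N * v N) 0.
Proof.
move=> uB v0 e e0.
have B0 : 0 <= B by apply: le_trans (uB 0%N); exact: modulus_ge0.
have eB : 0 < e / (B + 1) by rewrite divr_gt0// ltr_pwDr.
have [N0 h] := v0 _ eB; exists N0 => N /h; rewrite !subr0 modulusM => vN.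
apply: (@le_lt_trans _ _ (B * modulus (v N))).
  by rewrite ler_wpM2r// modulus_ge0.
apply: (@le_lt_trans _ _ ((B + 1) * modulus (v N))).
  by rewrite ler_wpM2r ?modulus_ge0// lerDl.
by move: vN; rewrite ltr_pdivlMr ?ltr_pwDr// mulrC.
Qed.

Lemma tends_cst z : tends (fun=> z) z.
Proof. by move=> e e0; exists 0%N => N _; rewrite subrr modulus0. Qed.

Lemma tends_shift u z : tends (fun N => u N - z) 0 -> tends u z.
Proof. by move=> h e /h[N0 hN]; exists N0 => N /hN; rewrite subr0. Qed.

Lemma tends_diff0 u z : tends u z -> tends (fun N => u N - z) 0.
Proof. by move=> h e /h[N0 hN]; exists N0 => N /hN; rewrite subr0. Qed.

Lemma tends_bounded u z : tends u z -> exists B, forall N, modulus (u N) <= B.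
Proof.
move=> /(_ 1 ltr01)[N0 h].
exists (modulus z + 1 + \sum_(k < N0) modulus (u k)) => N.
have [NN0|/h uN] := ltnP N N0.
  rewrite (bigD1 (Ordinal NN0))//= addrCA lerDl addr_ge0 ?addr_ge0 ?modulus_ge0//.
  by apply: sumr_ge0 => *; exact: modulus_ge0.
rewrite -[u N](subrK z) (le_trans (modulusD _ _))// addrC -addrA lerD2l.
rewrite (le_trans (ltW uN))// lerDl; apply: sumr_ge0 => *; exact: modulus_ge0.
Qed.

Lemma tendsM u v z w : tends u z -> tends v w -> tends (fun N => u N * v N) (z * w).
Proof.
move=> uz vw; apply: tends_shift.
have [B uB] := tends_bounded uz.
have h1 := tends_bounded_mul0 uB (tends_diff0 vw).
have h2 := tends_bounded_mul0 (fun N => lexx (modulus w)) (tends_diff0 uz).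
have := tendsD h1 h2; rewrite addr0.
by congr tends; apply/funext => N; ring.
Qed.

(** Sequences at geometrically small distance have the same limits; applied to the
    product of two partial sums and the partial sum of the Cauchy product. *)
Lemma tends_close u v z (B q : R) : 0 <= q -> q < 1 ->
  (forall N, modulus (u N - v N) <= B * q ^+ N) -> tends u z -> tends v z.
Proof.
move=> q0 q1 uv uz; apply: tends_shift => e e0.
have e2 : 0 < e / 2 by rewrite divr_gt0.
have [N1 h1] := uz _ e2.
have q1' : `|q| < 1 by rewrite ger0_norm.
have /cvgrPdist_lt /(_ _ e2)[N2 _ h2] := cvg_geometric B q1'.
exists (maxn N1 N2) => N; rewrite geq_max subr0 => /andP[/h1 l1 /h2 /= l2].
rewrite -(subrK (u N) (v N)) -addrA (le_lt_trans (modulusD _ _))//.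
rewrite [ltRHS]splitr ltr_leD//; last exact: ltW.
rewrite modulusB (le_lt_trans (uv N))// (le_lt_trans (ler_norm _))//.
by move: l2; rewrite sub0r normrN.
Qed.

End Modulus.

Section PowerSeries.
Variable R : realType.
Local Notation C := (R[i]^o).
Implicit Types (phi psi : C -> C) (c d : nat -> C) (z : C).

Definition partial_sum c z : nat -> C := fun N => \sum_(j < N) c j * z ^+ j.

Definition abs_bound c (r M : R) : Prop :=
  forall N, \sum_(j < N) modulus (c j) * r ^+ j <= M.

(** Germs at 0 of sums of power series that converge absolutely on some closed
    disc. The value of [phi] off the disc is arbitrary. *)
Definition power_series phi : Prop := exists c r M,
  [/\ 0 < r, abs_bound c r M &
      forall z, modulus z < r -> tends (partial_sum c z) (phi z)].

Lemma abs_bound_ge0 c r M : abs_bound c r M -> 0 <= M.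
Proof. by move=> /(_ 0%N); rewrite big_ord0. Qed.

Lemma abs_bound_le c r r' M : 0 <= r' -> r' <= r -> abs_bound c r M -> abs_bound c r' M.
Proof.
move=> r'0 r'r cM N; apply: le_trans (cM N); apply: ler_sum => j _.
by rewrite ler_wpM2l ?modulus_ge0// lerXn2r// nnegrE (le_trans r'0).
Qed.

Lemma power_series_cst z : power_series (fun=> z).
Proof.
exists (fun j => if j == 0%N then z else 0), 1, (modulus z); split=> // [N|w _].
  case: N => [|N]; first by rewrite big_ord0 modulus_ge0.
  rewrite big_ord_recl /= expr0 mulr1 big1 ?addr0// => j _.
  by rewrite modulus0 mul0r.
move=> e e0; exists 1%N => -[//|N] _; rewrite /partial_sum big_ord_recl /= expr0 mulr1.
by rewrite big1 ?addr0 ?subrr ?modulus0// => j _; rewrite mul0r.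
Qed.

Lemma power_series_affine z : power_series (fun w => z + w).
Proof.
exists (fun j => if j == 0%N then z else if j == 1%N then 1 else 0), 1, (modulus z + 1).
split=> // [N|w _].
  case: N => [|[|N]].
  - by rewrite big_ord0 addr_ge0 ?modulus_ge0.
  - by rewrite big_ord1 /= mulr1 lerDl.
  - rewrite !big_ord_recl /= !mulr1 modulus1 big1 ?addr0 ?expr1n ?mulr1//= => j _.
    by rewrite modulus0 mul0r.
move=> e e0; exists 2%N => -[//|[//|N]] _; rewrite /partial_sum !big_ord_recl /=.
rewrite big1 => [|j _]; last by rewrite mul0r.
by rewrite expr0 mulr1 mul1r addr0 expr1 subrr modulus0.
Qed.

Lemma power_seriesD phi psi : power_series phi -> power_series psi ->
  power_series (fun w => phi w + psi w).
Proof.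
move=> [c [r [M [r0 cM cphi]]]] [d [r' [M' [r'0 dM dpsi]]]].
exists (fun j => c j + d j), (Num.min r r'), (M + M').
have m0 : 0 < Num.min r r' by rewrite lt_min r0.
have m1 : Num.min r r' <= r by rewrite ge_min lexx.
have m2 : Num.min r r' <= r' by rewrite ge_min lexx orbT.
split=> // [N|z].
  have cN := abs_bound_le (ltW m0) m1 cM N.
  have dN := abs_bound_le (ltW m0) m2 dM N.
  apply: le_trans (lerD cN dN); rewrite -big_split /=; apply: ler_sum => j _.
  by rewrite -mulrDl ler_wpM2r ?modulusD// exprn_ge0// ltW.
rewrite lt_min => /andP[/cphi h1 /dpsi h2].
have := tendsD h1 h2; congr tends; apply/funext => N.
by rewrite /partial_sum -big_split /=; apply: eq_bigr => j _; rewrite mulrDl.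
Qed.

Definition cauchy_product c d m : C := \sum_(j < m.+1) c j * d (m - j)%N.

Lemma size_mul_poly (K : nzRingType) N (a b : nat -> K) :
  (size ((\poly_(j < N) a j) * (\poly_(j < N) b j))%R <= N + N)%N.
Proof.
apply: leq_trans (size_polyMleq _ _) _; apply: leq_trans (leq_pred _) _.
by apply: leq_add; exact: size_poly.
Qed.

Lemma cauchy_product_coef N c d m : (m < N)%N ->
  ((\poly_(j < N) c j) * (\poly_(j < N) d j))`_m = cauchy_product c d m.
Proof.
move=> mN; rewrite coefM; apply: eq_bigr => j _; rewrite !coef_poly.
by rewrite (leq_ltn_trans _ mN) ?leq_ord// (leq_ltn_trans (leq_subr _ _) mN).
Qed.

Lemma modulus_coefM N c d m :
  modulus ((\poly_(j < N) c j) * (\poly_(j < N) d j))`_m <=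
  ((\poly_(j < N) modulus (c j)) * (\poly_(j < N) modulus (d j)))`_m.
Proof.
rewrite !coefM; apply: le_trans (modulus_sum _ _ _) _; apply: ler_sum => j _.
by rewrite modulusM !coef_poly; do 2 case: ifP => _; rewrite ?modulus0.
Qed.

(** The polynomials of degree below N with coefficients the moduli: their product
    dominates that of the truncated series coefficientwise, and its value at r is
    the product of their values. *)
Lemma horner_abs_poly N c d r M M' : 0 < r -> abs_bound c r M -> abs_bound d r M' ->
  \sum_(m < N + N)
    ((\poly_(j < N) modulus (c j)) * (\poly_(j < N) modulus (d j)))`_m * r ^+ m
  <= M * M'.
Proof.
move=> r0 cM dM.
rewrite -(horner_coef_wide r (size_mul_poly _ _ _)) hornerM !horner_poly.
by apply: ler_pM => //; apply: sumr_ge0 => j _;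
  rewrite mulr_ge0 ?modulus_ge0 ?exprn_ge0 ?(ltW r0).
Qed.

(** The product of the partial sums of order N and the partial sum of order N of
    the Cauchy product differ only in degrees N and above, where the coefficients
    are dominated; the difference is at most M M' (|z| / r)^N. *)
Lemma power_seriesM phi psi : power_series phi -> power_series psi ->
  power_series (fun w => phi w * psi w).
Proof.
move=> [c [r1 [M [r10 cM1 cphi]]]] [d [r2 [M' [r20 dM2 dpsi]]]].
pose r := Num.min r1 r2.
have r0 : 0 < r by rewrite lt_min r10.
have rr1 : r <= r1 by rewrite ge_min lexx.
have rr2 : r <= r2 by rewrite ge_min lexx orbT.
have cM := abs_bound_le (ltW r0) rr1 cM1.
have dM := abs_bound_le (ltW r0) rr2 dM2.
have sumM N := @horner_abs_poly N c d r M M' r0 cM dM.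
have coef_ge0 N m :
    0 <= ((\poly_(j < N) modulus (c j)) * (\poly_(j < N) modulus (d j)))`_m.
  by apply: le_trans (modulus_coefM _ _ _ _); exact: modulus_ge0.
exists (cauchy_product c d), r, (M * M'); split=> // [N|z zr].
  apply: le_trans (sumM N); rewrite big_split_ord /= -[leLHS]addr0 lerD//; last first.
    by apply: sumr_ge0 => m _; rewrite mulr_ge0// exprn_ge0// ltW.
  apply: ler_sum => m _; rewrite ler_wpM2r ?exprn_ge0 ?(ltW r0)//.
  by rewrite -(cauchy_product_coef c d (ltn_ord m)) modulus_coefM.
have h1 := cphi z (lt_le_trans zr rr1); have h2 := dpsi z (lt_le_trans zr rr2).
pose x := modulus z / r.
have x0 : 0 <= x by rewrite divr_ge0 ?modulus_ge0 ?ltW.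
have x1 : x < 1 by rewrite ltr_pdivrMr// mul1r.
apply: (@tends_close _ (fun N => partial_sum c z N * partial_sum d z N) _ _ (M * M') x) => //;
  last exact: tendsM.
move=> N; have -> : partial_sum c z N * partial_sum d z N =
    \sum_(m < N + N) ((\poly_(j < N) c j) * (\poly_(j < N) d j))`_m * z ^+ m.
  by rewrite -(horner_coef_wide z (size_mul_poly _ _ _)) hornerM !horner_poly.
rewrite big_split_ord /= [X in modulus (X + _ - _)](_ : _ = partial_sum (cauchy_product c d) z N).
  rewrite addrAC subrr add0r; apply: le_trans (modulus_sum _ _ _) _.
  rewrite [leRHS]mulrC; apply: le_trans (ler_wpM2l (exprn_ge0 N x0) (sumM N)).
  rewrite big_split_ord /= mulrDr mulr_sumr mulr_sumr -[leLHS]add0r lerD//.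
    by apply: sumr_ge0 => m _; rewrite !mulr_ge0// exprn_ge0// ltW.
  apply: ler_sum => m _; rewrite modulusM modulusX.
  have -> : modulus z = r * x by rewrite mulrCA divff ?mulr1// gt_eqF.
  rewrite exprMn mulrA [leRHS]mulrC; apply: ler_pM.
  - by rewrite mulr_ge0 ?modulus_ge0 ?exprn_ge0 ?(ltW r0).
  - exact: exprn_ge0.
  - by rewrite ler_wpM2r ?exprn_ge0 ?(ltW r0)// modulus_coefM.
  - by rewrite exprD ler_piMr ?exprn_ge0// exprn_ile1 ?(ltW x1).
by apply: eq_bigr => m _; rewrite cauchy_product_coef.
Qed.

(** The first nonzero coefficient would dominate the remaining terms at zeros close
    enough to 0. *)
Lemma power_series_zeros phi : power_series phi ->
  (forall e : R, 0 < e -> exists z, [/\ z != 0, modulus z < e & phi z = 0]) ->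
  exists2 r : R, 0 < r & forall z, modulus z < r -> phi z = 0.
Proof.
move=> [c [r [M [r0 cM cphi]]]] zeros.
have c0 m : c m = 0.
  elim/ltn_ind: m => m IH; apply: modulus_eq0.
  have M0 := abs_bound_ge0 cM.
  have bound z : z != 0 -> modulus z < r -> phi z = 0 ->
      modulus (c m) <= M / r ^+ m.+1 * modulus z.
    move=> z0 zr phiz.
    have mz : 0 < modulus z.
      by rewrite lt_def modulus_ge0 andbT; apply: contra_neq z0 => /modulus_eq0.
    pose x := modulus z / r.
    have x0 : 0 <= x by rewrite divr_ge0 ?modulus_ge0 ?ltW.
    have x1 : x <= 1 by rewrite ler_pdivrMr// mul1r ltW.
    have tail N : modulus (\sum_(j < N) c (m.+1 + j)%N * z ^+ (m.+1 + j)) <= M * x ^+ m.+1.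
      apply: le_trans (modulus_sum _ _ _) _.
      apply: (@le_trans _ _ (\sum_(j < N) modulus (c (m.+1 + j)%N) * r ^+ (m.+1 + j) * x ^+ m.+1)).
        apply: ler_sum => j _; rewrite modulusM modulusX.
        have -> : modulus z = r * x by rewrite mulrCA divff ?mulr1// gt_eqF.
        rewrite exprMn mulrA ler_wpM2l ?mulr_ge0 ?modulus_ge0 ?exprn_ge0 ?(ltW r0)//.
        by rewrite exprD ler_piMr ?exprn_ge0// exprn_ile1.
      rewrite -mulr_suml ler_wpM2r ?exprn_ge0//.
      apply: le_trans (cM (m.+1 + N)%N); rewrite big_split_ord /= lerDr.
      by apply: sumr_ge0 => j _; rewrite mulr_ge0 ?modulus_ge0 ?exprn_ge0 ?(ltW r0).
    have main : modulus (c m) * modulus z ^+ m <= M * x ^+ m.+1.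
      apply/ler_addgt0Pl => e e0.
      have [N0 h] := cphi z zr e e0.
      have {h} := h (m.+1 + N0)%N (leq_addl _ _).
      rewrite phiz subr0 /partial_sum big_split_ord /= big_ord_recr /= big1 ?add0r.
        move=> he; rewrite -modulusX -modulusM.
        set S := \sum_(i < N0) _ in he.
        rewrite -[X in modulus X](addrK S) (le_trans (modulusD _ _))// modulusN.
        by rewrite lerD ?(ltW he)// /S; exact: tail.
      by move=> j _; rewrite IH// mul0r.
    have -> : M / r ^+ m.+1 * modulus z = M * x ^+ m.+1 / modulus z ^+ m.
      rewrite /x expr_div_n [modulus z ^+ m.+1]exprSr; field.
      by rewrite !expf_neq0 ?gt_eqF.
    by rewrite ler_pdivlMr// exprn_gt0.
  apply/eqP; rewrite eq_le modulus_ge0 andbT; apply/ler_addgt0Pl => e e0.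
  rewrite addr0.
  pose K := M / r ^+ m.+1 + 1.
  have K0 : 0 < K by rewrite ltr_pwDr// divr_ge0// exprn_ge0// ltW.
  have : 0 < Num.min r (e / K) by rewrite lt_min r0 divr_gt0.
  move=> /zeros[z [z0 + phiz]]; rewrite lt_min => /andP[zr ze].
  apply: le_trans (bound z z0 zr phiz) _.
  apply: (@le_trans _ _ (K * modulus z)).
    by rewrite ler_wpM2r ?modulus_ge0// lerDl.
  by move: ze; rewrite ltr_pdivlMr// mulrC => /ltW.
exists r => // z /cphi h; apply: modulus_eq0; apply/eqP.
rewrite eq_le modulus_ge0 andbT; apply/ler_addgt0Pl => e e0.
have [N hN] := h _ e0; have := hN N (leqnn _).
rewrite /partial_sum big1 ?sub0r ?modulusN ?addr0; first exact: ltW.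
by move=> j _; rewrite c0 mul0r.
Qed.

End PowerSeries.

(** * Regular functions of two complex variables *)
Section RealInduction.
Variable R : realType.

(** Induction along the unit interval: the supremum of the initial segments on
    which P holds cannot be less than 1. *)
Lemma real_induction (P : R -> Prop) :
  (forall t, 0 <= t <= 1 -> (forall s, 0 <= s < t -> P s) ->
     exists2 e : R, 0 < e & forall s, t - e < s < t + e -> 0 <= s -> P s) ->
  P 1.
Proof.
move=> step.
pose S := [set t : R | 0 <= t <= 1 /\ forall s, 0 <= s <= t -> P s].
have S0 : S 0.
  have [|s|e e0 he] := step 0; first by rewrite lexx ler01.
    by move=> /andP[s0 /(le_lt_trans s0)]; rewrite ltxx.
  split=> [|s]; first by rewrite lexx ler01.
  by rewrite -eq_le => /eqP <-; apply: he; rewrite ?sub0r ?add0r ?e0 ?oppr_lt0 ?e0.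
have supS : has_sup S by split; [exists 0|exists 1 => t [/andP[]]].
pose t0 := sup S.
have Sub : has_ubound S by case: supS.
have t00 : 0 <= t0 by exact: (ub_le_sup Sub S0).
have t01 : t0 <= 1 by apply: ge_sup; [exists 0|move=> t [/andP[]]].
have below s : 0 <= s < t0 -> P s.
  move=> /andP[s0 st]; have ts0 : 0 < t0 - s by rewrite subr_gt0.
  have [t [_ ht] stt] := sup_adherent ts0 supS.
  by apply: ht; rewrite s0 ltW//; move: stt; rewrite -/t0 subKr.
have [|e e0 he] := step t0 _ below; first by rewrite t00.
have Smin : S (Num.min 1 (t0 + e / 2)).
  split=> [|s /andP[s0]].
    by rewrite ge_min lexx le_min ler01 /= addr_ge0// divr_ge0// ltW.
  rewrite le_min => /andP[s1 s2].
  have [st|ts] := ltP s t0; first by apply: below; rewrite s0.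
  apply: he => //; apply/andP; split; first by rewrite ltrBlDr (le_lt_trans ts)// ltrDl.
  by apply: le_lt_trans s2 _; rewrite ltrD2l gtr_pMr// invf_lt1// ltr1n.
have := ub_le_sup Sub Smin; rewrite -/t0 ge_min => /orP[t1|].
  case: Smin => _; apply; rewrite ler01 le_min lexx (le_trans t1)// lerDl.
  by rewrite divr_ge0// ltW.
by rewrite gerDl leNgt divr_gt0.
Qed.

End RealInduction.

Section RegularFunctions.
Variable R : realType.
Local Notation C := (R[i]^o).
Implicit Types (f g : C * C -> C) (a b z : C * C) (phi : C -> C).

Definition polydisc a (e : R) : set (C * C) :=
  [set z | modulus (z.1 - a.1) < e /\ modulus (z.2 - a.2) < e].

Definition cont_at f a : Prop := forall e : R, 0 < e ->
  exists2 d : R, 0 < d & forall z, polydisc a d z -> modulus (f z - f a) < e.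

(** Continuity, and a power series expansion along each of the two coordinate lines
    through the point. This is weaker than analyticity, is stable under sums and
    products with proofs in one variable, and suffices for the identity theorems. *)
Definition regular f a : Prop :=
  [/\ cont_at f a, power_series (fun w => f (a.1 + w, a.2)) &
      power_series (fun w => f (a.1, a.2 + w))].

Lemma polydisc_center a (e : R) : 0 < e -> polydisc a e a.
Proof. by move=> e0; rewrite /polydisc /= !subrr modulus0. Qed.

Lemma polydisc_le a (e e' : R) : e <= e' -> polydisc a e `<=` polydisc a e'.
Proof. by move=> ee z [h1 h2]; split; apply: lt_le_trans ee. Qed.

Lemma polydisc_min a z (d d' : R) : polydisc a (Num.min d d') z ->
  polydisc a d z /\ polydisc a d' z.
Proof. by move=> [] /=; rewrite !lt_min => /andP[? ?] /andP[? ?]. Qed.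

Lemma polydisc_trans a b (e : R) : polydisc a e b ->
  exists2 d : R, 0 < d & polydisc b d `<=` polydisc a e.
Proof.
move=> [h1 h2].
exists (Num.min (e - modulus (b.1 - a.1)) (e - modulus (b.2 - a.2))).
  by rewrite lt_min !subr_gt0 h1.
have tri (u v w : C) (q : R) : modulus (u - v) < q - modulus (v - w) -> modulus (u - w) < q.
  rewrite ltrBrDr; apply: le_lt_trans.
  by apply: le_trans (modulusD _ _); rewrite addrA subrK.
by move=> w [] /=; rewrite !lt_min => /andP[/tri w1 _] /andP[_ /tri w2].
Qed.

Lemma cont_atD f g a : cont_at f a -> cont_at g a -> cont_at (fun z => f z + g z) a.
Proof.
move=> cf cg e e0; have e2 : 0 < e / 2 by rewrite divr_gt0.
have [d d0 fd] := cf _ e2; have [d' d'0 gd] := cg _ e2.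
exists (Num.min d d') => [|z zd]; first by rewrite lt_min d0.
have [zd1 zd2] := polydisc_min zd; have {}zd1 := fd z zd1; have {}zd2 := gd z zd2.
rewrite opprD addrACA (le_lt_trans (modulusD _ _))// [ltRHS]splitr; exact: ltrD.
Qed.

Lemma cont_atM f g a : cont_at f a -> cont_at g a -> cont_at (fun z => f z * g z) a.
Proof.
move=> cf cg e e0.
pose K := modulus (f a) + modulus (g a) + 1.
have K0 : 0 < K by rewrite ltr_pwDr// addr_ge0// modulus_ge0.
pose e1 := Num.min 1 (e / (2 * K)).
have e10 : 0 < e1 by rewrite lt_min ltr01 divr_gt0// mulr_gt0.
have [d d0 fd] := cf _ e10; have [d' d'0 gd] := cg _ e10.
exists (Num.min d d') => [|z zd]; first by rewrite lt_min d0.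
have [zd1 zd2] := polydisc_min zd; have {}zd1 := fd z zd1; have {}zd2 := gd z zd2.
have -> : f z * g z - f a * g a = (f z - f a) * (g z - g a) + (f z - f a) * g a + f a * (g z - g a).
  by ring.
apply: le_lt_trans (modulusD _ _) _.
apply: (@le_lt_trans _ _ (modulus (f z - f a) * modulus (g z - g a)
  + modulus (f z - f a) * modulus (g a) + modulus (f a) * modulus (g z - g a))).
  by rewrite -!modulusM lerD2r modulusD.
have e1e : e1 * (2 * K) <= e by rewrite -ler_pdivlMr ?mulr_gt0// ge_min lexx orbT.
have e11 : e1 <= 1 by rewrite ge_min lexx.
move: (modulus_ge0 (f z - f a)) (modulus_ge0 (g z - g a)) (modulus_ge0 (f a)) (modulus_ge0 (g a)).
move: zd1 zd2 e1e; rewrite /K.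
move: (modulus (f z - f a)) (modulus (g z - g a)) (modulus (f a)) (modulus (g a)) => u v p q.
move=> ue ve e1e u0 v0 p0 q0.
have : u * v <= e1 * 1 by apply: ler_pM => //; lra.
have : u * q <= e1 * q by apply: ler_wpM2r => //; lra.
have : p * v <= p * e1 by apply: ler_wpM2l => //; lra.
nra.
Qed.

Lemma regularD f g a : regular f a -> regular g a -> regular (fun z => f z + g z) a.
Proof.
move=> [f0 f1 f2] [g0 g1 g2]; split; first exact: cont_atD.
  exact: power_seriesD f1 g1.
exact: power_seriesD f2 g2.
Qed.

Lemma regularM f g a : regular f a -> regular g a -> regular (fun z => f z * g z) a.
Proof.
move=> [f0 f1 f2] [g0 g1 g2]; split; first exact: cont_atM.
  exact: power_seriesM f1 g1.
exact: power_seriesM f2 g2.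
Qed.

Lemma regular_cst (c : C) a : regular (fun=> c) a.
Proof.
split; [|exact: power_series_cst..].
by move=> e e0; exists 1 => // z _; rewrite subrr modulus0.
Qed.

Lemma regular_fst a : regular fst a.
Proof.
split; [|exact: power_series_affine|exact: power_series_cst].
by move=> e e0; exists e => // z [].
Qed.

Lemma regular_snd a : regular snd a.
Proof.
split; [|exact: power_series_cst|exact: power_series_affine].
by move=> e e0; exists e => // z [].
Qed.

Lemma regular_translate f a (u : C * C) :
  regular f (a + u) -> regular (fun z => f (z + u)) a.
Proof.
move=> [cf f1 f2]; split.
- move=> e /cf[d d0 fd]; exists d => // z [z1 z2]; apply: fd.
  by split; rewrite /= opprD addrACA subrr addr0.
- by move: f1; congr power_series; apply/funext => w /=; congr f; congr pair; rewrite /= addrAC.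
- by move: f2; congr power_series; apply/funext => w /=; congr f; congr pair; rewrite /= addrAC.
Qed.

(** By induction along the segment: if phi vanishes near all earlier points, its
    zeros accumulate at the current one, where it is a power series. *)
Lemma segment_identity phi (b v : C) :
  (forall t : R, 0 <= t <= 1 -> power_series (fun w => phi (b + t%:C * v + w))) ->
  (forall e : R, 0 < e -> exists w, [/\ w != 0, modulus w < e & phi (b + w) = 0]) ->
  phi (b + v) = 0.
Proof.
move=> ps zeros; have [->|v0] := eqVneq v 0.
  have ps0 : power_series (fun w => phi (b + w)).
    have := ps 0; rewrite lexx ler01 => /(_ isT).
    by congr power_series; apply/funext => w; rewrite mul0r addr0.
  have [r r0 h] := power_series_zeros ps0 zeros.
  by apply: h; rewrite modulus0.
have mv : 0 < modulus v.
  by rewrite lt_def modulus_ge0 andbT; apply: contra_neq v0 => /modulus_eq0.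
suff [r r0 h] : exists2 r : R, 0 < r & forall w, modulus w < r -> phi (b + 1%:C * v + w) = 0.
  by have := h 0; rewrite modulus0 addr0 mul1r; exact.
apply: (@real_induction R (fun t : R => exists2 r : R, 0 < r &
    forall w, modulus w < r -> phi (b + t%:C * v + w) = 0)) => t t01 below.
have acc : forall e : R, 0 < e -> exists w,
    [/\ w != 0, modulus w < e & phi (b + t%:C * v + w) = 0].
  have [t0|t0] := eqVneq t 0.
    by move=> e /zeros[w [w0 we hw]]; exists w; split=> //; rewrite t0 mul0r addr0.
  move=> e e0; have tp : 0 < t by rewrite lt_def t0; case/andP: t01.
  (* a zero at an earlier point of the segment, at distance less than e *)
  pose h : R := Num.min t (e / 2 / modulus v).
  have h0 : 0 < h by rewrite lt_min tp !divr_gt0.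
  have [|r r0 hr] := below (t - h).
    by rewrite subr_ge0 ge_min lexx /= ltrBlDr ltrDl.
  exists (- (h%:C * v)); split.
  - rewrite oppr_eq0 mulf_neq0//; apply: contraTneq h0 => /(congr1 (@complex.Re R)) /= ->.
    by rewrite ltxx.
  - rewrite modulusN modulusM modulus_real gtr0_norm// -ltr_pdivlMr//.
    rewrite (@le_lt_trans _ _ (e / 2 / modulus v))//; first by rewrite ge_min lexx orbT.
    by rewrite ltr_pM2r ?invr_gt0// ltr_pdivrMr// mulr_natr mulr2n ltrDl.
  - have := hr 0; rewrite modulus0 => /(_ r0); rewrite addr0 => <-.
    by congr phi; rewrite rmorphB /=; ring.
have [r r0 hr] := power_series_zeros (ps t t01) acc.
exists (r / 2 / modulus v) => [|s /andP[s1 s2] _]; first by rewrite !divr_gt0.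
exists (r / 2) => [|w wr]; first by rewrite divr_gt0.
have -> : b + s%:C * v + w = b + t%:C * v + ((s - t)%:C * v + w).
  by rewrite rmorphB /=; ring.
apply: hr; apply: le_lt_trans (modulusD _ _) _.
rewrite [ltRHS]splitr ltrD// modulusM modulus_real -ltr_pdivlMr//.
by rewrite ltr_norml; apply/andP; split; lra.
Qed.

End RegularFunctions.

(** * Identity theorems *)
Section IdentityTheorems.
Variable R : realType.
Local Notation C := (R[i]^o).
Implicit Types (f g : C * C -> C) (a b z : C * C).

Lemma disc_convex (a b c : C) (rho t : R) : 0 <= t <= 1 ->
  modulus (b - a) < rho -> modulus (c - a) < rho ->
  modulus (b + t%:C * (c - b) - a) < rho.
Proof.
move=> /andP[t0 t1] ba ca.
have -> : b + t%:C * (c - b) - a = (1 - t)%:C * (b - a) + t%:C * (c - a).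
  by rewrite rmorphB /=; ring.
apply: le_lt_trans (modulusD _ _) _.
rewrite !modulusM !modulus_real !ger0_norm ?subr_ge0//.
have [->|tp] := eqVneq t 0; first by rewrite subr0 mul0r mul1r addr0.
have {}tp : 0 < t by rewrite lt_def tp.
have h1 : (1 - t) * modulus (b - a) <= (1 - t) * rho.
  by rewrite ler_wpM2l ?subr_ge0// ltW.
have h2 : t * modulus (c - a) < t * rho by rewrite ltr_pM2l.
by lra.
Qed.

Section OnPolydisc.
Variables (f : C * C -> C) (a : C * C) (rho : R).
Hypothesis rf : forall z, polydisc a rho z -> regular f z.

Lemma first_slice_identity (b1 z1 u : C) :
  polydisc a rho (b1, u) -> polydisc a rho (z1, u) ->
  (forall e : R, 0 < e -> exists w, [/\ w != 0, modulus w < e & f (b1 + w, u) = 0]) ->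
  f (z1, u) = 0.
Proof.
move=> [/= b1a ua] [/= z1a _] zeros.
rewrite -[z1](subrKC b1); apply: (segment_identity (phi := fun w => f (w, u))) => // t t01.
have [|_ + _] := rf (z := (b1 + t%:C * (z1 - b1), u)); last exact.
by split=> //=; exact: disc_convex.
Qed.

Lemma second_slice_identity (b2 z2 u : C) :
  polydisc a rho (u, b2) -> polydisc a rho (u, z2) ->
  (forall e : R, 0 < e -> exists w, [/\ w != 0, modulus w < e & f (u, b2 + w) = 0]) ->
  f (u, z2) = 0.
Proof.
move=> [/= ua b2a] [/= _ z2a] zeros.
rewrite -[z2](subrKC b2); apply: (segment_identity (phi := fun w => f (u, w))) => // t t01.
have [|_ _] := rf (z := (u, b2 + t%:C * (z2 - b2))); last exact.
by split=> //=; exact: disc_convex.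
Qed.

(** Vanishing is spread in the first variable for each value of the second one near
    that of b, and then in the second variable. *)
Lemma polydisc_identity b (e : R) : 0 < e -> polydisc a rho b ->
  (forall z, polydisc b e z -> polydisc a rho z -> f z = 0) ->
  forall z, polydisc a rho z -> f z = 0.
Proof.
move=> e0 ab fb [z1 z2] az.
have [d d0 bd] := polydisc_trans ab.
have near (c : R) : 0 < c -> exists w : C, [/\ w != 0, modulus w < c & modulus w < Num.min d e].
  move=> c0; pose h := Num.min c (Num.min d e) / 2.
  have m0 : 0 < Num.min c (Num.min d e) by rewrite !lt_min c0 d0.
  have h0 : 0 < h by rewrite divr_gt0.
  have hm : h < Num.min c (Num.min d e) by rewrite ltr_pdivrMr// mulr_natr mulr2n ltrDl.
  exists h%:C; rewrite modulus_real gtr0_norm//; split.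
  - by apply: contraTneq h0 => /(congr1 (@complex.Re R)) /= ->; rewrite ltxx.
  - by move: hm; rewrite lt_min => /andP[].
  - by move: hm; rewrite lt_min => /andP[].
have inb (w1 w2 : C) : modulus w1 < Num.min d e -> modulus w2 < Num.min d e ->
    polydisc a rho (b.1 + w1, b.2 + w2) /\ f (b.1 + w1, b.2 + w2) = 0.
  rewrite !lt_min => /andP[w1d w1e] /andP[w2d w2e].
  have ain : polydisc a rho (b.1 + w1, b.2 + w2).
    by apply: bd; split; rewrite /= addrC addKr.
  by split=> //; apply: fb => //; split; rewrite /= addrC addKr.
have m0 : modulus (0 : C) < Num.min d e by rewrite modulus0 lt_min d0.
have step (w2 : C) : modulus w2 < Num.min d e -> f (z1, b.2 + w2) = 0.
  move=> w2m; have [[/= in1 in2] _] := inb 0 w2 m0 w2m.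
  apply: (@first_slice_identity (b.1 + 0)); first by split.
    by split=> //=; case: az.
  move=> c /near[w [w0 wc wm]]; exists w; split=> //.
  by rewrite addr0; case: (inb w w2).
apply: (@second_slice_identity b.2).
- by split; [case: az|case: ab].
- exact: az.
- by move=> c /near[w [w0 wc wm]]; exists w; split=> //; exact: step.
Qed.

(** As for polydiscs; zeros with real coordinates suffice since in each variable
    they accumulate. *)
Lemma real_identity (b1 b2 e : R) : 0 < e -> a = (b1%:C, b2%:C) -> 0 < rho ->
  (forall s t : R, `|s - b1| < e -> `|t - b2| < e -> f (s%:C, t%:C) = 0) ->
  forall z, polydisc a rho z -> f z = 0.
Proof.
move=> e0 aE rho0 fe [z1 z2] az.
have near (c : R) : 0 < c -> exists h : R, [/\ 0 < h, h < c, h < e & h < rho].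
  move=> c0; exists (Num.min c (Num.min e rho) / 2).
  have m0 : 0 < Num.min c (Num.min e rho) by rewrite !lt_min c0 e0.
  have : Num.min c (Num.min e rho) / 2 < Num.min c (Num.min e rho).
    by rewrite ltr_pdivrMr// mulr_natr mulr2n ltrDl.
  by rewrite {2}/Num.min !lt_min => /and3P[? ? ?]; split=> //; rewrite divr_gt0.
have nz (h : R) : 0 < h -> h%:C != 0 :> C.
  by move=> h0; apply: contraTneq h0 => /(congr1 (@complex.Re R)) /= ->; rewrite ltxx.
have step (t : R) : `|t - b2| < e -> `|t - b2| < rho -> f (z1, t%:C) = 0.
  move=> te tr; have tin : modulus (t%:C - b2%:C) < rho.
    by rewrite -rmorphB modulus_real.
  apply: (@first_slice_identity b1%:C).
  - by rewrite aE; split=> //=; rewrite subrr modulus0.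
  - by move: az; rewrite aE => -[/= h _]; split.
  - move=> c /near[h [h0 hc he hr]]; exists h%:C.
    split; [exact: nz|by rewrite modulus_real gtr0_norm|].
    by rewrite -rmorphD; apply: fe => //; rewrite addrC addKr gtr0_norm.
apply: (@second_slice_identity b2%:C).
- by move: az; rewrite aE => -[/= h _]; split=> //=; rewrite subrr modulus0.
- exact: az.
- move=> c /near[h [h0 hc he hr]]; exists h%:C.
  split; [exact: nz|by rewrite modulus_real gtr0_norm|].
  by rewrite -rmorphD; apply: step; rewrite addrC addKr gtr0_norm.
Qed.

End OnPolydisc.

Definition dense_support (U : set (C * C)) g : Prop :=
  forall b (e : R), U b -> 0 < e -> exists z, [/\ U z, polydisc b e z & g z != 0].

(** The function D, which matters only on W, is meromorphic near a: it is h / g. *)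
Definition local_fraction (W : set (C * C)) (D : C * C -> C) a : Prop :=
  exists (rho : R) g h,
    [/\ 0 < rho, forall z, polydisc a rho z -> regular g z,
        forall z, polydisc a rho z -> regular h z,
        dense_support (polydisc a rho) g &
        forall z, polydisc a rho z -> (g z != 0 -> W z) /\ (W z -> g z * D z = h z)].

Lemma eq0_of_dense f U b : cont_at f b -> U b ->
  (forall e : R, 0 < e -> exists2 z, polydisc b e z & f z = 0) -> f b = 0.
Proof.
move=> cf Ub zeros; apply: modulus_eq0; apply/eqP.
rewrite eq_le modulus_ge0 andbT; apply/ler_addgt0Pl => e e0; rewrite addr0.
have [d d0 fd] := cf _ e0; have [z /fd + fz] := zeros _ d0.
by rewrite fz sub0r modulusN => /ltW.
Qed.

(** Along the straight path from b to the given point, if D vanishes near the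
    earlier points of the path, the numerator vanishes on an open part of a polydisc
    about the current point, hence on the polydisc; then D vanishes where the
    denominator does not, and everywhere by density and continuity. *)
Theorem meromorphic_identity (W : set (C * C)) (D : C * C -> C) b (e : R) :
  (forall z, W z -> exists2 d : R, 0 < d & polydisc z d `<=` W) ->
  (forall z, W z -> regular D z) -> (forall a, local_fraction W D a) ->
  0 < e -> (forall z, W z -> polydisc b e z -> D z = 0) ->
  forall z, W z -> D z = 0.
Proof.
move=> oW rD frac e0 Db z Wz.
pose gamma (t : R) : C * C := (b.1 + t%:C * (z.1 - b.1), b.2 + t%:C * (z.2 - b.2)).
suff [r r0 h] : exists2 r : R, 0 < r & forall y, W y -> polydisc (gamma 1) r y -> D y = 0.
  apply: h => //; rewrite /gamma !mul1r !subrKC -surjective_pairing.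
  exact: polydisc_center.
apply: (@real_induction R (fun t => exists2 r : R, 0 < r &
  forall y, W y -> polydisc (gamma t) r y -> D y = 0)).
move=> t t01 below.
(* a positive Lipschitz constant for the path *)
pose K : R := modulus (z.1 - b.1) + modulus (z.2 - b.2) + 1.
have K0 : 0 < K by rewrite ltr_pwDr// addr_ge0 ?modulus_ge0.
have gamma_close (s s' r : R) : 0 < r -> `|s - s'| < r / K -> polydisc (gamma s') r (gamma s).
  move=> r0; rewrite ltr_pdivlMr// => ss.
  have tri (u v : C) : modulus v <= K -> modulus (u + s%:C * v - (u + s'%:C * v)) < r.
    move=> vK; have -> : u + s%:C * v - (u + s'%:C * v) = (s - s')%:C * v.
      by rewrite rmorphB /=; ring.
    rewrite modulusM modulus_real (le_lt_trans _ ss)// ler_wpM2l//.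
  by split; apply: tri; rewrite /K; have := modulus_ge0 (z.1 - b.1);
    have := modulus_ge0 (z.2 - b.2); lra.
have [rho [g [h [rho0 rg rh dg gDh]]]] := frac (gamma t).
have [t1 [t1in [r1 r10 Dt1]]] : exists t1 : R, [/\ polydisc (gamma t) rho (gamma t1) &
    exists2 r : R, 0 < r & forall y, W y -> polydisc (gamma t1) r y -> D y = 0].
  have [t0|t0] := eqVneq t 0.
    exists 0; split; first by rewrite t0; exact: polydisc_center.
    exists e => // y Wy; rewrite /gamma !mul0r !addr0 -surjective_pairing; exact: Db.
  have tp : 0 < t by rewrite lt_def t0; case/andP: t01.
  pose d : R := Num.min t (rho / K / 2).
  have d0 : 0 < d by rewrite lt_min tp !divr_gt0.
  exists (t - d); split; last first.
    by apply: below; rewrite subr_ge0 ge_min lexx /= ltrBlDr ltrDl.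
  apply: gamma_close => //; rewrite addrC addKr normrN gtr0_norm//.
  rewrite (@le_lt_trans _ _ (rho / K / 2))//; first by rewrite ge_min lexx orbT.
  by rewrite ltr_pdivrMr// mulr_natr mulr2n ltrDl divr_gt0.
have h0 : forall y, polydisc (gamma t) rho y -> h y = 0.
  apply: (polydisc_identity rh r10 t1in) => y y1 yin.
  apply: eq0_of_dense (yin) _; first by case: (rh y yin).
  move=> c c0; have [d d0 yd] := polydisc_trans y1.
  have m0 : 0 < Num.min c d by rewrite lt_min c0.
  have [x [xin xm gx]] := dg y _ yin m0.
  have [xc xd] := polydisc_min xm.
  exists x => //; have [Wx gD] := gDh x xin.
  by rewrite -(gD (Wx gx)) Dt1 ?mulr0//; [exact: Wx|exact: yd].
exists (rho / K / 2) => [|s]; first by rewrite !divr_gt0.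
rewrite -ltr_distlC => st s0.
have sin : polydisc (gamma t) rho (gamma s).
  apply: gamma_close => //; rewrite distrC (lt_trans st)//.
  by rewrite ltr_pdivrMr// mulr_natr mulr2n ltrDl divr_gt0.
have [d d0 sd] := polydisc_trans sin.
exists d => // y Wy /sd yin.
apply: eq0_of_dense (Wy) _; first by case: (rD y Wy).
move=> c c0; have [d' d'0 yW] := oW y Wy.
have m0 : 0 < Num.min c d' by rewrite lt_min c0.
have [x [xin xm gx]] := dg y _ yin m0.
have [xc xd] := polydisc_min xm.
exists x => //; have [Wx gD] := gDh x xin.
have := gD (yW x xd); rewrite (h0 x xin) => /eqP; rewrite mulf_eq0 (negbTE gx).
by move/eqP.
Qed.

End IdentityTheorems.

(** * Absolutely convergent double power series *)
Section Bridge.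
Variable R : realType.
Local Notation C := (R[i]^o).
Implicit Types (f g : C * C -> C) (a b z : C * C) (U V : set (C * C)).

Lemma ge0_real (r : C) : 0 <= r -> r = (complex.Re r)%:C.
Proof. by case: r => x y; rewrite lecE /= => /andP[/eqP -> _]. Qed.

Lemma tends_le (u : nat -> C) (y : C) (B : R) :
  (forall N, modulus (u N) <= B) -> tends u y -> modulus y <= B.
Proof.
move=> uB uy; apply/ler_addgt0Pl => e e0.
have [N h] := uy e e0; have := h N (leqnn _) => /ltW le.
rewrite -[y](subrK (u N)) (le_trans (modulusD _ _))// modulusB.
exact: lerD.
Qed.

Lemma double_sum_axis (c : nat -> nat -> C) (w : C) N :
  \sum_(j < N) \sum_(k < N) c j k * w ^+ j * 0 ^+ k = \sum_(j < N) c j 0%N * w ^+ j.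
Proof.
apply: eq_bigr => j _; case: N j => [[]//|N] j.
rewrite big_ord_recl /= expr0 mulr1 big1 ?addr0// => k _.
by rewrite exprS mul0r mulr0.
Qed.

Lemma double_sum_axis2 (c : nat -> nat -> C) (w : C) N :
  \sum_(j < N) \sum_(k < N) c j k * 0 ^+ j * w ^+ k = \sum_(k < N) c 0%N k * w ^+ k.
Proof.
rewrite exchange_big /=; apply: eq_bigr => k _; case: N k => [[]//|N] k.
rewrite big_ord_recl /= expr0 mulr1 big1 ?addr0// => j _.
by rewrite exprS mul0r mulr0 mul0r.
Qed.

Lemma monomial_close (u v : C) (r x : R) (j k : nat) :
  0 < r -> 0 <= x <= 1 -> modulus u <= r * x -> modulus v <= r * x ->
  modulus (u ^+ j * v ^+ k - 0 ^+ j * 0 ^+ k) <= r ^+ j * r ^+ k * x.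
Proof.
move=> r0 /andP[x0 x1] ux vx.
have [jk|jk] := eqVneq (j + k)%N 0%N.
  move/eqP: jk; rewrite addn_eq0 => /andP[/eqP -> /eqP ->].
  by rewrite !expr0 subrr modulus0 !mulr1 mul1r.
rewrite -exprD expr0n (negbTE jk) subr0 modulusM !modulusX.
apply: (@le_trans _ _ ((r * x) ^+ j * (r * x) ^+ k)).
  by apply: ler_pM; rewrite ?exprn_ge0 ?modulus_ge0// lerXn2r// nnegrE
    ?modulus_ge0// mulr_ge0// ltW.
rewrite !exprMn mulrACA -exprD ler_wpM2l ?mulr_ge0 ?exprn_ge0 ?(ltW r0)//.
by rewrite -exprD -(prednK (n := j + k)) ?lt0n// exprS ler_piMr// exprn_ile1.
Qed.

(** On a coordinate line only the coefficients with one index 0 remain. Continuity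
    follows from absolute convergence, since on the polydisc of radius r x with
    x <= 1 each nonconstant term gains a factor x. *)
Lemma analytic_regular f a : analytic_at f a -> regular f a.
Proof.
move=> [c [rC [MC [rC0 cMC cf]]]].
pose r := complex.Re rC; have rE : rC = r%:C by exact: ge0_real (ltW rC0).
have r0 : 0 < r by rewrite -ltcR -rE.
pose M := complex.Re MC; have ME : MC = M%:C.
  by apply: ge0_real; have := cMC 0%N; rewrite big_ord0.
have cM N : \sum_(j < N) \sum_(k < N) modulus (c j k) * r ^+ j * r ^+ k <= M.
  have := cMC N; rewrite ME rE -lecR; apply: le_trans.
  rewrite rmorph_sum; apply: ler_sum => j _; rewrite rmorph_sum; apply: ler_sum => k _.
  by rewrite !rmorphM !rmorphXn /= modulusE.
have term_ge0 j k : 0 <= modulus (c j k) * r ^+ j * r ^+ k.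
  by rewrite !mulr_ge0 ?modulus_ge0 ?exprn_ge0 ?(ltW r0).
have M0 : 0 <= M by have := cM 0%N; rewrite big_ord0.
pose S z : nat -> C := fun N => \sum_(j < N) \sum_(k < N)
  c j k * (z.1 - a.1) ^+ j * (z.2 - a.2) ^+ k.
have Sf z : polydisc a r z -> tends (S z) (f z).
  by move=> [z1 z2]; apply: cvg_tends; apply: cf; rewrite modulusE rE ltcR.
split.
- move=> e e0; pose x := Num.min 1 (e / (M + 1) / 2).
  have M10 : 0 < M + 1 by rewrite ltr_pwDr.
  have x0 : 0 < x by rewrite lt_min ltr01 !divr_gt0.
  have x1 : x <= 1 by rewrite ge_min lexx.
  have rx : r * x <= r by rewrite ler_piMr// ltW.
  exists (r * x) => [|z zx]; first by rewrite mulr_gt0.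
  have fz := Sf z (polydisc_le rx zx); have fa := Sf a (polydisc_center a r0).
  have close : modulus (f z - f a) <= M * x.
    rewrite -[- f a]mulN1r.
    apply: tends_le (tendsD fz (tendsM (tends_cst (-1)) fa)) => N.
    rewrite /S mulN1r -sumrB; apply: le_trans (modulus_sum _ _ _) _.
    apply: le_trans (ler_wpM2r (ltW x0) (cM N)); rewrite mulr_suml.
    apply: ler_sum => j _; rewrite -sumrB; apply: le_trans (modulus_sum _ _ _) _.
    rewrite mulr_suml; apply: ler_sum => k _.
    rewrite !subrr -!mulrA -mulrBr modulusM ler_wpM2l ?modulus_ge0// mulrA.
    case: zx => z1 z2; apply: monomial_close => //; rewrite ?(ltW x0) ?x1 ?(ltW z1) ?(ltW z2)//.
  apply: le_lt_trans close _.
  have xe : x * (2 * (M + 1)) <= e.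
    rewrite -ler_pdivlMr ?mulr_gt0// [_ * (M + 1)]mulrC invfM mulrA.
    by rewrite ge_min lexx orbT.
  by nra.
- exists (fun j => c j 0%N), r, M; split=> // [N|w wr].
    apply: le_trans (cM N); case: N => [|N]; first by rewrite !big_ord0.
    apply: ler_sum => j _; rewrite big_ord_recl /= expr0 mulr1 lerDl.
    by apply: sumr_ge0.
  have /Sf : polydisc a r (a.1 + w, a.2).
    by split; rewrite /= ?(addrC a.1) ?addrK// subrr modulus0.
  congr tends; apply/funext => N; rewrite /S /partial_sum -double_sum_axis.
  by apply: eq_bigr => j _; apply: eq_bigr => k _; rewrite /= (addrC a.1) addrK subrr.
- exists (fun k => c 0%N k), r, M; split=> // [N|w wr].
    apply: le_trans (cM N); case: N => [|N]; first by rewrite !big_ord0.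
    rewrite [leRHS]big_ord_recl /= -[leLHS]addr0 lerD//.
      by apply: ler_sum => k _; rewrite expr0 mulr1.
    by apply: sumr_ge0 => j _; apply: sumr_ge0.
  have /Sf : polydisc a r (a.1, a.2 + w).
    by split; rewrite /= ?(addrC a.2) ?addrK// subrr modulus0.
  congr tends; apply/funext => N; rewrite /S /partial_sum -double_sum_axis2.
  by apply: eq_bigr => j _; apply: eq_bigr => k _; rewrite /= (addrC a.2) addrK subrr.
Qed.

Lemma open_polydisc U a : open U -> U a ->
  exists2 d : R, 0 < d & polydisc a d `<=` U.
Proof.
move=> oU Ua; have /nbhs_ballP[e /= e0 eU] : nbhs a U by exact: open_nbhs_nbhs.
have eE := ge0_real (ltW e0).
exists (complex.Re e); first by rewrite -ltcR -eE.
move=> z [z1 z2]; apply: eU; split; rewrite /= -ball_normE /= modulusE eE ltcR modulusB//.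
Qed.

Lemma polydisc_open b (e : R) : 0 < e -> exists V,
  [/\ open V, V b & V `<=` polydisc b e].
Proof.
move=> e0; have eC : 0 < e%:C :> C by rewrite ltcR.
exists (ball b e%:C)^°; split.
- exact: open_interior.
- exact: nbhsx_ballx.
- move=> z /interior_subset [z1 z2]; split.
    by move: z1; rewrite /= -ball_normE /= modulusE ltcR modulusB.
  by move: z2; rewrite /= -ball_normE /= modulusE ltcR modulusB.
Qed.

End Bridge.

(** * The identity at real parameters and its continuation *)
Section BaseIdentity.
Variables (R : realType) (n p : nat) (s : bool).
Local Notation C := (R[i]^o).
Local Notation m := (@ord_max n).
Variables (W W' : set (C * C)) (T T' : C * C -> endo_dist R n.+1).
Hypotheses (contT : kernel_continuation p s W T)
  (contT' : kernel_continuation p (~~ s) W' T').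

Definition Pop_factor (z : C * C) : C :=
  (z.1 + z.2 - n.+1%:R) * (z.2 - z.1 + 1) * (z.1 - n.+1%:R + p%:R - 1) * (z.1 - p%:R).

Lemma base_identity_real (l nu : R) (v : extform n.+1 (R^o)) I f :
  4 < l + nu - n.+1%:R -> 4 < - nu - 1 -> is_pform p v -> schwartz f ->
  Pop p l%:C (T (l%:C, nu%:C) (complexify v)) I f =
  Pop_factor (l%:C, nu%:C) * T' (l%:C - 1, nu%:C) (complexify v) I f.
Proof.
move=> a4 b4 vp sf.
have a2 : 2 < l + nu - n.+1%:R by lra.
have b2 : 2 < - nu - 1 by lra.
have a2' : 2 < l - 1 + nu - n.+1%:R by lra.
have rT := represents_continuation contT a2 b2 vp.
have rT' := represents_continuation contT' a2' b2 vp.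
have vp' := is_pform_int_ext m m vp.
have [_ ->//] := Pop_kfield a4 b4 vp' (int_basis_sqr m _) rT.
have -> : l%:C - 1 = (l - 1)%:C :> C by rewrite rmorphB.
pose c : R := (l + nu - n.+1%:R) * (nu - l + 1) * (l - n.+1%:R + p%:R - 1) * (l - p%:R).
have -> : Pop_factor (l%:C, nu%:C) = c%:C.
  by rewrite /c /Pop_factor /= !(rmorph_nat, rmorph1, rmorphN, rmorphM, rmorphD).
have [_ /(_ I f sf) <-] := representsZ c rT'.
by rewrite !fctE.
Qed.

Lemma region_base (l nu : R) : 4 < l + nu - n.+1%:R -> 4 < - nu - 1 ->
  W (l%:C, nu%:C) /\ W' (l%:C - 1, nu%:C).
Proof.
move=> a4 b4; have := ler0n R n.+1 => N0.
case: contT contT' => [_ regT _] [_ regT' _].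
by split; [apply: regT|apply: regT']; split=> /=; lra.
Qed.

(** Both sides are complex linear in the constant form, so real forms suffice. *)
Lemma base_identity (l nu : R) (w : extform n.+1 C) I f :
  4 < l + nu - n.+1%:R -> 4 < - nu - 1 -> is_pform p w -> schwartz f ->
  Pop p l%:C (T (l%:C, nu%:C) w) I f =
  Pop_factor (l%:C, nu%:C) * T' (l%:C - 1, nu%:C) w I f.
Proof.
move=> a4 b4 wp sf; have [WT WT'] := region_base a4 b4.
pose wr : extform n.+1 (R^o) := fun J => complex.Re (w J).
pose wi : extform n.+1 (R^o) := fun J => complex.Im (w J).
have wrp : is_pform p wr by move=> J /wp; rewrite /wr => ->.
have wip : is_pform p wi by move=> J /wp; rewrite /wi => ->.
have cwrp : is_pform p (complexify wr) by move=> J /wrp; rewrite /complexify => ->.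
have cwip : is_pform p (complexify wi) by move=> J /wip; rewrite /complexify => ->.
have wE : w = ('i%C : C) *: complexify wi + complexify wr.
  apply/funext => J; rewrite !fctE /complexify /wr /wi [LHS]complexE addrC.
  by rewrite /GRing.scale.
have [[_ tT _ _] _ _] := contT; have [[_ tT' _ _] _ _] := contT'.
have [linT _ _] := tT _ WT; have [linT' _ _] := tT' _ WT'.
rewrite wE linT'// mulrDr mulrCA -!base_identity_real//.
apply: (observable_linear _ (differential_op_Pop p I sf)).
by move=> J g sg; rewrite linT.
Qed.

End BaseIdentity.

Section Continuation.
Variables (R : realType) (n p : nat) (W : set (R[i]^o * R[i]^o))
  (T : R[i]^o * R[i]^o -> endo_dist R n.+1).
Local Notation C := (R[i]^o).
Hypothesis merT : meromorphic_family p W T.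
Variables (w : extform n.+1 C) (wp : is_pform p w).

Lemma observable_regular F z : observable F -> W z ->
  regular (fun y : C * C => F y.1 (T y w)) z.
Proof.
move=> oF Wz; have [_ _ hol _] := merT.
elim: oF => {F} [J g sg|F G _ IF _ IG|c F _ IF|F _ IF].
- exact/analytic_regular/(hol w J g wp sg).
- exact: regularD.
- exact: regularM (regular_cst c z) IF.
- exact: regularM (regular_fst z) IF.
Qed.

(** One denominator serves all components and test functions, hence all
    observables. *)
Lemma observable_fraction F (U : set (C * C)) (g : C * C -> C) : observable F ->
  (forall v J f, is_pform p v -> schwartz f -> exists2 h : C * C -> C,
     holomorphic_on U h & forall z, U z -> W z -> g z * T z v J f = h z) ->
  exists2 h : C * C -> C, forall z, U z -> regular h z &
    forall z, U z -> W z -> g z * F z.1 (T z w) = h z.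
Proof.
move=> oF frac.
elim: oF => {F} [J f sf|F G _ [h rh hE] _ [h' rh' hE']|c F _ [h rh hE]|F _ [h rh hE]].
- have [h hol hE] := frac w J f wp sf; exists h => // z Uz.
  exact/analytic_regular/hol.
- exists (fun z => h z + h' z) => [z Uz|z Uz Wz].
    exact: regularD (rh z Uz) (rh' z Uz).
  by rewrite mulrDr hE// hE'.
- exists (fun z => c * h z) => [z Uz|z Uz Wz].
    exact: regularM (regular_cst c z) (rh z Uz).
  by rewrite mulrCA hE.
- exists (fun z => z.1 * h z) => [z Uz|z Uz Wz].
    exact: regularM (regular_fst z) (rh z Uz).
  by rewrite mulrCA hE.
Qed.

End Continuation.

Section RegularFactor.
Variables (R : realType).
Local Notation C := (R[i]^o).

Lemma regularB (f g : C * C -> C) a : regular f a -> regular g a ->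
  regular (fun z => f z - g z) a.
Proof.
move=> rf rg; have := regularD rf (regularM (regular_cst (-1) a) rg).
by congr regular; apply/funext => z; rewrite mulN1r.
Qed.

Lemma regular_Pop_factor n p a : regular (@Pop_factor R n p) a.
Proof.
have f := regular_fst a; have g := regular_snd a.
have c (x : C) := regular_cst x a.
apply: regularM; last exact: regularB f (c _).
apply: regularM; last exact: regularB (regularD (regularB f (c _)) (c _)) (c _).
apply: regularM; last exact: regularD (regularB g f) (c _).
exact: regularB (regularD f g) (c _).
Qed.

Lemma nonzero_nearby (g : C * C -> C) z : cont_at g z -> g z != 0 ->
  exists2 d : R, 0 < d & forall y, polydisc z d y -> g y != 0.
Proof.
move=> cg gz; have m0 : 0 < modulus (g z).
  by rewrite lt_def modulus_ge0 andbT; apply: contra_neq gz => /modulus_eq0.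
have [d d0 gd] := cg _ m0; exists d => // y /gd; apply: contraTneq => ->.
by rewrite sub0r modulusN ltxx.
Qed.

Lemma polydisc_translate (a u z : C * C) (e : R) :
  polydisc (a + u) e (z + u) <-> polydisc a e z.
Proof.
have e1 : (z + u).1 - (a + u).1 = z.1 - a.1 by rewrite opprD addrACA subrr addr0.
have e2 : (z + u).2 - (a + u).2 = z.2 - a.2 by rewrite opprD addrACA subrr addr0.
by rewrite /polydisc /mkset e1 e2.
Qed.

End RegularFactor.

(* The dimension of the paper is n.+1; s = true is the upper sign. *)
Theorem theorem3p19 (R : realType) (n p : nat) (s : bool)
    (W W' : set (R[i]^o * R[i]^o))
    (T T' : R[i]^o * R[i]^o -> endo_dist R n.+1) :
  (2 <= n.+1)%N -> (p <= n.+1)%N ->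
  kernel_continuation p s W T ->
  kernel_continuation p (~~ s) W' T' ->
  forall l nu : R[i]^o, W (l, nu) -> W' (l - 1, nu) ->
  forall (w : extform n.+1 (R[i]^o)) (I : {set 'I_n.+1}) (f : 'rV[R]_n.+1 -> R),
    is_pform p w -> schwartz f ->
    Pop p l (T (l, nu) w) I f =
    (l + nu - n.+1%:R) * (nu - l + 1) * (l - n.+1%:R + p%:R - 1) * (l - p%:R)
    * T' (l - 1, nu) w I f.
Proof.
move=> _ _ contT contT' l nu Wl Wl' w I f wp sf.
(* the second family is evaluated at the translate by u *)
pose u : R[i]^o * R[i]^o := (-1, 0).
have shiftE z : (z.1 - 1, z.2) = z + u by rewrite /u [RHS]surjective_pairing /= addr0.
pose W0 : set (R[i]^o * R[i]^o) := [set z | W z /\ W' (z + u)].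
pose D (z : R[i]^o * R[i]^o) :=
  Pop p z.1 (T z w) I f - Pop_factor n p z * T' (z + u) w I f.
suff D0 : forall z, W0 z -> D z = 0.
  have := D0 (l, nu); rewrite /D -shiftE /= => /(_ (conj Wl _))/eqP.
  by rewrite subr_eq0 -shiftE => /(_ Wl')/eqP.
have oP J := @differential_op_Pop R n p J f sf.
have [[oW tT hT merT] regT intT] := contT.
have [[oW' tT' hT' merT'] regT' intT'] := contT'.
have mT : meromorphic_family p W T by [].
have mT' : meromorphic_family p W' T' by [].
have rD z : W0 z -> regular D z.
  move=> [Wz Wz']; apply: regularB; first exact: (observable_regular mT wp (oP I)).
  apply: regularM (regular_Pop_factor n p z) _.
  by apply: (regular_translate (f := fun y => T' y w I f)); exact/analytic_regular/hT'.
have openW0 z : W0 z -> exists2 d : R, 0 < d & polydisc z d `<=` W0.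
  move=> [Wz Wz'].
  have [d d0 dW] := open_polydisc oW Wz; have [d' d'0 dW'] := open_polydisc oW' Wz'.
  exists (Num.min d d') => [|y /polydisc_min[yd yd']]; first by rewrite lt_min d0.
  by split; [exact: dW|apply: dW'; apply/polydisc_translate].
have frac a : local_fraction W0 D a.
  have [U [g [[oU Ua] hg dg gW gT]]] := merT a.
  have [U' [g' [[oU' Ua'] hg' dg' gW' gT']]] := merT' (a + u).
  have [h rh hE] := observable_fraction wp (oP I) gT.
  have [h' rh' hE'] := gT' w I f wp sf.
  have [d d0 dU] := open_polydisc oU Ua; have [d' d'0 dU'] := open_polydisc oU' Ua'.
  pose rho := Num.min d d'.
  have inU z : polydisc a rho z -> U z by move=> /polydisc_min[/dU].
  have inU' z : polydisc a rho z -> U' (z + u).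
    by move=> /polydisc_min[_ zd']; apply: dU'; apply/polydisc_translate.
  have rg z : polydisc a rho z -> regular g z.
    by move=> /inU Uz; exact/analytic_regular/hg.
  have rg' z : polydisc a rho z -> regular (fun y => g' (y + u)) z.
    by move=> /inU' Uz; apply: regular_translate; exact/analytic_regular/hg'.
  exists rho, (fun z => g z * g' (z + u)),
    (fun z => g' (z + u) * h z - Pop_factor n p z * g z * h' (z + u)); split.
  - by rewrite lt_min d0.
  - by move=> z az; exact: regularM (rg z az) (rg' z az).
  - move=> z az; apply: regularB; first exact: regularM (rg' z az) (rh z (inU z az)).
    apply: regularM.
      exact: regularM (regular_Pop_factor n p z) (rg z az).
    by apply: regular_translate; exact/analytic_regular/rh'/inU'.
  (* a point where g is nonzero has a neighbourhood where it stays so, and in it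
     lies a point where the other factor is nonzero *)
  - move=> b e ab e0; have [r r0 br] := polydisc_trans ab.
    have m0 : 0 < Num.min r e by rewrite lt_min r0.
    have [V [oV Vb Vr]] := polydisc_open b m0.
    have [z [Uz Vz gz]] := dg b V (inU b ab) oV Vb.
    have bz := Vr z Vz; have [/br az bez] := polydisc_min bz.
    have [cg _ _] := rg z az.
    have [r1 r10 g_r1] := nonzero_nearby cg gz.
    have [r2 r20 zr2] := polydisc_trans bz.
    have m10 : 0 < Num.min r1 r2 by rewrite lt_min r10.
    have [V' [oV' Vz' Vr']] := polydisc_open (z + u) m10.
    have [y [Uy Vy gy]] := dg' (z + u) V' (inU' z az) oV' Vz'.
    have := Vr' y Vy; rewrite -[y](subrK u) => /polydisc_translate zy.
    have [/g_r1 gy1 /zr2 /polydisc_min[/br ay bey]] := polydisc_min zy.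
    by exists (y - u); split=> //; rewrite subrK mulf_neq0.
  - move=> z az; split.
      rewrite mulf_eq0 negb_or => /andP[gz gz'].
      by split; [exact: gW (inU z az) gz|exact: gW' (inU' z az) gz'].
    move=> [Wz Wz']; rewrite /D mulrBr -hE//; last exact: inU.
    by rewrite -hE'//; [ring|exact: inU'].
(* exponents 10 and 9 at the centre, hence above 4 on the polydisc of radius 1 *)
pose l0 : R := n.+1%:R + 20; pose nu0 : R := - 10.
pose b0 : R[i]^o * R[i]^o := (l0%:C, nu0%:C).
have Re_le (z : R[i]^o) : `|complex.Re z| <= modulus z.
  case: z => x y; rewrite /modulus normc_def /= -sqrtr_sqr ler_wsqrtr//.
  by rewrite lerDl sqr_ge0.
have b0W : polydisc b0 1 `<=` W0.
  move=> z [z1 z2].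
  have := le_lt_trans (Re_le _) z1; have := le_lt_trans (Re_le _) z2.
  have := ler0n R n.+1.
  case: z z1 z2 => -[x1 y1] [x2 y2] _ _ /= N0; rewrite !ltr_norml.
  rewrite /l0 /nu0 => /andP[h1 h2] /andP[h3 h4].
  by split; [apply: regT|apply: regT']; split=> /=; lra.
apply: (meromorphic_identity (b := b0) (e := 1)) => // z _.
apply: (@real_identity R D b0 1 _ l0 nu0 1) => //.
  by move=> y /b0W; exact: rD.
move=> x y; rewrite !ltr_norml /l0 /nu0 => /andP[h1 h2] /andP[h3 h4].
have N0 := ler0n R n.+1.
rewrite /D -shiftE /= (base_identity contT contT')// ?subrr//; lra.
Qed.
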